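(* Let $\Omega$ be a connected Stein manifold, let $\varphi:\Omega\to\Omega$ be holomorphic, and let $(n_l)_{l\in\mathbb{N}}$ be an increasing sequence of natural numbers. Suppose that $\varphi$ is injective and that $\varphi(\Omega)$ is a Runge domain with respect to $\Omega$. If there exists a point $z_0\in\Omega$ such that $$\lim_{l\to\infty}c_{\Omega}(z_0,\varphi^{[n_l]}(z_0))=\infty,$$ then the operator $C_\varphi$ is hereditarily hypercyclic with respect to $(n_l)_l$.
   Context: A Stein manifold is a complex analytic manifold $\Omega$ of finite dimension $N$ such that: $\Omega$ has an exhaustion by compact sets $K_l$ with $K_l\subset\operatorname{int}K_{l+1}$ and $\bigcup_l K_l=\Omega$; the holomorphic hull $\widehat{K}_\Omega=\{z\in\Omega: |f(z)|\le\sup_K|f| \text{ for every } f\in\mathcal{O}(\Omega)\}$ of every compact set $K\subset\Omega$ is compact; holomorphic functions on $\Omega$ separate points; and for each $z\in\Omega$ some holomorphic map $F:\Omega\to\mathbb{C}^N$ has invertible derivative at $z$. $\mathcal{O}(\Omega)$ is the space of holomorphic functions $\Omega\to\mathbb{C}$ with the topology of uniform convergence on compact sets. $C_\varphi:\mathcal{O}(\Omega)\to\mathcal{O}(\Omega)$ is $C_\varphi(f)=f\circ\varphi$. For a self-map $T$, $T^{[n]}$ denotes its $n$-th iterate. ''Increasing'' means strictly increasing. $\mathbb{D}$ is the open unit disc in $\mathbb{C}$. For $z,w\in\Omega$ put $c_\Omega^*(z,w)=\sup\{|F(z)|: F:\Omega\to\mathbb{D}\text{ holomorphic}, F(w)=0\}$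 and $c_\Omega(z,w)=\frac12\log\frac{1+c_\Omega^*(z,w)}{1-c_\Omega^*(z,w)}$ (the Carathéodory pseudodistance). A domain $U\subset\Omega$ is a Runge domain with respect to $\Omega$ if every function in $\mathcal{O}(U)$ can be approximated locally uniformly on $U$ by functions from $\mathcal{O}(\Omega)$. A sequence $(T_l)_l$ of continuous self-maps of a topological space $X$ is universal if there is $x\in X$ with $\{T_l(x): l\in\mathbb{N}\}$ dense in $X$; it is hereditarily universal if each of its subsequences is universal. A continuous linear operator $T$ on a topological vector space is hereditarily hypercyclic with respect to $(n_l)_l$ if $(T^{[n_l]})_l$ is hereditarily universal. *)

(* Defs.v *)
From HB Require Import structures.
From mathcomp Require Import all_boot all_order all_algebra.
From mathcomp Require Import complex.
From mathcomp Require Import all_classical all_reals all_analysis.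

Set Implicit Arguments.
Unset Strict Implicit.
Unset Printing Implicit Defensive.

Import Order.TTheory GRing.Theory Num.Theory.
Import numFieldNormedType.Exports.

Local Open Scope classical_set_scope.
Local Open Scope ring_scope.

(* [R[i]] seen as an abstract [numFieldType], so that the topology, the norm and
   the normed-module structures of [numFieldNormedType] apply to it. The norm
   [`|z|] takes its values in [R[i]]; [modulus] is its real-valued version. *)
Definition Cplx (R : realType) : numFieldType := R[i].

Definition modulus (R : realType) (z : Cplx R) : R :=
  ComplexField.Normc.normc (z : R[i]).

(* A chart is a homeomorphism between the open sets [chart_dom c] and
   [c @` chart_dom c]; the values of [c] and [chart_inv c] elsewhere are junk. *)
Record chart (R : realType) (N : nat) (M : topologicalType) := Chart {
  chart_dom : set M;
  chart_map :> M -> 'rV[Cplx R]_N;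
  chart_inv : 'rV[Cplx R]_N -> M }.

Definition is_chart (R : realType) (N : nat) (M : topologicalType)
    (c : chart R N M) : Prop :=
  [/\ open (chart_dom c),
      open (c @` chart_dom c),
      forall z, chart_dom c z -> chart_inv c (c z) = z,
      forall z, chart_dom c z -> {for z, continuous c} &
      forall x, (c @` chart_dom c) x -> {for x, continuous (chart_inv c)}].

Record complexManifold (R : realType) (N : nat) := ComplexManifold {
  cm_sort :> topologicalType;
  atlas : set (chart R N cm_sort);
  cm_hausdorff : hausdorff_space cm_sort;
  atlas_chart : forall c, atlas c -> is_chart c;
  atlas_cover : forall z, exists2 c, atlas c & chart_dom c z;
  (* [differentiable] is Frechet differentiability over the field [Cplx R]:
     the transition maps are holomorphic. *)
  atlas_holo : forall c d, atlas c -> atlas d ->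
    forall z, chart_dom c z -> chart_dom d z ->
    differentiable (d \o chart_inv c) (c z) }.

Section Holomorphic.
Context {R : realType} {N : nat}.
Implicit Types M : complexManifold R N.

(* For an open [U], the elements of O(U) are represented by functions on all of
   [M] whose values outside [U] are irrelevant. *)
Definition holomorphic_on M (W : normedModType (Cplx R)) (U : set M)
    (f : M -> W) : Prop :=
  forall c, atlas c -> forall z, U z -> chart_dom c z ->
    differentiable (f \o chart_inv c) (c z).

Definition holomorphic M (W : normedModType (Cplx R)) (f : M -> W) : Prop :=
  holomorphic_on [set: M] f.

Definition holomorphic_map M (N' : nat) (M' : complexManifold R N')
    (phi : M -> M') : Prop :=
  continuous phi /\
  forall c c', atlas c -> atlas c' ->
  forall z, chart_dom c z -> chart_dom c' (phi z) ->
    differentiable (c' \o phi \o chart_inv c) (c z).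

Definition holomorphic_hull M (K : set M) : set M :=
  [set z | forall f : M -> Cplx R, holomorphic f ->
     modulus (f z) <= sup [set modulus (f w) | w in K]].

Definition has_compact_exhaustion (T : topologicalType) : Prop :=
  exists K : nat -> set T,
    [/\ forall l, compact (K l),
        forall l, K l `<=` interior (K l.+1) &
        \bigcup_l K l = [set: T]].

Definition stein M : Prop :=
  [/\ has_compact_exhaustion M,
      forall K : set M, compact K -> compact (holomorphic_hull K),
      forall z w : M, z <> w ->
        exists2 f : M -> Cplx R, holomorphic f & f z <> f w &
      forall z : M, exists2 F : M -> 'rV[Cplx R]_N, holomorphic F &
        forall c, atlas c -> chart_dom c z ->
          bijective ('d (F \o chart_inv c) (c z))].

Definition caratheodory_star M (z w : M) : R :=
  sup [set r | exists F : M -> Cplx R,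
         [/\ holomorphic F, forall x, modulus (F x) < 1,
             F w = 0 & r = modulus (F z)]].

Definition caratheodory M (z w : M) : R :=
  2^-1 * ln ((1 + caratheodory_star z w) / (1 - caratheodory_star z w)).

(* On a manifold, which is locally compact, locally uniform approximation on the
   open set [U] is uniform approximation on the compact subsets of [U]. *)
Definition runge_domain M (U : set M) : Prop :=
  [/\ open U, connected U, U !=set0 &
      forall g : M -> Cplx R, holomorphic_on U g ->
      forall K : set M, compact K -> K `<=` U -> forall e : R, 0 < e ->
      exists2 f : M -> Cplx R, holomorphic f &
        forall z, K z -> modulus (f z - g z) < e].

End Holomorphic.

Section Differentiability.
Context {K : numFieldType} {V W : normedModType K}.

Lemma near_eq_differentiable (f g : V -> W) (x : V) :
  (\forall y \near x, f y = g y) -> differentiable f x -> differentiable g x.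
Proof.
move=> fg df.
have fgx : f x = g x by exact: (nbhs_singleton fg).
have dg : g \o shift x = cst (g x) + 'd f x +o_ 0 id.
  apply/eqaddoP => _/posnumP[e].
  have /diff_locally/eqaddoP/(_ _ (gt0 e)) := df.
  have : \forall h \near (0 : V), f (h + x) = g (h + x).
    by move: fg; rewrite (near_shift 0) subr0 /=.
  by apply: filterS2 => h /= fgh; rewrite !fctE /= fgh fgx.
have dE := diff_unique (diff_continuous df) dg.
by apply/diff_locallyP; rewrite dE; split => //; exact: diff_continuous.
Qed.

End Differentiability.

Section HolomorphicTheory.
Context {R : realType} {N : nat}.
Implicit Types M : complexManifold R N.

Lemma near_chart_inv M (c : chart R N M) (z : M) (P : set M) :
  atlas c -> chart_dom c z -> nbhs z P ->
  \forall x \near c z, P (chart_inv c x).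
Proof.
move=> /atlas_chart[_ _ cK _ ci] cz Pz.
have := ci (c z) (ex_intro2 _ _ z cz erefl).
by rewrite /prop_for /continuous_at cK //; exact.
Qed.

Lemma holomorphic_continuous M (W : normedModType (Cplx R)) (f : M -> W) :
  holomorphic f -> continuous f.
Proof.
move=> hf z; have [c ac cz] := atlas_cover z.
have [co _ cK cc _] := atlas_chart ac.
have fc : {for z, continuous ((f \o chart_inv c) \o c)}.
  apply: continuous_comp; first exact: cc.
  exact: differentiable_continuous (hf c ac z I cz).
move=> A Az; have fA : nbhs z (((f \o chart_inv c) \o c) @^-1` A).
  by apply: fc; rewrite /= cK.
have dz : nbhs z (chart_dom c) by exact: open_nbhs_nbhs.
by move: dz fA; apply: filterS2 => y dy; rewrite /preimage /= cK.
Qed.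

Lemma holomorphic_comp M (N' : nat) (M' : complexManifold R N')
    (W : normedModType (Cplx R)) (phi : M -> M') (f : M' -> W) :
  holomorphic_map phi -> holomorphic f -> holomorphic (f \o phi).
Proof.
move=> [pc ph] hf c ac z _ cz.
have [d ad dz] := atlas_cover (phi z).
have [do_ _ dK _ _] := atlas_chart ad.
have [_ _ cK _ _] := atlas_chart ac.
apply: (@near_eq_differentiable _ _ _
  ((f \o chart_inv d) \o (d \o phi \o chart_inv c))).
  apply: (near_chart_inv (P := fun w => f (chart_inv d (d (phi w))) = f (phi w))
    ac cz).
  have : \forall w \near z, chart_dom d (phi w).
    by apply: pc; exact: open_nbhs_nbhs.
  by apply: filterS => w dw; rewrite dK.
apply: differentiable_comp; first exact: ph.
rewrite /= cK //; exact: hf.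
Qed.

End HolomorphicTheory.

(* O(M), topologized by uniform convergence on compact sets. *)
Section HolomorphicFunctions.
Context {R : realType} {N : nat} (M : complexManifold R N).

Definition holo_pred : {pred M -> Cplx R} :=
  fun f => `[< holomorphic f >].

Lemma holo_submod : submod_closed holo_pred.
Proof.
split=> [|a f g /asboolP hf /asboolP hg]; apply/asboolP => c ac z Uz cz.
  exact: differentiable_cst.
apply: differentiableD; last exact: hg.
by apply: differentiableZ; exact: hf.
Qed.

HB.instance Definition _ := GRing.isSubmodClosed.Build (Cplx R) (M -> Cplx R)
  holo_pred holo_submod.

Record holoFun := HoloFun {
  holo_val :> M -> Cplx R;
  holo_valP : holo_val \in holo_pred }.

HB.instance Definition _ := [isSub for holo_val].
HB.instance Definition _ := [Choice of holoFun by <:].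
HB.instance Definition _ :=
  [SubChoice_isSubLmodule of holoFun by <:].

Definition holo_fam (f : holoFun) : {family compact, M -> Cplx R} :=
  holo_val f.

HB.instance Definition _ :=
  Topological.copy holoFun (initial_topology holo_fam).

Lemma holo_holomorphic (f : holoFun) : holomorphic f.
Proof. by case: f => f /= /asboolP. Qed.

Lemma near_holo (f : holoFun) (K : set M) (e : Cplx R) :
  compact K -> 0 < e ->
  nbhs f [set g : holoFun | forall y, K y -> `|f y - g y| < e].
Proof.
move=> cK e0.
apply: (@initial_continuous _ _ holo_fam f
  [set g | forall y, K y -> `|f y - g y| < e]).
apply: (@fam_nbhs _ _ compact K [set xy | ball xy.1 e xy.2] (holo_fam f)) => //.
exact: entourage_ball (PosNum e0).
Qed.

Lemma continuous_holo (T : topologicalType) (F : T -> holoFun) (t : T) :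
  (forall (K : set M) (e : Cplx R), compact K -> 0 < e ->
    \forall s \near t, forall y, K y -> `|F t y - F s y| < e) ->
  {for t, continuous F}.
Proof.
move=> H.
suff h : (holo_fam \o F) x @[x --> t] --> holo_fam (F t).
  move=> U [?/= [[W oW <-]]] /= WF /filterS; apply; apply: h.
  exact: open_nbhs_nbhs.
apply/fam_cvgP => K cK P /uniform_nbhs[E [entE EP]].
move: entE; rewrite -entourage_ballE => -[e /= e0 eE].
have := H K e cK e0; apply: filterS => s Hs; apply: EP => y Ky.
by apply: eE; exact: Hs.
Qed.

Lemma holo_add_continuous :
  continuous (fun x : holoFun * holoFun => x.1 + x.2).
Proof.
move=> [f g]; apply: continuous_holo => K e cK e0.
have e20 : 0 < e / 2 by rewrite divr_gt0.
exists ([set f' : holoFun | forall y, K y -> `|f y - f' y| < e / 2],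
        [set g' : holoFun | forall y, K y -> `|g y - g' y| < e / 2]).
  by split; exact: near_holo.
move=> [f' g'] /= [hf hg] y Ky.
rewrite [X in `|X|](_ : _ = (f y - f' y) + (g y - g' y)); last first.
  by rewrite opprD addrACA.
by rewrite (le_lt_trans (ler_normD _ _))// (splitr e) ltrD ?hf ?hg.
Qed.

HB.instance Definition _ :=
  PreTopologicalNmodule_isTopologicalNmodule.Build holoFun holo_add_continuous.

Lemma holo_bounded (f : holoFun) (K : set M) :
  compact K -> exists2 B : Cplx R, 0 < B & forall y, K y -> `|f y| <= B.
Proof.
move=> /compact_near_coveringP cK.
have H : \forall B \near +oo, K `<=` [set y | `|f y| <= B].
  apply: (cK _ _ (fun B y => `|f y| <= B)) => x Kx.
  exists ([set y | `|f x - f y| < 1], [set B | `|f x| + 1 <= B]).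
    split => /=; last first.
      by apply: nbhs_pinfty_ge; rewrite realD ?normr_real ?real1.
    by have /cvgr_dist_lt/(_ _ ltr01) := holomorphic_continuous
      (holo_holomorphic f) (x := x).
  move=> [y B] /= [fxy]; apply: le_trans.
  rewrite -[f y](subKr (f x)) (le_trans (ler_normB _ _))// lerD2l.
  exact: ltW.
have P : \forall B \near +oo, 0 < (B : Cplx R).
  by apply: nbhs_pinfty_gt; exact: real0.
have [B [B0 KB]] := filter_ex (filterI P H).
by exists B.
Qed.

Lemma holo_scale_continuous :
  continuous (fun z : (Cplx R)^o * holoFun => z.1 *: z.2).
Proof.
move=> [a f]; apply: continuous_holo => K e cK e0.
have [B B0 fB] := holo_bounded f cK.
have a1 : 0 < `|a| + 1 by rewrite ltr_wpDl.
have eB : 0 < e / 2 / B by rewrite !divr_gt0.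
have ea : 0 < e / 2 / (`|a| + 1) by rewrite !divr_gt0.
exists ([set b | `|a - b| < e / 2 / B] `&` [set b | `|a - b| < 1],
        [set g : holoFun | forall y, K y -> `|f y - g y| < e / 2 / (`|a| + 1)]).
  split; last exact: near_holo.
  by apply: filterI; [exact: (nbhsx_ballx a _ eB)|exact: (nbhsx_ballx a _ ltr01)].
move=> [b g] /= [[ab ab1] fg] y Ky.
rewrite [X in `|X|](_ : _ = (a - b) * f y + b * (f y - g y)); last first.
  by rewrite mulrBl mulrBr addrA subrK.
rewrite (le_lt_trans (ler_normD _ _))// (splitr e) ler_ltD// normrM.
  have -> : e / 2 = e / 2 / B * B by rewrite divfK ?gt_eqF.
  by rewrite ler_pM// ?fB// ltW.
have b1 : `|b| < `|a| + 1.
  rewrite -[b](subKr a) (le_lt_trans (ler_normB _ _))// ltrD2l//.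
rewrite (@le_lt_trans _ _ ((`|a| + 1) * `|f y - g y|))//.
  by rewrite ler_wpM2r// ltW.
by rewrite mulrC -ltr_pdivlMr// fg.
Qed.

HB.instance Definition _ :=
  TopologicalNmodule_isTopologicalLmodule.Build (Cplx R) holoFun
    holo_scale_continuous.

End HolomorphicFunctions.

Section CompositionOperator.
Context {R : realType} {N : nat} {M : complexManifold R N}.
Context {phi : M -> M} (hphi : holomorphic_map phi).

Lemma comp_op_subproof (f : holoFun M) : f \o phi \in @holo_pred R N M.
Proof. by apply/asboolP/holomorphic_comp => //; exact: holo_holomorphic. Qed.

Definition comp_op (f : holoFun M) : holoFun M := HoloFun (comp_op_subproof f).

Lemma comp_op_linear : linear comp_op.
Proof. by move=> a f g; exact/val_inj. Qed.

HB.instance Definition _ :=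
  GRing.isLinear.Build (Cplx R) (holoFun M) (holoFun M) _ comp_op comp_op_linear.

Lemma comp_op_continuous : continuous comp_op.
Proof.
move=> f; apply: continuous_holo => K e cK e0.
have cphiK : compact (phi @` K).
  by apply: continuous_compact => //; exact/continuous_subspaceT/(proj1 hphi).
apply: filterS (near_holo f cphiK e0) => g fg y Ky.
by apply: fg; exists y.
Qed.

End CompositionOperator.

Definition universal (X : topologicalType) (T : nat -> X -> X) : Prop :=
  (forall l, continuous (T l)) /\ exists x : X, dense (range (fun l => T l x)).

Definition hereditarily_universal (X : topologicalType) (T : nat -> X -> X) :
    Prop :=
  forall k : nat -> nat, increasing_seq k -> universal (fun l => T (k l)).

Definition hereditarily_hypercyclic (K : numFieldType)
    (X : topologicalLmodType K) (T : {linear X -> X}) (n : nat -> nat) : Prop :=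
  continuous T /\ hereditarily_universal (fun l => iter (n l) T).

(* Main.v *)
Require Import Defs.
From HB Require Import structures.
From mathcomp Require Import all_boot all_order all_algebra.
From mathcomp Require Import complex.
From mathcomp Require Import all_classical all_reals all_analysis.
From mathcomp Require Import ring lra.

Set Implicit Arguments.
Unset Strict Implicit.
Unset Printing Implicit Defensive.

Import Order.TTheory GRing.Theory Num.Theory.
Import numFieldNormedType.Exports.

Local Open Scope classical_set_scope.
Local Open Scope ring_scope.

(** If [F : Omega -> D] vanishes at [phi^n z0] and [1 - |F z0|] is small then, after
    a rotation, Harnack's inequality makes [1 - F] small on any given compact set
    [K], while the same inequality applied to [F \o phi^n] keeps [|F|] away from 1 on
    [phi^n K]. A power of [F] followed by iterates of the polynomial [3x^2 - 2x^3]
    is then close to 1 on [K] and close to 0 on [phi^n K]. Since [phi] is a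
    biholomorphism onto its image (Osgood) and the image is Runge, every [h] has some
    [h'] in O(Omega) with [h' \o phi^n] close to [h] on [K], so [chi g + (1 - chi) h']
    is close to [g] on [K] and its composition with [phi^n] is close to [h] on [K].
    This holds for all large indices; O(Omega) being separable, a universal function
    is obtained as the limit of a sequence of such corrections. *)

(** The accuracy of the cut-off has to be fixed in two stages. Harnack's constant for [K] determines
    an exponent and a threshold, and these determine how large the index must be; the correction
    [h'] exists only once the index is known, and nothing bounds its size on [K] and on [phi^n K] in
    advance. A power of [F] alone therefore cannot make the error small. The fixed accuracy 1/10
    that it provides lies inside the basins of the superattracting points 0 and 1 of [3x^2 - 2x^3],
    so the number of iterations can be chosen last. The function theory rests on one estimate:
    [|u a|] is at most four times a bound of [|u|] on an annulus around [a], which follows from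
    Goursat's theorem on squares. It yields Cauchy estimates, the Weierstrass theorem (for the limit
    of the corrections), a form of Hurwitz's theorem and, applied to reciprocals of difference
    quotients, the one-variable case of Osgood's theorem. Constants such as 24 and 96 are not sharp;
    only their uniformity matters. *)

(** * Real-valued norms, coordinates and first-order estimates *)

Section RealNorm.
Context {R : realType}.
Local Notation C := (Cplx R).

(* [`|x|] takes values in [Cplx R]; this is its real part, hence the real norm. *)
Definition nrm (V : normedModType C) (x : V) : R := complex.Re (`|x| : R[i]).

Definition toC (x : R) : C := (x%:C)%C.
Definition mkC (x y : R) : C := (x +i* y)%C.
Definition reC (z : C) : R := complex.Re (z : R[i]).
Definition imC (z : C) : R := complex.Im (z : R[i]).

Section Generic.
Variable V : normedModType C.
Implicit Types x y : V.

Lemma nrmE x : `|x| = toC (nrm x).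
Proof.
have : (0 : R[i]) <= (`|x| : R[i]) by exact: normr_ge0.
by rewrite /toC /nrm lecE /= => /andP[/eqP h _]; case: (`|x| : R[i]) h => a b /= ->.
Qed.

Lemma toC_le (a b : R) : (toC a <= toC b) = (a <= b).
Proof. exact: lecR. Qed.

Lemma toC_lt (a b : R) : (toC a < toC b) = (a < b).
Proof. exact: ltcR. Qed.

Lemma toC_gt0 (a : R) : (0 < toC a) = (0 < a).
Proof. exact: (toC_lt 0). Qed.

(** The order of [R[i]] only compares numbers with equal imaginary parts, so every positive radius
    is real. *)
Lemma posC (e : C) : 0 < e -> 0 < reC e /\ e = toC (reC e).
Proof.
rewrite /toC /reC => e0; have : (0 : R[i]) < (e : R[i]) by exact: e0.
by case: {e0} (e : R[i]) => a b; rewrite ltcE /= => /andP[/eqP -> ->].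
Qed.

Lemma toCD (a b : R) : toC (a + b) = toC a + toC b.
Proof. exact: (raddfD (real_complex R)). Qed.

Lemma toCM (a b : R) : toC (a * b) = toC a * toC b.
Proof. exact: (rmorphM (real_complex R)). Qed.

Lemma toC_inj : injective toC.
Proof. by move=> a b []. Qed.

Lemma nrm_ge0 x : 0 <= nrm x.
Proof. by rewrite -toC_le -nrmE normr_ge0. Qed.

Lemma nrm0 : nrm (0 : V) = 0.
Proof. by apply: toC_inj; rewrite -nrmE normr0. Qed.

Lemma nrm_eq0 x : (nrm x == 0) = (x == 0).
Proof.
apply/eqP/eqP => [h|->]; last exact: nrm0.
by apply/eqP; rewrite -normr_eq0 nrmE h.
Qed.

Lemma nrm_gt0 x : (0 < nrm x) = (x != 0).
Proof. by rewrite lt_def nrm_ge0 andbT nrm_eq0. Qed.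

Lemma nrmD x y : nrm (x + y) <= nrm x + nrm y.
Proof. by rewrite -toC_le toCD -!nrmE ler_normD. Qed.

Lemma nrmN x : nrm (- x) = nrm x.
Proof. by apply: toC_inj; rewrite -!nrmE normrN. Qed.

Lemma nrm_distC x y : nrm (x - y) = nrm (y - x).
Proof. by rewrite -nrmN opprB. Qed.

Lemma nrmB x y : nrm (x - y) <= nrm x + nrm y.
Proof. by rewrite -(nrmN y) nrmD. Qed.

Lemma nrmBD x y z : nrm (x - z) <= nrm (x - y) + nrm (y - z).
Proof. by rewrite (le_trans _ (nrmD _ _)) // addrA subrK. Qed.

Lemma ler_nrmB x y : nrm x - nrm y <= nrm (x - y).
Proof. by rewrite lerBlDr (le_trans _ (nrmD _ _)) // subrK. Qed.

Lemma nrmZ (a : C) x : nrm (a *: x) = nrm a * nrm x.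
Proof. by apply: toC_inj; rewrite toCM -!nrmE normrZ. Qed.

Lemma nbhs_nrmP x (A : set V) :
  nbhs x A <-> exists2 e : R, 0 < e & forall y, nrm (y - x) < e -> A y.
Proof.
split.
  move=> /nbhs_ballP[e /= /posC[e1 ->] eA].
  exists (reC e) => // y yx; apply: eA.
  by rewrite -ball_normE /ball_ /= distrC nrmE toC_lt.
move=> [e e0 eA]; apply/nbhs_ballP; exists (toC e); first by rewrite /= toC_gt0.
by move=> y; rewrite -ball_normE /ball_ /= distrC nrmE toC_lt; exact: eA.
Qed.

End Generic.

Lemma modulusE (z : C) : modulus z = nrm z.
Proof.
by apply: toC_inj; rewrite -nrmE.
Qed.

Lemma nrmM (a b : C) : nrm (a * b) = nrm a * nrm b.
Proof. by apply: toC_inj; rewrite toCM -!nrmE normrM. Qed.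

Lemma nrm1 : nrm (1 : C) = 1.
Proof. by apply: toC_inj; rewrite -nrmE normr1. Qed.

Lemma nrmV (a : C) : nrm (a^-1) = (nrm a)^-1.
Proof.
have [->|a0] := eqVneq a 0; first by rewrite invr0 nrm0 invr0.
have n0 : nrm a != 0 by rewrite nrm_eq0.
by apply: (mulfI n0); rewrite -nrmM !divff // nrm1.
Qed.

Lemma nrmX (a : C) k : nrm (a ^+ k) = nrm a ^+ k.
Proof. by elim: k => [|k IH]; rewrite ?expr0 ?nrm1 // !exprS nrmM IH. Qed.

Lemma nrm_toC (x : R) : nrm (toC x) = `|x|.
Proof.
by rewrite -modulusE /modulus /toC /= expr0n addr0 sqrtr_sqr.
Qed.

Lemma nrm_mkC (x y : R) : nrm (mkC x y) ^+ 2 = x ^+ 2 + y ^+ 2.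
Proof.
by rewrite -modulusE /modulus /mkC /= sqr_sqrtr // addr_ge0 ?sqr_ge0.
Qed.

Lemma mkC_eta (z : C) : mkC (reC z) (imC z) = z.
Proof. by rewrite /mkC /reC /imC; case: (z : R[i]). Qed.

Lemma nrm_re_im (z : C) : nrm z ^+ 2 = reC z ^+ 2 + imC z ^+ 2.
Proof. by rewrite -{1}(mkC_eta z) nrm_mkC. Qed.

Lemma reC_le (z : C) : `|reC z| <= nrm z.
Proof.
rewrite -(@ler_pXn2r _ 2) ?nnegrE ?nrm_ge0 // nrm_re_im real_normK ?num_real //.
by rewrite lerDl sqr_ge0.
Qed.

Lemma imC_le (z : C) : `|imC z| <= nrm z.
Proof.
rewrite -(@ler_pXn2r _ 2) ?nnegrE ?nrm_ge0 // nrm_re_im real_normK ?num_real //.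
by rewrite lerDr sqr_ge0.
Qed.

Lemma nrm_le_re_im (z : C) : nrm z <= `|reC z| + `|imC z|.
Proof.
rewrite -(@ler_pXn2r _ 2) ?nnegrE ?nrm_ge0 ?addr_ge0 // nrm_re_im sqrrD.
rewrite !real_normK ?num_real // lerD2r lerDl mulrn_wge0 // mulr_ge0 //.
Qed.

Lemma reCD z w : reC (z + w) = reC z + reC w.
Proof. by rewrite -(mkC_eta z) -(mkC_eta w). Qed.
Lemma imCD z w : imC (z + w) = imC z + imC w.
Proof. by rewrite -(mkC_eta z) -(mkC_eta w). Qed.
Lemma reCN z : reC (- z) = - reC z.
Proof. by rewrite -(mkC_eta z). Qed.
Lemma imCN z : imC (- z) = - imC z.
Proof. by rewrite -(mkC_eta z). Qed.
Lemma reCM z w : reC (z * w) = reC z * reC w - imC z * imC w.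
Proof. by rewrite -(mkC_eta z) -(mkC_eta w). Qed.
Lemma imCM z w : imC (z * w) = reC z * imC w + imC z * reC w.
Proof. by rewrite -(mkC_eta z) -(mkC_eta w). Qed.

Lemma C_ext (z w : C) : reC z = reC w -> imC z = imC w -> z = w.
Proof. by rewrite -(mkC_eta z) -(mkC_eta w) => /= -> ->. Qed.

Section Diff.
Variables V W : normedModType C.
Implicit Types (f : V -> W) (x : V).

Lemma continuous_nrmP f x : {for x, continuous f} <->
  forall e : R, 0 < e -> exists2 d : R, 0 < d &
    forall y, nrm (y - x) < d -> nrm (f y - f x) < e.
Proof.
split=> [cf e e0|H A /nbhs_nrmP[e e0 eA]].
  have /cf /nbhs_nrmP[d d0 dA] : nbhs (f x) [set y | nrm (y - f x) < e].
    by apply/nbhs_nrmP; exists e.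
  by exists d.
have [d d0 dH] := H e e0; apply/nbhs_nrmP; exists d => // y yd /=.
by apply: eA; exact: dH.
Qed.

Lemma differentiable_est f x : differentiable f x ->
  forall e : R, 0 < e -> exists2 d : R, 0 < d &
    forall h, nrm h < d -> nrm (f (x + h) - f x - 'd f x h) <= e * nrm h.
Proof.
move=> df e e0.
have e0' : 0 < toC e by rewrite toC_gt0.
have /diff_locally/eqaddoP/(_ _ e0') /nbhs_nrmP[d d0 H] := df.
exists d => // h hd.
have := H h; rewrite subr0 => /(_ hd) /=.
by rewrite !fctE !nrmE -toCM toC_le opprD addrA [h + x]addrC.
Qed.

Lemma linear_bound (L : {linear V -> W}) : continuous L ->
  exists2 B : R, 0 < B & forall h, nrm (L h) <= B * nrm h.
Proof.
move=> cL; have /linear_lipschitz[k /posC[k0 kE] kL] := cL.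
exists (reC k) => // h.
by rewrite -toC_le toCM -kE -!nrmE.
Qed.

Lemma bounded_linear_cont (L : {linear V -> W}) (B : R) :
  (forall h, nrm (L h) <= B * nrm h) -> continuous L.
Proof.
move=> LB; apply: continuousfor0_continuous.
apply/continuous_nrmP => e e0; exists (e / (`|B| + 1)).
  by rewrite divr_gt0 // ltr_wpDl.
move=> y; rewrite subr0 linear0 subr0 => ye.
have b1 : 0 < `|B| + 1 by rewrite ltr_wpDl.
move: ye; rewrite ltr_pdivlMr // => ye.
apply: le_lt_trans (LB y) _; apply: le_lt_trans ye.
rewrite mulrC ler_wpM2l ?nrm_ge0 // (le_trans (ler_norm B)) // lerDl //.
Qed.

(** Uniqueness of the differential identifies it with any linear map that satisfies the first-order
    estimate; the bound [B] supplies the continuity of that map. *)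
Lemma diff_of_est f x (L : {linear V -> W}) (B : R) :
  (forall h, nrm (L h) <= B * nrm h) ->
  (forall e : R, 0 < e -> exists2 d : R, 0 < d &
    forall h, nrm h < d -> nrm (f (x + h) - f x - L h) <= e * nrm h) ->
  differentiable f x /\ 'd f x = L :> (V -> W).
Proof.
move=> LB H.
have cL := bounded_linear_cont LB.
have dg : f \o shift x = cst (f x) + L +o_ 0 id.
  apply/eqaddoP => e /posC[e0 ->].
  have [d d0 dH] := H _ e0; apply/nbhs_nrmP; exists d => // h.
  rewrite subr0 => /dH; rewrite !fctE /= !nrmE -toCM toC_le.
  by rewrite opprD addrA [h + x]addrC.
have dE := diff_unique cL dg.
split => //.
by apply/diff_locallyP; rewrite dE; split.
Qed.

End Diff.
End RealNorm.

Global Opaque nrm.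

(** Taken componentwise, so that real Lebesgue integration on a segment applies to each part. *)
HB.lock Definition segint (R : realType) (g : R -> Cplx R) (a b : R) : Cplx R :=
  mkC (\int[lebesgue_measure]_(x in `[a, b]) reC (g x))
      (\int[lebesgue_measure]_(x in `[a, b]) imC (g x)).

(** * Cauchy's theorem on rectangles *)

Section SegmentIntegral.
Context {R : realType}.
Local Notation C := (Cplx R).
Local Notation mu := (@lebesgue_measure R).
Implicit Types (g h : R -> C) (a b c : R).

(** Continuity relative to the closed segment: it is one-sided at the end points. *)
Definition seg_continuous g a b := forall x, a <= x <= b ->
  forall e : R, 0 < e -> exists2 d : R, 0 < d &
  forall y, a <= y <= b -> `|y - x| < d -> nrm (g y - g x) < e.

Lemma within_itv_continuous (u : R -> R) a b :
  (forall x, a <= x <= b -> forall e : R, 0 < e -> exists2 d : R, 0 < d &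
  forall y, a <= y <= b -> `|y - x| < d -> `|u y - u x| < e) ->
  {within `[a, b], continuous u}.
Proof.
move=> H; apply/subspace_continuousP => x /=; rewrite in_itv /= => xab.
apply/cvgrPdist_lt => e e0; have [d d0 dH] := H x xab e e0.
rewrite near_withinE; apply/nbhs_ballP; exists d => //= y.
rewrite /ball /= distrC => yd; rewrite in_itv /= => yab.
by rewrite distrC; exact: dH.
Qed.

Lemma seg_continuous_re g a b : seg_continuous g a b ->
  {within `[a, b], continuous (fun x => reC (g x))}.
Proof.
move=> H; apply: within_itv_continuous => x xab e e0.
have [d d0 dH] := H x xab e e0; exists d => // y yab yd.
by rewrite -reCN -reCD (le_lt_trans (reC_le _)) // dH.
Qed.

Lemma seg_continuous_im g a b : seg_continuous g a b ->
  {within `[a, b], continuous (fun x => imC (g x))}.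
Proof.
move=> H; apply: within_itv_continuous => x xab e e0.
have [d d0 dH] := H x xab e e0; exists d => // y yab yd.
by rewrite -imCN -imCD (le_lt_trans (imC_le _)) // dH.
Qed.

Lemma seg_continuousS g a b a' b' : a <= a' -> b' <= b ->
  seg_continuous g a b -> seg_continuous g a' b'.
Proof.
move=> aa bb H x /andP[xa xb] e e0.
have [|d d0 dH] := H x _ e e0; first by rewrite (le_trans aa) // (le_trans xb).
exists d => // y /andP[ya yb]; apply: dH.
by rewrite (le_trans aa) // (le_trans yb).
Qed.

Lemma seg_integrable (u : R -> R) a b : {within `[a, b], continuous u} ->
  mu.-integrable `[a, b] (EFin \o u).
Proof. by move=> cu; apply: continuous_compact_integrable => //; exact: segment_compact. Qed.

Let Rint_add (u : R -> R) a b c : a <= b -> b <= c -> {within `[a, c], continuous u} ->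
  \int[mu]_(x in `[a, c]) u x = \int[mu]_(x in `[a, b]) u x + \int[mu]_(x in `[b, c]) u x.
Proof.
move=> ab bc cu; have iu := seg_integrable cu.
have := @Rintegral_itvB _ u (BLeft a) (BRight c) b iu.
rewrite !bnd_simp => /(_ ab bc) /eqP; rewrite subr_eq addrC => /eqP ->.
congr (_ + _); apply: Rintegral_itv_obnd_cbnd.
by apply: integrableS iu => //; apply: subset_itvr; rewrite bnd_simp.
Qed.

Lemma segint_add g a b c : a <= b -> b <= c -> seg_continuous g a c ->
  segint g a c = segint g a b + segint g b c.
Proof.
move=> ab bc cg; rewrite segint.unlock (Rint_add ab bc (seg_continuous_re cg)).
by rewrite (Rint_add ab bc (seg_continuous_im cg)).
Qed.

Lemma segintD g h a b : seg_continuous g a b -> seg_continuous h a b ->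
  segint (fun x => g x + h x) a b = segint g a b + segint h a b.
Proof.
move=> cg ch; rewrite segint.unlock.
under eq_Rintegral do rewrite reCD.
under [X in mkC _ X]eq_Rintegral do rewrite imCD.
rewrite !RintegralD //; apply: seg_integrable.
- exact: seg_continuous_im.
- exact: seg_continuous_im.
- exact: seg_continuous_re.
- exact: seg_continuous_re.
Qed.

Lemma segintZ (k : C) g a b : seg_continuous g a b ->
  segint (fun x => k * g x) a b = k * segint g a b.
Proof.
move=> cg.
have ir := seg_integrable (seg_continuous_re cg).
have ii := seg_integrable (seg_continuous_im cg).
have iZ (r : R) u : mu.-integrable `[a, b] (EFin \o u) ->
    mu.-integrable `[a, b] (EFin \o (fun x => r * u x)).
  move=> iu; apply: (@eq_integrable _ _ _ mu `[a, b] _ (fun x => r%:E * (EFin \o u) x)%E) => //.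
  exact: integrableZl.
apply: C_ext.
  rewrite reCM segint.unlock /=; under eq_Rintegral do rewrite reCM.
  by rewrite RintegralB ?RintegralZl //; exact: iZ.
rewrite imCM segint.unlock /=; under eq_Rintegral do rewrite imCM.
by rewrite RintegralD ?RintegralZl //; exact: iZ.
Qed.

Let Rint_cst (k : R) a b : a <= b -> \int[mu]_(x in `[a, b]) k = k * (b - a).
Proof.
move=> ab; rewrite Rintegral_cst //= lebesgue_measure_itv /= lte_fin.
by move: ab; rewrite le_eqVlt => /predU1P[->|->]; rewrite ?ltxx ?subrr.
Qed.

Lemma segint_cst (k : C) a b : a <= b -> segint (fun=> k) a b = k * toC (b - a).
Proof.
by move=> ab; rewrite segint.unlock !Rint_cst //; apply: C_ext;
  rewrite ?reCM ?imCM /= mulr0 ?subr0 ?add0r.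
Qed.

Let Rint_le (u v : R -> R) a b : {within `[a, b], continuous u} ->
  {within `[a, b], continuous v} -> (forall x, a <= x <= b -> u x <= v x) ->
  \int[mu]_(x in `[a, b]) u x <= \int[mu]_(x in `[a, b]) v x.
Proof.
move=> cu cv uv; have iu := seg_integrable cu; have iv := seg_integrable cv.
by apply: le_Rintegral => // x /=; rewrite in_itv /=; exact: uv.
Qed.

Let within_cst (k : R) a b : {within `[a, b], continuous (fun=> k : R)}.
Proof. by apply: continuous_subspaceT => x; exact: cst_continuous. Qed.

Let Rint_bnd (u : R -> R) a b m : a <= b -> {within `[a, b], continuous u} ->
  (forall x, a <= x <= b -> `|u x| <= m) ->
  `|\int[mu]_(x in `[a, b]) u x| <= m * (b - a).
Proof.
move=> ab cu um; rewrite ler_norml -mulNr -!Rint_cst //.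
by apply/andP; split; apply: Rint_le => // x /um; rewrite ler_norml => /andP[].
Qed.

(** The factor 2 comes from bounding the real and the imaginary part separately. *)
Lemma segint_le g a b m : a <= b -> seg_continuous g a b ->
  (forall x, a <= x <= b -> nrm (g x) <= m) ->
  nrm (segint g a b) <= 2 * m * (b - a).
Proof.
move=> ab cg gm; rewrite segint.unlock (le_trans (nrm_le_re_im _)) // -mulrA mulr_natl mulr2n.
apply: lerD; apply: Rint_bnd => //.
- exact: seg_continuous_re.
- by move=> x /gm; apply: le_trans; exact: reC_le.
- exact: seg_continuous_im.
- by move=> x /gm; apply: le_trans; exact: imC_le.
Qed.

Lemma segint_re_ge g a b m : a <= b -> seg_continuous g a b ->
  (forall x, a <= x <= b -> m <= reC (g x)) -> m * (b - a) <= reC (segint g a b).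
Proof.
move=> ab cg gm; rewrite -Rint_cst // segint.unlock /=.
by apply: Rint_le => //; exact: seg_continuous_re.
Qed.

Lemma segint_im_ge g a b m : a <= b -> seg_continuous g a b ->
  (forall x, a <= x <= b -> m <= imC (g x)) -> m * (b - a) <= imC (segint g a b).
Proof.
move=> ab cg gm; rewrite -Rint_cst // segint.unlock /=.
by apply: Rint_le => //; exact: seg_continuous_im.
Qed.

Lemma segint_id a b : a <= b -> segint toC a b = toC ((b ^+ 2 - a ^+ 2) / 2).
Proof.
move=> ab; rewrite segint.unlock; apply: C_ext => /=; last by rewrite Rint_cst // mul0r.
move: ab; rewrite le_eqVlt => /predU1P[->|ab].
  by rewrite set_itv1 Rintegral_set1 subrr mul0r.
have dF (x : R) : is_derive x 1 (fun x => x ^+ 2 / 2 : R) x.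
  apply: is_derive_eq; rewrite /GRing.scale /=.
  by field.
have cF (x : R) : {for x, continuous (fun x : R => x ^+ 2 / 2 : R)}.
  by apply: differentiable_continuous; apply/derivable1_diffP; case: (dF x).
rewrite /Rintegral (@continuous_FTC2 _ _ (fun x => x ^+ 2 / 2)) //=.
- by field.
- by apply: continuous_subspaceT => x; exact: cvg_id.
- split.
  + by move=> x _; case: (dF x).
  + by apply: cvg_at_right_filter; exact: cF.
  + by apply: cvg_at_left_filter; exact: cF.
- by move=> x _; rewrite derive1E derive_val.
Qed.

Lemma eq_segint g h a b : (forall x, a <= x <= b -> g x = h x) ->
  segint g a b = segint h a b.
Proof.
move=> gh; rewrite segint.unlock; congr mkC; apply: eq_Rintegral => x;
  by rewrite inE /= in_itv /= => /gh ->.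
Qed.

End SegmentIntegral.

(** * Contour integrals over rectangles and Goursat's theorem *)

Section Goursat.
Context {R : realType}.
Local Notation C := (Cplx R).
Implicit Types (f : C -> C) (a b c d : R).

Definition iC : C := mkC 0 1.

Lemma nrm_iC : nrm iC = 1.
Proof.
apply/eqP; rewrite -(@eqrXn2 _ 2) ?nrm_ge0 // nrm_mkC expr0n add0r //.
Qed.

Lemma mkCE (x y : R) : mkC x y = toC x + iC * toC y.
Proof. by apply: C_ext; rewrite ?reCD ?imCD ?reCM ?imCM /=; ring. Qed.

Definition in_rect a b c d (z : C) := a <= reC z <= b /\ c <= imC z <= d.

(** The contour integral along the boundary, counterclockwise: [dz] is [dx] on the horizontal sides
    and [i dy] on the vertical ones. *)
Definition rectint f a b c d : C :=
  segint (fun x => f (mkC x c)) a b + iC * segint (fun y => f (mkC b y)) c d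
  - segint (fun x => f (mkC x d)) a b - iC * segint (fun y => f (mkC a y)) c d.

Lemma rectintE f a b c d : rectint f a b c d =
  segint (fun x => f (mkC x c)) a b + iC * segint (fun y => f (mkC b y)) c d
  - segint (fun x => f (mkC x d)) a b - iC * segint (fun y => f (mkC a y)) c d.
Proof. by []. Qed.

Definition rect_cont f a b c d :=
  forall z, in_rect a b c d z -> {for z, continuous f}.

Lemma rect_cont_h f a b c d y : rect_cont f a b c d -> c <= y <= d ->
  seg_continuous (fun x => f (mkC x y)) a b.
Proof.
move=> cf yc x xab e e0.
have [//|r r0 rf] := (continuous_nrmP f (mkC x y)).1 (cf _ _) e e0.
exists r => // x' _ xr; apply: rf.
rewrite [_ - _](_ : _ = toC (x' - x)) ?nrm_toC //.
by apply: C_ext => /=; ring.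
Qed.

Lemma rect_cont_v f a b c d x : rect_cont f a b c d -> a <= x <= b ->
  seg_continuous (fun y => f (mkC x y)) c d.
Proof.
move=> cf yc y xab e e0.
have [//|r r0 rf] := (continuous_nrmP f (mkC x y)).1 (cf _ _) e e0.
exists r => // x' _ xr; apply: rf.
rewrite [_ - _](_ : _ = iC * toC (x' - y)) ?nrmM ?nrm_iC ?mul1r ?nrm_toC //.
by apply: C_ext => /=; ring.
Qed.

Lemma rect_contS f a b c d a' b' c' d' : a <= a' -> b' <= b -> c <= c' -> d' <= d ->
  rect_cont f a b c d -> rect_cont f a' b' c' d'.
Proof.
move=> aa bb cc dd cf z [/andP[h1 h2] /andP[h3 h4]]; apply: cf; split; apply/andP; split.
- exact: le_trans h1.
- exact: le_trans bb.
- exact: le_trans h3.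
- exact: le_trans dd.
Qed.

Lemma rectint_hsplit f a m b c d : a <= m -> m <= b -> c <= d ->
  rect_cont f a b c d ->
  rectint f a b c d = rectint f a m c d + rectint f m b c d.
Proof.
move=> am mb cd cf; rewrite /rectint.
rewrite (segint_add am mb (rect_cont_h cf _)) ?lexx //.
rewrite (segint_add am mb (rect_cont_h cf _)) ?lexx ?cd //; ring.
Qed.

Lemma rectint_vsplit f a b c m d : c <= m -> m <= d -> a <= b ->
  rect_cont f a b c d ->
  rectint f a b c d = rectint f a b c m + rectint f a b m d.
Proof.
move=> cm md ab cf; rewrite /rectint.
rewrite (segint_add cm md (rect_cont_v cf _)) ?lexx ?ab //.
rewrite (segint_add cm md (rect_cont_v cf _)) ?lexx ?ab //; ring.
Qed.

Lemma continuous_rect_cont f a b c d : continuous f -> rect_cont f a b c d.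
Proof. by move=> cf z _; exact: cf. Qed.

Lemma affine_continuous (p k : C) : continuous (fun z => p + k * z).
Proof.
move=> z; apply: differentiable_continuous.
by apply: differentiableD => //; apply: differentiableM.
Qed.

Lemma toC_seg_continuous a b : seg_continuous toC a b.
Proof.
move=> x _ e e0; exists e => // y _ yx.
by rewrite [_ - _](_ : _ = toC (y - x)) ?nrm_toC //; apply: C_ext => /=; ring.
Qed.

Lemma cst_seg_continuous (k : C) a b : seg_continuous (fun=> k) a b.
Proof. by move=> x _ e e0; exists 1 => // y _ _; rewrite subrr nrm0. Qed.

Lemma mul_seg_continuous (k : C) g a b : seg_continuous g a b ->
  seg_continuous (fun x => k * g x) a b.
Proof.
move=> cg x xab e e0.
have k1 : 0 < nrm k + 1 by rewrite ltr_wpDl ?nrm_ge0.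
have [|d d0 dH] := cg x xab (e / (nrm k + 1)); first by rewrite divr_gt0.
exists d => // y yab /(dH y yab); rewrite ltr_pdivlMr // => yd.
rewrite -mulrBr nrmM (le_lt_trans _ yd) // mulrC ler_wpM2l ?nrm_ge0 //.
by rewrite lerDl.
Qed.

Lemma segint_affine (p q k : C) a b : a <= b ->
  segint (fun x => p + k * (q * toC x)) a b =
  p * toC (b - a) + k * q * toC ((b ^+ 2 - a ^+ 2) / 2).
Proof.
move=> ab; rewrite segintD ?segint_cst //.
- rewrite (@eq_segint _ _ (fun x => (k * q) * toC x)); last by move=> *; rewrite mulrA.
  by rewrite segintZ ?segint_id //; exact: toC_seg_continuous.
- exact: cst_seg_continuous.
- by do 2!apply: mul_seg_continuous; exact: toC_seg_continuous.
Qed.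

(** Affine functions have a primitive; here the four sides are evaluated and cancel. It allows a
    first-order Taylor polynomial to be subtracted under the integral. *)
Lemma rectint_affine (p k : C) a b c d : a <= b -> c <= d ->
  rectint (fun z => p + k * z) a b c d = 0.
Proof.
move=> ab cd; rewrite /rectint.
have h y : segint (fun x => p + k * mkC x y) a b =
    (p + k * iC * toC y) * toC (b - a) + k * 1 * toC ((b ^+ 2 - a ^+ 2) / 2).
  rewrite -segint_affine //; apply: eq_segint => x _; rewrite mkCE; ring.
have v x : segint (fun y => p + k * mkC x y) c d =
    (p + k * toC x) * toC (d - c) + k * iC * toC ((d ^+ 2 - c ^+ 2) / 2).
  rewrite -segint_affine //; apply: eq_segint => y _; rewrite mkCE; ring.
rewrite !h !v; apply: C_ext; rewrite !(reCD, imCD, reCN, imCN, reCM, imCM) /=; by field.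
Qed.

Definition on_bd a b c d (z : C) := in_rect a b c d z /\
  [\/ reC z = a, reC z = b, imC z = c | imC z = d].

(** Only boundary points count, because integrands such as [z^-1] are singular inside the square. *)
Definition bd_cont f a b c d :=
  forall z, on_bd a b c d z -> {for z, continuous f}.

Lemma rect_bd_cont f a b c d : rect_cont f a b c d -> bd_cont f a b c d.
Proof. by move=> cf z [/cf]. Qed.

Lemma bd_cont_h f a b c d y : c <= d -> bd_cont f a b c d -> y = c \/ y = d ->
  seg_continuous (fun x => f (mkC x y)) a b.
Proof.
move=> cd cf yE; apply: (@rect_cont_h _ _ _ y y); rewrite ?lexx // => z [zx /le_anti zy].
apply: cf; split; first by split => //; rewrite -zy; case: yE => ->; rewrite lexx ?cd.
by rewrite -zy; case: yE => ->; [apply: Or43|apply: Or44].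
Qed.

Lemma bd_cont_v f a b c d x : a <= b -> bd_cont f a b c d -> x = a \/ x = b ->
  seg_continuous (fun y => f (mkC x y)) c d.
Proof.
move=> ab cf xE; apply: (@rect_cont_v _ x x); rewrite ?lexx // => z [/le_anti zx zy].
apply: cf; split; first by split => //; rewrite -zx; case: xE => ->; rewrite lexx ?ab.
by rewrite -zx; case: xE => ->; [apply: Or41|apply: Or42].
Qed.

Lemma rectintD f g a b c d : a <= b -> c <= d ->
  bd_cont f a b c d -> bd_cont g a b c d ->
  rectint (fun z => f z + g z) a b c d = rectint f a b c d + rectint g a b c d.
Proof.
move=> ab cd cf cg; rewrite /rectint.
have l (x y : R) : x = x \/ x = y by left.
have r (x y : R) : x = y \/ x = x by right.
rewrite (segintD (bd_cont_h cd cf (l _ _)) (bd_cont_h cd cg (l _ _))).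
rewrite (segintD (bd_cont_h cd cf (r _ _)) (bd_cont_h cd cg (r _ _))).
rewrite (segintD (bd_cont_v ab cf (l _ _)) (bd_cont_v ab cg (l _ _))).
rewrite (segintD (bd_cont_v ab cf (r _ _)) (bd_cont_v ab cg (r _ _))); ring.
Qed.

Lemma rectintZ (k : C) f a b c d : a <= b -> c <= d -> bd_cont f a b c d ->
  rectint (fun z => k * f z) a b c d = k * rectint f a b c d.
Proof.
move=> ab cd cf; rewrite /rectint.
have l (x y : R) : x = x \/ x = y by left.
have r (x y : R) : x = y \/ x = x by right.
rewrite (segintZ k (bd_cont_h cd cf (l _ _))) (segintZ k (bd_cont_h cd cf (r _ _))).
rewrite (segintZ k (bd_cont_v ab cf (l _ _))) (segintZ k (bd_cont_v ab cf (r _ _))).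
ring.
Qed.

(** The constant 4 counts two parallel sides in each direction, each with the factor 2 of
    [segint_le]. *)
Lemma rectint_le f a b c d (m : R) : a <= b -> c <= d -> bd_cont f a b c d ->
  (forall z, on_bd a b c d z -> nrm (f z) <= m) ->
  nrm (rectint f a b c d) <= 4 * m * (b - a + (d - c)).
Proof.
move=> ab cd cf fm; rewrite /rectint.
have H1 y : y = c \/ y = d -> nrm (segint (fun x => f (mkC x y)) a b) <= 2 * m * (b - a).
  move=> yE; apply: segint_le => // [|x xab]; first exact: (bd_cont_h cd cf).
  apply: fm; split; first by split => //=; case: yE => ->; rewrite lexx ?cd.
  by case: yE => ->; [apply: Or43|apply: Or44].
have H2 x : x = a \/ x = b -> nrm (iC * segint (fun y => f (mkC x y)) c d) <= 2 * m * (d - c).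
  move=> xE; rewrite nrmM nrm_iC mul1r.
  apply: segint_le => // [|y ycd]; first exact: (bd_cont_v ab cf).
  apply: fm; split; first by split => //=; case: xE => ->; rewrite lexx ?ab.
  by case: xE => ->; [apply: Or41|apply: Or42].
have h1 := H1 c (or_introl erefl); have h2 := H1 d (or_intror erefl).
have h3 := H2 a (or_introl erefl); have h4 := H2 b (or_intror erefl).
apply: le_trans (nrmB _ _) _; apply: le_trans (lerD (nrmB _ _) (lexx _)) _.
apply: le_trans (lerD (lerD (nrmD _ _) (lexx _)) (lexx _)) _.
move: h1 h2 h3 h4; clear; lra.
Qed.

Lemma rectint_near_affine f a b c d (p k : C) (m : R) : a <= b -> c <= d ->
  rect_cont f a b c d ->
  (forall z, in_rect a b c d z -> nrm (f z - (p + k * z)) <= m) ->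
  nrm (rectint f a b c d) <= 4 * m * (b - a + (d - c)).
Proof.
move=> ab cd cf fm.
have ca : rect_cont (fun z => p + k * z) a b c d.
  exact/continuous_rect_cont/affine_continuous.
have cr : rect_cont (fun z => f z - (p + k * z)) a b c d.
  by move=> z zr; apply: continuousB; [exact: cf|exact: ca].
have -> : f = (fun z => (f z - (p + k * z)) + (p + k * z)).
  by apply/funext => z; rewrite subrK.
rewrite rectintD //; [|exact: rect_bd_cont|exact: rect_bd_cont].
rewrite rectint_affine // addr0; apply: rectint_le => //; first exact: rect_bd_cont.
by move=> z [/fm].
Qed.

Lemma exists_half_pow_lt (w e : R) : 0 < e -> exists n : nat, w * 2^-1 ^+ n < e.
Proof.
move=> e0.
have : (fun n : nat => w * 2^-1 ^+ n) @ \oo --> w * 0.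
  apply: cvgMr; apply: cvg_expr; rewrite ger0_norm ?invr_ge0 //; lra.
rewrite mulr0 => /cvgrPdist_lt /(_ e e0)[n _ /(_ n (leqnn n))] /=.
rewrite sub0r normrN => h; exists n; exact: le_lt_trans (ler_norm _) h.
Qed.

Lemma nested_interval (x : nat -> R) (w : R) : 0 <= w ->
  (forall n, x n <= x n.+1 /\ x n.+1 + w * 2^-1 ^+ n.+1 <= x n + w * 2^-1 ^+ n) ->
  exists l, forall n, x n <= l <= x n + w * 2^-1 ^+ n.
Proof.
move=> w0 H.
have wn n : 0 <= w * 2^-1 ^+ n by rewrite mulr_ge0 // exprn_ge0 // invr_ge0.
have xm n m : x n <= x (n + m)%N /\ x (n + m)%N + w * 2^-1 ^+ (n + m)%N <= x n + w * 2^-1 ^+ n.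
  elim: m => [|m [h1 h2]]; first by rewrite addn0.
  have [h3 h4] := H (n + m)%N; rewrite addnS; split.
    exact: le_trans h3.
  exact: le_trans h2.
have xle n m : x n <= x m + w * 2^-1 ^+ m.
  have [nm|/ltnW mn] := leqP n m.
    have [h _] := xm n (m - n)%N; rewrite subnKC // in h.
    by rewrite (le_trans h) // lerDl.
  have [_ h] := xm m (n - m)%N; rewrite subnKC // in h.
  by rewrite (le_trans _ h) // lerDl.
exists (sup (range x)) => n; apply/andP; split.
  apply: ub_le_sup; last by exists n.
  by exists (x 0%N + w * 2^-1 ^+ 0) => _ [k _ <-].
apply: ge_sup; first by exists (x 0%N), 0%N.
by move=> _ [k _ <-].
Qed.

(** Bisection: a nonzero integral leaves at every scale a subrectangle whose integral exceeds [eta]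
    times the square of its half-perimeter. At the common point of these rectangles,
    differentiability makes the integral at most half of that. *)
Lemma goursat f a b c d : a <= b -> c <= d ->
  (forall z, in_rect a b c d z -> differentiable f z) ->
  rectint f a b c d = 0.
Proof.
move=> ab cd df; apply/eqP; rewrite -nrm_eq0; apply/negPn/negP => I0.
have {I0} I0 : 0 < nrm (rectint f a b c d) by rewrite lt_def I0 nrm_ge0.
set w := b - a; set h := d - c.
have w0 : 0 <= w by rewrite subr_ge0.
have h0 : 0 <= h by rewrite subr_ge0.
pose s := (w + h) ^+ 2; have s0 : 0 <= s by exact: sqr_ge0.
(* The [+ 1] makes the inequality in [good] strict at the start and keeps [eta] positive for a
   degenerate rectangle. *)
pose eta := nrm (rectint f a b c d) / (s + 1).
have eta0 : 0 < eta by rewrite divr_gt0 // ltr_wpDl.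
pose W n := w * 2^-1 ^+ n; pose H n := h * 2^-1 ^+ n.
have p0 n : 0 <= 2^-1 ^+ n :> R by rewrite exprn_ge0 // invr_ge0.
have W0 n : 0 <= W n by rewrite mulr_ge0.
have H0 n : 0 <= H n by rewrite mulr_ge0.
have WS n : W n = W n.+1 + W n.+1 by rewrite /W exprSr; field.
have HS n : H n = H n.+1 + H n.+1 by rewrite /H exprSr; field.
pose good n (p : R * R) := [/\ a <= p.1, p.1 + W n <= b, c <= p.2, p.2 + H n <= d &
  eta * (W n + H n) ^+ 2 < nrm (rectint f p.1 (p.1 + W n) p.2 (p.2 + H n))].
pose next n (p q : R * R) := [/\ good n.+1 q, p.1 <= q.1, q.1 + W n.+1 <= p.1 + W n,
  p.2 <= q.2 & q.2 + H n.+1 <= p.2 + H n].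
have cf : rect_cont f a b c d by move=> z /df; exact: differentiable_continuous.
have step n p : exists q, good n p -> next n p q.
  have [[x1 x2 y1 y2 gI]|] := pselect (good n p); last by exists p.
  case: p x1 x2 y1 y2 gI => x y /= x1 x2 y1 y2 gI.
  set x' := x + W n.+1; set y' := y + H n.+1.
  have wn := W0 n.+1; have hn := H0 n.+1.
  have xE : x + W n = x' + W n.+1 by rewrite /x' -addrA -WS.
  have yE : y + H n = y' + H n.+1 by rewrite /y' -addrA -HS.
  apply: contrapT => /forallNP Nq.
  (* Otherwise all four quarters satisfy the reverse inequality. Halving the sides divides the
     square of the half-perimeter by four, so the four bounds add up to the bound for the parent,
     which is [good]. *)
  have Q u v : (u = x \/ u = x') -> (v = y \/ v = y') ->
      nrm (rectint f u (u + W n.+1) v (v + H n.+1)) <= eta * (W n.+1 + H n.+1) ^+ 2.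
    move=> hu hv; rewrite leNgt; apply/negP => lt; apply: (Nq (u, v)) => _.
    have E1 : [/\ a <= u, u + W n.+1 <= b, x <= u & u + W n.+1 <= x + W n].
      by case: hu => ->; split; rewrite ?xE ?lerDl // -?xE // ?(le_trans x1) ?lerDl // (le_trans _ x2) // xE lerDl.
    have E2 : [/\ c <= v, v + H n.+1 <= d, y <= v & v + H n.+1 <= y + H n].
      by case: hv => ->; split; rewrite ?yE ?lerDl // -?yE // ?(le_trans y1) ?lerDl // (le_trans _ y2) // yE lerDl.
    by move: E1 E2 => [? ? ? ?] [? ? ? ?]; split.
  have cn : rect_cont f x (x + W n) y (y + H n) by apply: rect_contS cf.
  have E : rectint f x (x + W n) y (y + H n) =
     rectint f x (x + W n.+1) y (y + H n.+1) + rectint f x' (x' + W n.+1) y (y + H n.+1)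
   + (rectint f x (x + W n.+1) y' (y' + H n.+1) + rectint f x' (x' + W n.+1) y' (y' + H n.+1)).
    have xx' : x <= x' by rewrite lerDl.
    have yy' : y <= y' by rewrite lerDl.
    have x'X : x' <= x + W n by rewrite xE lerDl.
    have y'Y : y' <= y + H n by rewrite yE lerDl.
    rewrite (rectint_vsplit yy' y'Y (le_trans xx' x'X) cn) -xE -yE.
    congr (_ + _); apply: rectint_hsplit => //; exact: rect_contS cn.
  have q1 := Q x y (or_introl erefl) (or_introl erefl).
  have q2 := Q x' y (or_intror erefl) (or_introl erefl).
  have q3 := Q x y' (or_introl erefl) (or_intror erefl).
  have q4 := Q x' y' (or_intror erefl) (or_intror erefl).
  move: gI; rewrite E ltNge => /negP; apply.
  apply: le_trans (nrmD _ _) _.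
  apply: le_trans (lerD (nrmD _ _) (nrmD _ _)) _.
  apply: le_trans (lerD (lerD q1 q2) (lerD q3 q4)) _.
  rewrite (WS n) (HS n); set A := W n.+1; set B := H n.+1.
  by rewrite le_eqVlt; apply/orP; left; apply/eqP; ring.
have [F FP] := choice (fun np : nat * (R * R) => step np.1 np.2).
pose u := fix u n := if n is m.+1 then F (m, u m) else (a, c).
have gu n : good n (u n).
  elim: n => [|n IH]; last by have [] := FP (n, u n) IH.
  have W00 : W 0%N = w by rewrite /W expr0 mulr1.
  have H00 : H 0%N = h by rewrite /H expr0 mulr1.
  have aw : a + w = b by rewrite /w addrC subrK.
  have ch : c + h = d by rewrite /h addrC subrK.
  rewrite /good W00 H00 /= aw ch; split; [exact: lexx|exact: lexx|exact: lexx|exact: lexx|].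
  by rewrite -/s /eta mulrAC ltr_pdivrMr ?ltr_wpDl // ltr_pM2l // ltrDl.
have nu n : next n (u n) (u n.+1) by exact: FP (n, u n) (gu n).
have [lx lxP] : exists l, forall n, (u n).1 <= l <= (u n).1 + W n.
  by apply: nested_interval => // n; have [] := nu n.
have [ly lyP] : exists l, forall n, (u n).2 <= l <= (u n).2 + H n.
  by apply: nested_interval => // n; have [] := nu n.
pose z0 := mkC lx ly.
have z0r : in_rect a b c d z0.
  have /andP[e1 e2] := lxP 0%N; have /andP[e3 e4] := lyP 0%N.
  have [g1 g2 g3 g4 _] := gu 0%N.
  split => /=; apply/andP; split.
  - exact: le_trans g1 e1.
  - exact: le_trans e2 g2.
  - exact: le_trans g3 e3.
  - exact: le_trans e4 g4.
(* On half-perimeter [A] the affine error is [eta / 8 * A], and the factor 4 of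
   [rectint_near_affine] turns it into [eta * A ^+ 2 / 2]. *)
have [|r r0 rH] := @differentiable_est _ _ _ f z0 (df _ z0r) (eta / 8); first by rewrite divr_gt0.
have [n nr] := exists_half_pow_lt (w + h) r0.
have nr' : W n + H n < r by rewrite /W /H -mulrDl.
have [g1 g2 g3 g4 g5] := gu n.
have /andP[lx1 lx2] := lxP n; have /andP[ly1 ly2] := lyP n.
set k := 'd f z0 1.
have dk (v : C) : 'd f z0 v = k * v.
  by rewrite -{1}[v]mulr1 -[v * 1]/(v *: (1 : C)) linearZ /= mulrC.
have near z : in_rect (u n).1 ((u n).1 + W n) (u n).2 ((u n).2 + H n) z ->
    nrm (f z - ((f z0 - k * z0) + k * z)) <= eta / 8 * (W n + H n).
  move=> [/andP[zx1 zx2] /andP[zy1 zy2]].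
  have zz : nrm (z - z0) <= W n + H n.
    apply: le_trans (nrm_le_re_im _) _; rewrite reCD imCD reCN imCN /=.
    by apply: lerD; rewrite ler_norml; apply/andP; split;
      move: zx1 zx2 zy1 zy2 lx1 lx2 ly1 ly2; clear; lra.
  have := rH (z - z0) (le_lt_trans zz nr').
  rewrite dk [z0 + _]addrC subrK => h1.
  rewrite [X in nrm X](_ : _ = f z - f z0 - k * (z - z0)); last ring.
  by apply: le_trans h1 _; rewrite ler_wpM2l // divr_ge0 // ltW.
have := @rectint_near_affine f _ _ _ _ _ _ _ _ _ _ near.
rewrite !lerDl => /(_ (W0 n) (H0 n)) h1.
have {h1} := h1 (rect_contS g1 g2 g3 g4 cf).
rewrite leNgt => /negP; apply; apply: le_lt_trans g5.
have -> : (u n).1 + W n - (u n).1 + ((u n).2 + H n - (u n).2) = W n + H n by ring.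
set A := W n + H n.
have : 0 <= eta * A ^+ 2 by rewrite mulr_ge0 ?sqr_ge0 // ltW.
suff -> : 4 * (eta / 8 * A) * A = eta * A ^+ 2 / 2 by lra.
by field.
Qed.

End Goursat.

(** * A mean value inequality from square contours *)

Section MeanValue.
Context {R : realType}.
Local Notation C := (Cplx R).
Implicit Types (f u : C -> C).

Lemma reCV (z : C) : reC z^-1 = reC z / nrm z ^+ 2.
Proof.
rewrite nrm_re_im -{1}(mkC_eta z) [LHS]/reC /=.
by [].
Qed.

Lemma imCV (z : C) : imC z^-1 = - imC z / nrm z ^+ 2.
Proof.
rewrite nrm_re_im -{1}(mkC_eta z) [LHS]/imC /=.
by rewrite mulNr.
Qed.

(** The maximum norm of the plane, whose spheres are the square contours. *)
Definition supn (z : C) : R := Num.max `|reC z| `|imC z|.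

Lemma nrm_ge_supn (z : C) : supn z <= nrm z.
Proof. by rewrite ge_max reC_le imC_le. Qed.

Lemma nrm_le_supn (z : C) : nrm z <= 2 * supn z.
Proof.
rewrite (le_trans (nrm_le_re_im z)) // mulr_natl mulr2n.
by apply: lerD; rewrite le_max lexx ?orbT.
Qed.

Lemma on_bd_square r z : 0 <= r -> on_bd (- r) r (- r) r z -> supn z = r.
Proof.
move=> r0 [[]]; rewrite -!ler_norml /supn => h1 h2 h3; apply/le_anti/andP; split.
  by rewrite ge_max h1 h2.
by rewrite le_max; case: h3 => ->; rewrite ?normrN (ger0_norm r0) lexx ?orbT.
Qed.

(** The region between the squares is cut into two strips of full width, above and below, and two
    short rectangles at the left and right. Goursat's theorem applies to each, and the inner edges
    cancel. *)
Lemma square_annulus f e r : 0 <= e -> e <= r ->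
  (forall z, e <= supn z <= r -> differentiable f z) ->
  rectint f (- r) r (- r) r = rectint f (- e) e (- e) e.
Proof.
move=> e0 er df.
have nr : - r <= - e by rewrite lerN2.
have ne : - e <= e by rewrite (@le_trans _ _ 0) ?oppr_le0.
have nre : - r <= e by exact: le_trans ne.
have ner : - e <= r by exact: le_trans er.
have sr x y : -r <= x <= r -> -r <= y <= r -> (e <= `|x| \/ e <= `|y|) ->
    differentiable f (mkC x y).
  rewrite -!ler_norml => hx hy h; apply: df; rewrite /supn /= ge_max hx hy andbT.
  by rewrite le_max; case: h => ->; rewrite ?orbT.
have D a b c d : - r <= a -> a <= b -> b <= r -> - r <= c -> c <= d -> d <= r ->
    [\/ b <= - e, e <= a, d <= - e | e <= c] -> rectint f a b c d = 0.
  move=> ra ab br rc cd dr h; apply: goursat => // z [/andP[za zb] /andP[zc zd]].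
  rewrite -(mkC_eta z); apply: sr.
  - by rewrite (le_trans ra za) (le_trans zb br).
  - by rewrite (le_trans rc zc) (le_trans zd dr).
  - case: h => h; [left|left|right|right]; rewrite ler_normr.
    + by rewrite [_ <= - reC z]lerNr (le_trans zb h) orbT.
    + by rewrite (le_trans h za).
    + by rewrite [_ <= - imC z]lerNr (le_trans zd h) orbT.
    + by rewrite (le_trans h zc).
have T := D (-r) r e r (lexx _) (le_trans nre er) (lexx _) nre er (lexx _) (Or44 _ _ _ (lexx _)).
have B := D (-r) r (-r) (-e) (lexx _) (le_trans nre er) (lexx _) (lexx _) nr ner (Or43 _ _ _ (lexx _)).
have L := D (-r) (-e) (-e) e (lexx _) nr ner nr ne er (Or41 _ _ _ (lexx _)).
have Q := D e r (-e) e nre er (lexx _) nr ne er (Or42 _ _ _ (lexx _)).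
have rr : - r <= r by exact: le_trans er.
have hc y : e <= `|y| -> -r <= y <= r -> seg_continuous (fun x => f (mkC x y)) (-r) r.
  move=> ey yr; apply: (@rect_cont_h _ _ _ _ y y); rewrite ?lexx // => z [zx /le_anti zy].
  apply: differentiable_continuous; rewrite -(mkC_eta z) -zy.
  by apply: sr => //; right.
have vc x : e <= `|x| -> -r <= x <= r -> seg_continuous (fun y => f (mkC x y)) (-r) r.
  move=> ey yr; apply: (@rect_cont_v _ _ x x); rewrite ?lexx // => z [/le_anti zx zy].
  apply: differentiable_continuous; rewrite -(mkC_eta z) -zx.
  by apply: sr => //; left.
have ae : e <= `|e| by rewrite ger0_norm.
have are : e <= `|-e| by rewrite normrN ger0_norm.
have ar : e <= `|r| by rewrite ger0_norm // (le_trans e0).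
have arr : e <= `|-r| by rewrite normrN ger0_norm // (le_trans e0).
have split3 g : seg_continuous g (-r) r ->
    segint g (-r) r = segint g (-r) (-e) + (segint g (-e) e + segint g e r).
  move=> cg; rewrite (segint_add nr ner cg) (@segint_add _ _ (-e) e r) //.
  exact: seg_continuousS cg.
have h1 := split3 _ (hc e ae _); have h2 := split3 _ (hc (-e) are _).
have h3 := split3 _ (vc r ar _); have h4 := split3 _ (vc (-r) arr _).
have -> : rectint f (- r) r (- r) r = rectint f (- e) e (- e) e +
   (rectint f (-r) r e r + rectint f (-r) r (-r) (-e) + rectint f (-r) (-e) (-e) e + rectint f e r (-e) e).
  rewrite !rectintE h1 ?nre ?er // h2 ?nr ?ner // h3 ?rr ?lexx // h4 ?rr ?lexx //; ring.
by rewrite T B L Q !addr0.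
Qed.

(** The exact value is [2 pi i]. Each side contributes at least 1 to the imaginary part, since
    [e / (e^2 + x^2) >= 1 / (2e)] on a side of length [2e]. *)
Lemma square_inv (e : R) : 0 < e -> 4 <= nrm (rectint (fun z : C => z^-1) (- e) e (- e) e).
Proof.
move=> e0.
have ne : - e <= e by rewrite (@le_trans _ _ 0) ?oppr_le0 // ltW.
have cV : bd_cont (fun z : C => z^-1) (- e) e (- e) e.
  move=> z /(on_bd_square (ltW e0)) ze; apply: differentiable_continuous.
  apply: differentiable_Rinv; rewrite -nrm_gt0; apply: lt_le_trans (nrm_ge_supn z).
  by rewrite ze.
have key (x : R) : - e <= x <= e -> (2 * e)^-1 <= e / (e ^+ 2 + x ^+ 2).
  rewrite -ler_norml => xe.
  have : x ^+ 2 <= e ^+ 2 by rewrite -(real_normK (num_real x)) ler_pXn2r // nnegrE ltW.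
  move=> x2; rewrite ler_pdivlMr ?ltr_pwDl ?exprn_gt0 ?sqr_ge0 //.
  rewrite ler_pdivrMl ?mulr_gt0 //; move: x2; rewrite expr2; nra.
have l2 : (2 * e)^-1 * (e - - e) = 1 by field; rewrite gt_eqF.
pose i0 := rectint (fun z : C => z^-1) (- e) e (- e) e.
suff : 4 <= imC i0 by move=> h; apply: le_trans h (le_trans (ler_norm _) (imC_le _)).
have h (y : R) : y = - e \/ y = e -> 1 <= - (y / e) * imC (segint (fun x => (mkC x y)^-1) (- e) e).
  move=> yE.
  have cy : seg_continuous (fun x => (mkC x y)^-1) (- e) e by exact: (bd_cont_h ne cV).
  rewrite -[X in X <= _]l2.
  have <- : imC (segint (fun x => toC (- (y / e)) * (mkC x y)^-1) (- e) e) =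
      - (y / e) * imC (segint (fun x => (mkC x y)^-1) (- e) e).
    by rewrite segintZ // imCM /=; ring.
  apply: segint_im_ge => //; first exact: mul_seg_continuous.
  move=> x xe; rewrite imCM imCV nrm_mkC /=; apply: le_trans (key x xe) _.
  have y2 : y ^+ 2 = e ^+ 2 by case: yE => ->; rewrite ?sqrrN.
  rewrite y2 [e ^+ 2 + _]addrC; set D := (_ + e ^+ 2)^-1.
  rewrite (_ : - (y / e) * (- y * D) + _ = (y ^+ 2) / e * D); last ring.
  by rewrite y2 expr2 mulfK ?gt_eqF.
have v (x : R) : x = - e \/ x = e -> 1 <= (x / e) * reC (segint (fun y => (mkC x y)^-1) (- e) e).
  move=> xE.
  have cx : seg_continuous (fun y => (mkC x y)^-1) (- e) e by exact: (bd_cont_v ne cV).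
  rewrite -[X in X <= _]l2.
  have <- : reC (segint (fun y => toC (x / e) * (mkC x y)^-1) (- e) e) =
      (x / e) * reC (segint (fun y => (mkC x y)^-1) (- e) e).
    by rewrite segintZ // reCM /=; ring.
  apply: segint_re_ge => //; first exact: mul_seg_continuous.
  move=> y ye; rewrite reCM reCV nrm_mkC /=; apply: le_trans (key y ye) _.
  have x2 : x ^+ 2 = e ^+ 2 by case: xE => ->; rewrite ?sqrrN.
  rewrite x2; set D := (e ^+ 2 + _)^-1.
  rewrite (_ : x / e * (x * D) - _ = (x ^+ 2) / e * D); last ring.
  by rewrite x2 expr2 mulfK ?gt_eqF.
have := h _ (or_introl erefl); have := h _ (or_intror erefl).
have := v _ (or_introl erefl); have := v _ (or_intror erefl).
rewrite !mulNr !divff ?gt_eqF // opprK !mul1r => v1 v2 h1 h2.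
rewrite /i0 !rectintE !(imCD, imCN, imCM) [reC iC]/= [imC iC]/= !mul0r !add0r !mul1r.
move: v1 v2 h1 h2; clear; lra.
Qed.

(* A crude mean value inequality that needs no contour other than squares: compare
   the integrals of [u z / z] over a small and a large square about 0. *)
Lemma punctured_bound0 u (rho r M : R) : 0 < r -> 2 * r < rho ->
  (forall z, 0 < nrm z < rho -> differentiable u z) -> {for 0, continuous u} ->
  (forall z, r <= nrm z <= 2 * r -> nrm (u z) <= M) -> nrm (u 0) <= 4 * M.
Proof.
move=> r0 rrho du cu uM.
pose f z := u z * z^-1.
have df z : 0 < nrm z < rho -> differentiable f z.
  move=> zr; apply: differentiableM; first exact: du.
  by apply: differentiable_Rinv; rewrite -nrm_gt0; case/andP: zr.
have nr : - r <= r by rewrite (@le_trans _ _ 0) ?oppr_le0 // ltW.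
apply/ler_addgt0Pr => dl dl0.
have dl40 : 0 < dl / 4 by rewrite divr_gt0.
have [d d0 dH] := (continuous_nrmP u 0).1 cu _ dl40.
have [e [e0 er ed]] : exists e : R, [/\ 0 < e, e <= r & 2 * e < d].
  exists (Num.min (d / 4) r); rewrite lt_min r0 divr_gt0 // ge_min lexx orbT.
  split => //; have : Num.min (d / 4) r <= d / 4 by rewrite ge_min lexx.
  by move: d0; clear; lra.
have E : rectint f (- r) r (- r) r = rectint f (- e) e (- e) e.
  apply: (square_annulus (ltW e0) er) => z /andP[z1 z2]; apply: df; rewrite (lt_le_trans e0) ?(le_trans z1) ?nrm_ge_supn //=.
  apply: le_lt_trans (nrm_le_supn z) _; apply: le_lt_trans rrho.
  by rewrite ler_pM2l.
have ne : - e <= e by rewrite (@le_trans _ _ 0) ?oppr_le0 // ltW.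
have bde z : on_bd (- e) e (- e) e z -> e <= nrm z <= 2 * e.
  move=> /(on_bd_square (ltW e0)) zr.
  by rewrite -[X in X <= _]zr nrm_ge_supn -[X in _ * X]zr nrm_le_supn.
have cV : bd_cont (fun z : C => z^-1) (- e) e (- e) e.
  move=> z /bde/andP[ze _]; apply: differentiable_continuous.
  by apply: differentiable_Rinv; rewrite -nrm_gt0; apply: lt_le_trans ze.
have cf : bd_cont f (- e) e (- e) e.
  move=> z /bde/andP[z1 z2]; apply: differentiable_continuous; apply: df.
  rewrite (lt_le_trans e0 z1) (le_lt_trans z2) // (le_lt_trans _ rrho) //.
  by rewrite ler_pM2l.
have c0 : bd_cont (fun z => u 0 * z^-1) (- e) e (- e) e.
  by move=> z zb; apply: continuousM; [exact: cst_continuous|exact: cV].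
have cr : bd_cont (fun z => f z - u 0 * z^-1) (- e) e (- e) e.
  by move=> z zb; apply: continuousB; [exact: cf|exact: c0].
have fE : f = fun z => u 0 * z^-1 + (f z - u 0 * z^-1).
  by apply/funext => z; rewrite addrC subrK.
(* The integrand is [(u z - u 0) / z], at most [dl / 4 / e] on a contour of length proportional to
   [e], so the bound does not depend on [e]. *)
have small : nrm (rectint (fun z => f z - u 0 * z^-1) (- e) e (- e) e) <= 4 * dl.
  have -> : 4 * dl = 4 * (dl / 4 / e) * (e - - e + (e - - e)) by field; rewrite gt_eqF.
  apply: (rectint_le ne ne cr) => z /bde /andP[z1 z2].
  rewrite -mulrBl nrmM nrmV; apply: ler_pM; rewrite ?nrm_ge0 ?invr_ge0 ?nrm_ge0 //.
    by apply/ltW/dH; rewrite subr0 (le_lt_trans z2).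
  by rewrite lef_pV2 // posrE // (lt_le_trans e0 z1).
have big : nrm (rectint f (- r) r (- r) r) <= 16 * M.
  have -> : 16 * M = 4 * (M / r) * (r - - r + (r - - r)) by field; rewrite gt_eqF.
  have bd z : on_bd (- r) r (- r) r z -> r <= nrm z <= 2 * r.
    move=> /(on_bd_square (ltW r0)) zr.
    by rewrite -[X in X <= _]zr nrm_ge_supn -[X in _ * X]zr nrm_le_supn.
  have cf0 : bd_cont f (- r) r (- r) r.
    move=> z /bd /andP[z1 z2]; apply: differentiable_continuous; apply: df.
    by rewrite (lt_le_trans r0 z1) (le_lt_trans z2).
  apply: (rectint_le nr nr cf0) => z /bd /andP[z1 z2].
  rewrite nrmM nrmV; apply: ler_pM; rewrite ?nrm_ge0 ?invr_ge0 ?nrm_ge0 //.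
    by apply: uM; rewrite z1 z2.
  by rewrite lef_pV2 // posrE // (lt_le_trans r0 z1).
have : nrm (u 0 * rectint (fun z : C => z^-1) (- e) e (- e) e) <= 16 * M + 4 * dl.
  rewrite -rectintZ //.
  have -> : rectint (fun z => u 0 * z^-1) (- e) e (- e) e =
     rectint f (- r) r (- r) r - rectint (fun z => f z - u 0 * z^-1) (- e) e (- e) e.
    by rewrite E {1}fE rectintD // addrK.
  by apply: le_trans (nrmB _ _) _; exact: lerD.
rewrite nrmM => h.
have h4 : nrm (u 0) * 4 <= 16 * M + 4 * dl.
  by apply: le_trans h; rewrite ler_wpM2l ?nrm_ge0 // square_inv.
move: h4; clear; lra.
Qed.

Lemma differentiable_shift (V W : normedModType C) (f : V -> W) (a z : V) :
  differentiable f (a + z) -> differentiable (fun z => f (a + z)) z.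
Proof.
move=> df; apply: (@differentiable_comp _ _ _ _ (fun z => a + z) f) => //.
Qed.

Lemma punctured_bound u (a : C) (rho r M : R) : 0 < r -> 2 * r < rho ->
  (forall z, 0 < nrm (z - a) < rho -> differentiable u z) -> {for a, continuous u} ->
  (forall z, r <= nrm (z - a) <= 2 * r -> nrm (u z) <= M) -> nrm (u a) <= 4 * M.
Proof.
move=> r0 rrho du cu uM; rewrite -[in u a](addr0 a).
apply: (@punctured_bound0 (fun z => u (a + z)) rho r _ r0 rrho).
- move=> z zr; apply: differentiable_shift; apply: du.
  by rewrite addrAC subrr add0r.
- apply/continuous_nrmP => e e0; have [d d0 dH] := (continuous_nrmP u a).1 cu e e0.
  exists d => // y yd; rewrite addr0; apply: dH; by rewrite addrAC subrr add0r -[y]subr0.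
- by move=> z zr; apply: uM; rewrite addrAC subrr add0r.
Qed.

End MeanValue.

(** * Cauchy estimates and the Weierstrass theorem *)

Section Cauchy.
Context {R : realType}.
Local Notation C := (Cplx R).

Lemma differentiable_idfun (V : normedModType C) (x : V) : differentiable (fun x : V => x) x.
Proof. exact: ex_diff. Qed.

Lemma diff_scal (f : C -> C) (a v : C) : differentiable f a -> 'd f a v = v * 'd f a 1.
Proof.
by move=> df; rewrite -{1}[v]mulr1 -[v * 1]/(v *: (1 : C)) linearZ.
Qed.

(* [punctured_bound] for the difference quotient, extended by continuity at [a]. *)
Lemma deriv_bound (f : C -> C) (a : C) (r M : R) : 0 < r ->
  (forall z, nrm (z - a) < r -> differentiable f z) ->
  (forall z, nrm (z - a) < r -> nrm (f z) <= M) ->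
  nrm ('d f a 1) <= 24 * M / r.
Proof.
move=> r0 df fM.
have dfa : differentiable f a by apply: df; rewrite subrr nrm0.
pose u z := if z == a then 'd f a 1 else (f z - f a) * (z - a)^-1.
have ua : u a = 'd f a 1 by rewrite /u eqxx.
(* On the annulus [r / 3 <= |z - a| <= 2r / 3] the quotient is at most [2M / (r / 3) = 6M / r]. *)
rewrite -ua (_ : 24 * M / r = 4 * (6 * M / r)); last ring.
have r3 : 0 < r / 3 by rewrite divr_gt0.
have r32 : 2 * (r / 3) < r by move: r0; clear; lra.
apply: (@punctured_bound _ u a r (r / 3) _ r3 r32).
- move=> z /andP[z0 zr].
  apply: (@near_eq_differentiable _ _ _ (fun z => (f z - f a) * (z - a)^-1)).
    apply/nbhs_nrmP; exists (nrm (z - a)) => // y yz; rewrite /u.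
    case: eqP => // ya; move: yz; rewrite ya nrm_distC ltxx //.
  apply: differentiableM; first by apply: differentiableB; [exact: df|exact: differentiable_cst].
  apply: differentiableV; first by apply: differentiableB; [exact: differentiable_idfun|exact: differentiable_cst].
  by rewrite -nrm_gt0.
- apply/continuous_nrmP => e e0.
  have e20 : 0 < e / 2 by rewrite divr_gt0.
  have [d d0 dH] := differentiable_est dfa e20.
  exists d => // y yd; rewrite ua /u; case: eqP => [_|/eqP ya].
    by rewrite subrr nrm0.
  have ya0 : y - a != 0 by rewrite subr_eq0.
  have := dH (y - a) yd; rewrite [a + _]addrC subrK (diff_scal (y - a) dfa) => h.
  rewrite (_ : _ - _ = (f y - f a - (y - a) * 'd f a 1) * (y - a)^-1); last first.
    rewrite [RHS]mulrBl; congr (_ - _); by rewrite mulrAC divff // mul1r.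
  rewrite nrmM nrmV ltr_pdivrMr ?nrm_gt0 //. apply: le_lt_trans h _.
  rewrite ltr_pM2r ?nrm_gt0 //; move: e0; clear; lra.
- move=> z /andP[z1 z2].
  have z0 : 0 < nrm (z - a) by exact: lt_le_trans z1.
  rewrite /u; case: eqP => [za|/eqP za]; first by rewrite za subrr nrm0 ltxx in z0.
  have zr : nrm (z - a) < r by exact: le_lt_trans r32.
  rewrite nrmM nrmV ler_pdivrMr //.
  have h1 : nrm (f z - f a) <= 2 * M.
    apply: le_trans (nrmB _ _) _; rewrite mulr_natl mulr2n; apply: lerD; apply: fM => //.
    by rewrite subrr nrm0.
  apply: le_trans h1 _.
  have M0 : 0 <= M by apply: le_trans (nrm_ge0 (f z)) _; exact: fM.
  have -> : 2 * M = 6 * M / r * (r / 3) by field; rewrite gt_eqF.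
  by apply: ler_wpM2l => //; rewrite divr_ge0 ?mulr_ge0 // ltW.
Qed.

Section Normed.
Variable V : normedModType C.
Implicit Types (f g : V -> C) (a h x : V).

Lemma diff1_of_est (W : normedModType C) (g : C -> W) (t : C) (w : W) :
  (forall e : R, 0 < e -> exists2 d : R, 0 < d & forall s : C, nrm s < d ->
     nrm (g (t + s) - g t - s *: w) <= e * nrm s) ->
  differentiable g t /\ 'd g t 1 = w.
Proof.
move=> H.
pose L := fun s : C => s *: w.
have Llin : linear L by move=> k u v; rewrite /L scalerDl scalerA.
pose L' : {linear C -> W} := HB.pack L (GRing.isLinear.Build _ _ _ _ _ Llin).
have LB s : nrm (L' s) <= nrm w * nrm s by rewrite /= /L nrmZ mulrC.
have [dg ->] := @diff_of_est _ _ _ g t L' _ LB H.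
by split => //=; rewrite /L scale1r.
Qed.

Lemma diff_line (W : normedModType C) (f : V -> W) a h (t : C) : differentiable f (a + t *: h) ->
  differentiable (fun t : C => f (a + t *: h)) t /\
  'd (fun t : C => f (a + t *: h)) t 1 = 'd f (a + t *: h) h.
Proof.
move=> df; apply: diff1_of_est => e e0.
have h1 : 0 < nrm h + 1 by rewrite ltr_wpDl ?nrm_ge0.
have eh : 0 < e / (nrm h + 1) by rewrite divr_gt0.
have [d d0 dH] := differentiable_est df eh.
exists (d / (nrm h + 1)); first by rewrite divr_gt0.
move=> s; rewrite ltr_pdivlMr // => sd.
have sh : nrm (s *: h) <= nrm s * (nrm h + 1).
  by rewrite nrmZ ler_wpM2l ?nrm_ge0 // lerDl.
have := dH (s *: h) (le_lt_trans sh sd).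
rewrite scalerDl addrA linearZ => h2; apply: le_trans h2 _.
rewrite -ler_pdivlMl // invf_div mulrA [_ / e * e]divfK ?gt_eqF // mulrC.
exact: sh.
Qed.

(** This is [deriv_bound] on the complex line [a + t h], where the disc of radius [r / nrm h] stays
    in the ball. *)
Lemma diff_bound f a (r M : R) : 0 < r ->
  (forall x, nrm (x - a) < r -> differentiable f x) ->
  (forall x, nrm (x - a) < r -> nrm (f x) <= M) ->
  forall h, nrm ('d f a h) <= 24 * M / r * nrm h.
Proof.
move=> r0 df fM h.
have [->|h0] := eqVneq h 0; first by rewrite linear0 !nrm0 mulr0.
have nh : 0 < nrm h by rewrite nrm_gt0.
have fa : differentiable f (a + 0 *: h) by rewrite scale0r addr0; apply: df; rewrite subrr nrm0.
have [_] := diff_line fa; rewrite scale0r addr0 => <-.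
rewrite (_ : 24 * M / r * nrm h = 24 * M / (r / nrm h)); last first.
  by rewrite invfM invrK mulrA.
have B t : nrm (t - 0 : C) < r / nrm h -> nrm (a + t *: h - a) < r.
  by rewrite subr0 ltr_pdivlMr // [a + _]addrC addrK nrmZ.
apply: deriv_bound; first by rewrite divr_gt0.
- by move=> t /B tr; have [] := @diff_line _ f a h t (df _ tr).
- by move=> t /B; exact: fM.
Qed.

Lemma is_derive_est (u : R -> R) (t d : R) :
  (forall e : R, 0 < e -> exists2 dl : R, 0 < dl &
   forall s, `|s| < dl -> `|u (t + s) - u t - d * s| <= e * `|s|) ->
  is_derive t 1 u d.
Proof.
move=> H.
have cv : (fun s : R => s^-1 *: (u (s *: 1 + t) - u t)) @ 0^' --> d.
  apply/cvgrPdist_le => e e0; have [dl dl0 dH] := H e e0.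
  near=> s.
  have s0 : s != 0 by near: s; exact: nbhs_dnbhs_neq.
  have sd : `|s| < dl.
    near: s; apply: dnbhs0_lt => //.
  have := dH s sd; rewrite /GRing.scale /= mulr1 [s + t]addrC => h.
  rewrite -(ler_pM2r (_ : 0 < `|s|)) ?normr_gt0 //.
  apply: le_trans h; rewrite -normrM mulrBl mulrAC mulVf // mul1r distrC //.
apply: DeriveDef; first by apply/cvg_ex; exists d.
exact: cvg_lim cv.
Unshelve. all: by end_near. Qed.

(** The real mean value theorem is applied to the real and the imaginary part along the segment,
    hence the factor 2. *)
Lemma segment_lip f x h (B : R) :
  (forall t : R, 0 <= t <= 1 -> differentiable f (x + toC t *: h)) ->
  (forall t : R, 0 <= t <= 1 -> nrm ('d f (x + toC t *: h) h) <= B) ->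
  nrm (f (x + h) - f x) <= 2 * B.
Proof.
move=> df dB.
have est (t : R) : 0 <= t <= 1 -> forall e : R, 0 < e -> exists2 dl : R, 0 < dl &
   forall s, `|s| < dl -> nrm (f (x + toC (t + s) *: h) - f (x + toC t *: h)
      - toC s * 'd f (x + toC t *: h) h) <= e * `|s|.
  move=> t01 e e0; have [d1 d2] := diff_line (df _ t01).
  have [d d0 dH] := differentiable_est d1 e0.
  exists d => // s sd; have := dH (toC s); rewrite nrm_toC => /(_ sd).
  by rewrite diff_scal // d2 -toCD.
have dre (t : R) : 0 <= t <= 1 ->
    is_derive t 1 (fun t => reC (f (x + toC t *: h))) (reC ('d f (x + toC t *: h) h)).
  move=> t01; apply: is_derive_est => e e0; have [d d0 dH] := est t t01 e e0.
  exists d => // s /dH; apply: le_trans.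
  set D := 'd _ _ _.
  have -> : reC D * s = reC (toC s * D) by rewrite reCM /= mul0r subr0 mulrC.
  by rewrite -!reCN -!reCD reC_le.
have dim (t : R) : 0 <= t <= 1 ->
    is_derive t 1 (fun t => imC (f (x + toC t *: h))) (imC ('d f (x + toC t *: h) h)).
  move=> t01; apply: is_derive_est => e e0; have [d d0 dH] := est t t01 e e0.
  exists d => // s /dH; apply: le_trans.
  set D := 'd _ _ _.
  have -> : imC D * s = imC (toC s * D) by rewrite imCM /= mul0r addr0 mulrC.
  by rewrite -!imCN -!imCD imC_le.
have cont (u du : R -> R) : (forall t : R, 0 <= t <= 1 -> is_derive t 1 u (du t)) ->
    (forall t : R, 0 <= t <= 1 -> `|du t| <= B) -> `|u 1 - u 0| <= B.
  move=> du1 duB.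
  have [||c c01 ->] := @MVT _ u du 0 1 ltr01.
  - by move=> t; rewrite in_itv /= => /andP[t0 t1]; apply: du1; rewrite !ltW.
  - apply: continuous_in_subspaceT => t; rewrite inE /= in_itv /= => t01.
    apply: differentiable_continuous; apply/derivable1_diffP.
    by have [] := du1 t t01.
  rewrite subr0 mulr1; apply: duB; move: c01; rewrite in_itv /= => /andP[? ?].
  by rewrite !ltW.
have : `|imC (f (x + toC 1 *: h)) - imC (f (x + toC 0 *: h))| <= B.
  apply: (cont (fun t => imC (f (x + toC t *: h))) _ dim) => t t01.
  exact: le_trans (imC_le _) (dB t t01).
have : `|reC (f (x + toC 1 *: h)) - reC (f (x + toC 0 *: h))| <= B.
  apply: (cont (fun t => reC (f (x + toC t *: h))) _ dre) => t t01.
  exact: le_trans (reC_le _) (dB t t01).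
rewrite -[toC 1]/(1 : C) -[toC 0]/(0 : C) !scale1r !scale0r !addr0 => h1 h2.
apply: le_trans (nrm_le_re_im _) _; rewrite reCD imCD reCN imCN.
move: h1 h2; clear; lra.
Qed.

Lemma segment_ball (a x y : V) (r t : R) : nrm (x - a) < r -> nrm (y - a) < r ->
  0 <= t <= 1 -> nrm (x + toC t *: (y - x) - a) < r.
Proof.
move=> xr yr /andP[t0 t1].
have -> : x + toC t *: (y - x) - a = toC (1 - t) *: (x - a) + toC t *: (y - a).
  have -> : toC (1 - t) = 1 - toC t by apply: C_ext => /=; ring.
  rewrite scalerBl scale1r -[RHS]addrA [- _ + _]addrC -scalerBr opprB.
  by rewrite [y - a + _]addrA subrK addrAC.
apply: le_lt_trans (nrmD _ _) _; rewrite !nrmZ !nrm_toC.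
rewrite (ger0_norm t0) ger0_norm ?subr_ge0 //.
have : (1 - t) * (r - nrm (x - a)) + t * (r - nrm (y - a)) > 0.
  have [t12|t12] := lerP t (1/2).
    apply: ltr_pwDl; first by rewrite mulr_gt0 ?subr_gt0 //; move: t12; clear; lra.
    by rewrite mulr_ge0 // subr_ge0 ltW.
  apply: ltr_wpDl; first by rewrite mulr_ge0 ?subr_ge0 // ltW.
  by rewrite mulr_gt0 ?subr_gt0 //; move: t12; clear; lra.
clear; lra.
Qed.

Lemma ball_half (a x y : V) (r : R) : nrm (x - a) < r / 2 -> nrm (y - x) < r / 2 -> nrm (y - a) < r.
Proof.
move=> h1 h2; apply: le_lt_trans (nrmBD _ x _) _; move: h1 h2; clear; lra.
Qed.

(** From a point of the half ball a radius [r / 2] remains, so the differential there is bounded by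
    [24 M / (r / 2)]; [segment_lip] doubles this. *)
Lemma ball_lip f a (r M : R) : 0 < r ->
  (forall x, nrm (x - a) < r -> differentiable f x) ->
  (forall x, nrm (x - a) < r -> nrm (f x) <= M) ->
  forall x y, nrm (x - a) < r / 2 -> nrm (y - a) < r / 2 ->
  nrm (f y - f x) <= 96 * M / r * nrm (y - x).
Proof.
move=> r0 df fM x y xr yr.
have r20 : 0 < r / 2 by rewrite divr_gt0.
rewrite -[in f y](subrK x y) [y - x + x]addrC.
rewrite (_ : 96 * M / r * _ = 2 * (24 * M / (r / 2) * nrm (y - x))); last first.
  by rewrite invfM invrK; ring.
have sb t : 0 <= t <= 1 -> nrm (x + toC t *: (y - x) - a) < r / 2 by exact: segment_ball.
apply: segment_lip => t t01.
  by apply: df; apply: lt_trans (sb t t01) _; move: r0; clear; lra.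
by apply: (diff_bound r20) => z zr; [apply: df|apply: fM]; exact: ball_half (sb t t01) zr.
Qed.

End Normed.
End Cauchy.

Lemma diff_sub (K : numFieldType) (V W : normedModType K) (f g : V -> W) x h :
  differentiable f x -> differentiable g x ->
  'd (fun x => f x - g x) x h = 'd f x h - 'd g x h.
Proof.
by move=> df dg; rewrite -[fun x => _]/(f - g); have -> := diffB df dg.
Qed.

Lemma diff_linE (K : numFieldType) (V W : normedModType K) (L : {linear V -> W}) x h :
  continuous L -> 'd L x h = L h.
Proof. by move=> cL; rewrite diff_lin. Qed.

(** * Second-order remainders and uniform limits *)

Section Remainder.
Context {R : realType}.
Local Notation C := (Cplx R).
Variable V : normedModType C.
Implicit Types (f g : V -> C) (a h x : V).

Lemma le_of_small (A B K : R) : 0 <= K ->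
  (forall e : R, 0 < e -> A <= B + K * e) -> A <= B.
Proof.
move=> K0 H; apply/ler_addgt0Pr => e e0.
have K1 : 0 < K + 1 by rewrite ltr_wpDl.
have e1 : 0 < e / (K + 1) by rewrite divr_gt0.
apply: le_trans (H _ e1) _; rewrite lerD2l mulrA ler_pdivrMr // mulrC.
by rewrite ler_pM2l // lerDl.
Qed.

Lemma diffquot_cvg f x h : differentiable f x -> forall e : R, 0 < e ->
  exists2 d : R, 0 < d & forall t : C, 0 < nrm t < d ->
  nrm (t^-1 * (f (x + t *: h) - f x) - 'd f x h) <= e.
Proof.
move=> df e e0.
have fx : differentiable f (x + 0 *: h) by rewrite scale0r addr0.
have [d1 d2] := diff_line fx.
have [d d0 dH] := differentiable_est d1 e0.
exists d => // t /andP[t0 td]; have := dH t td.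
rewrite (diff_scal _ d1) d2 add0r scale0r addr0 => h1.
have tn : t != 0 by rewrite -nrm_gt0.
rewrite (_ : _ - _ = t^-1 * (f (x + t *: h) - f x - t * 'd f x h)); last first.
  by rewrite [RHS]mulrBr mulKf.
by rewrite nrmM nrmV ler_pdivrMl // [leRHS]mulrC.
Qed.

(** Second derivatives are avoided: the difference quotient of step [t] is holomorphic on a ball of
    radius [r / 4] and bounded there by [ball_lip], uniformly in [t]. A second use of [ball_lip]
    makes it Lipschitz, and [t] tends to 0. *)
Lemma diff_lip f a (r M : R) : 0 < r ->
  (forall x, nrm (x - a) < r -> differentiable f x) ->
  (forall x, nrm (x - a) < r -> nrm (f x) <= M) ->
  forall h x y, nrm (x - a) < r / 8 -> nrm (y - a) < r / 8 ->
  nrm ('d f y h - 'd f x h) <= (4 * (96 * 96)) * M / r ^+ 2 * nrm h * nrm (y - x).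
Proof.
move=> r0 df fM h x y xr yr.
have [->|h0] := eqVneq h 0; first by rewrite !linear0 ?subr0 ?addr0 !nrm0 mulr0 mul0r.
have nh : 0 < nrm h by rewrite nrm_gt0.
have r4 : 0 < r / 4 by rewrite divr_gt0.
have r48 : r / 4 / 2 = r / 8 by field.
have lt4 z : nrm (z - a) < r / 4 -> nrm (z - a) < r / 2.
  by move=> zr; apply: lt_trans zr _; move: r0; clear; lra.
have lt8 z : nrm (z - a) < r / 8 -> nrm (z - a) < r.
  by move=> zr; apply: lt_trans zr _; move: r0; clear; lra.
apply: (@le_of_small _ _ 2) => // e e0.
have [d1 d10 dH1] := diffquot_cvg h (df _ (lt8 _ xr)) e0.
have [d2 d20 dH2] := diffquot_cvg h (df _ (lt8 _ yr)) e0.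
pose d := Num.min (Num.min d1 d2) (r / 4 / nrm h).
have d0 : 0 < d by rewrite !lt_min d10 d20 divr_gt0.
pose t : C := toC (d / 2).
have d2d : d / 2 < d by move: d0; clear; lra.
have tn : nrm t = d / 2 by rewrite nrm_toC ger0_norm // divr_ge0 // ltW.
have tdd : 0 < nrm t < d by rewrite tn d2d divr_gt0.
have t1 : 0 < nrm t < d1.
  case/andP: tdd => -> td; apply: lt_le_trans td _; by rewrite !ge_min lexx.
have t2 : 0 < nrm t < d2.
  case/andP: tdd => -> td; apply: lt_le_trans td _; by rewrite !ge_min lexx orbT.
have t3 : nrm (t *: h) < r / 4.
  rewrite nrmZ -ltr_pdivlMr //; case/andP: tdd => _ td; apply: lt_le_trans td _.
  by rewrite ge_min lexx orbT.
have t0 : 0 < nrm t by case/andP: t1.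
pose q z := t^-1 * (f (z + t *: h) - f z).
have shift z : nrm (z - a) < r / 4 -> nrm (z + t *: h - a) < r / 2.
  move=> zr; rewrite addrAC; apply: le_lt_trans (nrmD _ _) _.
  by move: zr t3; clear; lra.
have lt2 z : nrm (z - a) < r / 2 -> nrm (z - a) < r.
  by move=> zr; apply: lt_trans zr _; move: r0; clear; lra.
have dq z : nrm (z - a) < r / 4 -> differentiable q z.
  move=> zr; apply: differentiableM; first exact: differentiable_cst.
  apply: differentiableB; last exact/df/lt2/lt4.
  have dfz := df _ (lt2 _ (shift _ zr)); rewrite addrC in dfz.
  have -> : (fun z => f (z + t *: h)) = (fun z => f (t *: h + z)).
    by apply/funext => w; rewrite addrC.
  exact: differentiable_shift dfz.
have qM z : nrm (z - a) < r / 4 -> nrm (q z) <= 96 * M / r * nrm h.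
  move=> zr; rewrite nrmM nrmV ler_pdivrMl //.
  have := @ball_lip _ V f a r M r0 df fM z (z + t *: h) (lt4 _ zr) (shift _ zr).
  rewrite [z + _ - z]addrAC subrr add0r nrmZ => h1; apply: le_trans h1 _.
  by rewrite mulrCA.
have := @ball_lip _ V q a (r / 4) _ r4 dq qM x y; rewrite r48 => /(_ xr yr) h1.
have h2 := dH1 t t1; have h3 := dH2 t t2; rewrite -/(q x) -/(q y) in h2 h3.
rewrite (_ : _ - _ = (q y - q x) - (q y - 'd f y h) + (q x - 'd f x h)); last first.
  by ring.
apply: le_trans (nrmD _ _) _; apply: le_trans (lerD (nrmB _ _) (lexx _)) _.
rewrite (_ : (4 * (96 * 96)) * M / r ^+ 2 * nrm h * nrm (y - x) =
   96 * (96 * M / r * nrm h) / (r / 4) * nrm (y - x)); last first.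
  by field; rewrite gt_eqF.
move: h1 h2 h3; clear; lra.
Qed.

(** [segment_lip] is applied to [f] minus its differential at [a], whose own differential along the
    segment is small by [diff_lip]. The constant depends on [r] and [M] only, which is what passes
    to limits. *)
Lemma remainder_bound f a (r M : R) : 0 < r ->
  (forall x, nrm (x - a) < r -> differentiable f x) ->
  (forall x, nrm (x - a) < r -> nrm (f x) <= M) ->
  forall h, nrm h < r / 8 ->
  nrm (f (a + h) - f a - 'd f a h) <= (8 * (96 * 96)) * M / r ^+ 2 * nrm h ^+ 2.
Proof.
move=> r0 df fM h hr.
have dfa : differentiable f a by apply: df; rewrite subrr nrm0.
have M0 : 0 <= M.
  by apply: le_trans (nrm_ge0 (f a)) _; apply: fM; rewrite subrr nrm0.
have cL := diff_continuous dfa.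
have dL x : differentiable ('d f a) x by exact: linear_differentiable.
pose g x := f x - 'd f a x.
have -> : f (a + h) - f a - 'd f a h = g (a + h) - g a.
  by rewrite /g linearD; ring.
rewrite (_ : (8 * (96 * 96)) * M / r ^+ 2 * nrm h ^+ 2 =
  2 * ((4 * (96 * 96)) * M / r ^+ 2 * nrm h ^+ 2)); last by ring.
have sb t : 0 <= t <= 1 -> nrm (a + toC t *: h - a) <= nrm h.
  move=> /andP[t0 t1]; rewrite [a + _]addrC addrK nrmZ nrm_toC ger0_norm //.
  by rewrite ler_piMl ?nrm_ge0.
have lt8 z : nrm (z - a) < r / 8 -> nrm (z - a) < r.
  by move=> zr; apply: lt_trans zr _; move: r0; clear; lra.
have sr t : 0 <= t <= 1 -> nrm (a + toC t *: h - a) < r / 8.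
  by move=> /sb h1; exact: le_lt_trans hr.
apply: segment_lip => t t01; have dft := df _ (lt8 _ (sr _ t01)).
  exact: differentiableB.
have E : 'd g (a + toC t *: h) h = 'd f (a + toC t *: h) h - 'd f a h.
  apply: etrans (diff_sub h dft (dL _)) _; congr (_ - _).
  exact: diff_linE.
have a8 : nrm (a - a) < r / 8 by rewrite subrr nrm0 divr_gt0.
have := diff_lip r0 df fM h a8 (sr _ t01); rewrite -E => h1; apply: le_trans h1 _.
rewrite -mulrA [nrm h ^+ 2]expr2 ler_wpM2l //; last by rewrite ler_wpM2l ?nrm_ge0 // sb.
by rewrite !mulr_ge0 // invr_ge0 exprn_ge0 // ltW.
Qed.

Lemma C_complete (u : nat -> C) :
  (forall e : R, 0 < e -> exists N, forall n m, (N <= n)%N -> (N <= m)%N -> nrm (u n - u m) <= e) ->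
  exists l, forall e : R, 0 < e -> exists N, forall n, (N <= n)%N -> nrm (u n - l) <= e.
Proof.
move=> H.
have real (v : nat -> R) : (forall n m, `|v n - v m| <= nrm (u n - u m)) ->
    exists l, forall e : R, 0 < e -> exists N, forall n, (N <= n)%N -> `|v n - l| <= e.
  move=> vu; have : cauchy (v @ \oo).
    apply/cauchy_exP => e e0; have e20 : 0 < e / 2 by rewrite divr_gt0.
    have [N NH] := H _ e20; exists (v N); exists N => // n /= Nn.
    rewrite /ball /=; apply: le_lt_trans (vu _ _) _.
    by apply: le_lt_trans (NH N n (leqnn N) Nn) _; move: e0; clear; lra.
  move=> /cauchy_cvgP /cvg_ex[l vl]; exists l => e e0.
  have /cvgrPdist_le /(_ e e0)[N _ NH] := vl.
  by exists N => n /NH /=; rewrite distrC.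
have [n m|l1 H1] := real (fun n => reC (u n)); first by rewrite -reCN -reCD reC_le.
have [n m|l2 H2] := real (fun n => imC (u n)); first by rewrite -imCN -imCD imC_le.
exists (mkC l1 l2) => e e0; have e20 : 0 < e / 2 by rewrite divr_gt0.
have [N1 {}H1] := H1 _ e20; have [N2 {}H2] := H2 _ e20.
exists (maxn N1 N2) => n; rewrite geq_max => /andP[/H1 h1 /H2 h2].
apply: le_trans (nrm_le_re_im _) _; rewrite reCD imCD reCN imCN /=.
by move: h1 h2; clear; lra.
Qed.

(** The approximants are uniformly bounded near [a]; by [diff_bound] their differentials at [a] form
    a Cauchy sequence, and the uniform second-order remainder shows that the limit is the
    differential of [f]. *)
Lemma weierstrass f a (r : R) : 0 < r ->
  (forall e : R, 0 < e -> exists g, forall x, nrm (x - a) < r ->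
     differentiable g x /\ nrm (g x - f x) <= e) ->
  differentiable f a.
Proof.
move=> r0 H.
have n1 n : 0 < (n.+1%:R)^-1 :> R by rewrite invr_gt0.
have [G GP] := choice (fun n => H _ (n1 n)).
have aa : nrm (a - a) < r by rewrite subrr nrm0.
have [rho rho0 [rhor [M M0 GM]]] : exists2 rho : R, 0 < rho & rho <= r /\ (exists2 M : R, 0 < M &
    forall n x, nrm (x - a) < rho -> nrm (G n x) <= M).
  have /differentiable_continuous/continuous_nrmP/(_ 1 ltr01)[d d0 dH] := (GP 0%N a aa).1.
  exists (Num.min d r); first by rewrite lt_min d0.
  split; first by rewrite ge_min lexx orbT.
  exists (nrm (G 0%N a) + 3); first by rewrite ltr_wpDl ?nrm_ge0.
  move=> n x; rewrite lt_min => /andP[xd xr].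
  have h1 := dH x xd; have h2 := (GP 0%N x xr).2; have h3 := (GP n x xr).2.
  have h4 : (n.+1%:R)^-1 <= 1 :> R by rewrite invf_le1 // ler1n.
  rewrite invr1 in h2.
  have -> : G n x = (G n x - f x) - (G 0%N x - f x) + (G 0%N x - G 0%N a) + G 0%N a by ring.
  apply: le_trans (nrmD _ _) _; rewrite addrC lerD2l.
  apply: le_trans (nrmD _ _) _; apply: le_trans (lerD (nrmB _ _) (lexx _)) _.
  by move: h1 h2 (le_trans h3 h4); clear; lra.
have dG n x : nrm (x - a) < rho -> differentiable (G n) x.
  by move=> xr; have [] := GP n x (lt_le_trans xr rhor).
have aar : nrm (a - a) < rho by rewrite subrr nrm0.
have dGa n : differentiable (G n) a by exact: dG.
have inv_small (K e : R) : 0 <= K -> 0 < e -> exists N, forall n, (N <= n)%N -> K * n.+1%:R^-1 <= e.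
  move=> K0 e0; have NK := archi_boundP (divr_ge0 K0 (ltW e0)).
  set N := Num.bound (K / e) in NK.
  exists N => n Nn; rewrite ler_pdivrMr // mulrC -ler_pdivrMr //.
  apply: le_trans (ltW NK) _; rewrite ler_nat; exact: leqW.
(* The differential of [G n - G m] is controlled by a uniform bound of this difference. *)
have cauchy h : exists l, forall e : R, 0 < e -> exists N, forall n, (N <= n)%N -> nrm ('d (G n) a h - l) <= e.
  apply: C_complete => e e0.
  have K0 : 0 <= 24 * 2 / rho * nrm h by rewrite mulr_ge0 ?nrm_ge0 // divr_ge0 // ltW.
  have [N NP] := inv_small _ _ K0 e0.
  exists N => n m Nn Nm.
  have <- : 'd (fun x => G n x - G m x) a h = 'd (G n) a h - 'd (G m) a h.
    exact: diff_sub.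
  apply: le_trans (NP N (leqnn N)).
  rewrite (_ : 24 * 2 / rho * nrm h * N.+1%:R^-1 = 24 * (2 * N.+1%:R^-1) / rho * nrm h); last by ring.
  apply: (diff_bound rho0) => x xr; first by apply: differentiableB; exact: dG.
  have xr' := lt_le_trans xr rhor.
  have h1 := (GP n x xr').2; have h2 := (GP m x xr').2.
  have le k : (N <= k)%N -> k.+1%:R^-1 <= N.+1%:R^-1 :> R.
    by move=> Nk; rewrite lef_pV2 ?posrE // ler_nat.
  have h3 := le_trans h1 (le n Nn); have h4 := le_trans h2 (le m Nm).
  have -> : G n x - G m x = (G n x - f x) - (G m x - f x) by ring.
  apply: le_trans (nrmB _ _) _; move: h3 h4; move: (N.+1%:R^-1) => dl; clear; lra.
have [L LP] := choice cauchy.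
have Lbound h : nrm (L h) <= 24 * M / rho * nrm h.
  apply: (@le_of_small _ _ 1) => // e e0; have [N /(_ N (leqnn N)) NP] := LP h e e0.
  have h1 := diff_bound rho0 (dG N) (GM N) h.
  have -> : L h = 'd (G N) a h - ('d (G N) a h - L h) by ring.
  by apply: le_trans (nrmB _ _) _; rewrite mul1r; exact: lerD.
have Llin : linear L.
  move=> k u v; apply/eqP; rewrite -subr_eq0 -nrm_eq0; apply/eqP/le_anti; rewrite nrm_ge0 andbT.
  have K0 : 0 <= 2 + nrm k by rewrite addr_ge0 ?nrm_ge0.
  apply: (le_of_small K0) => e e0.
  have [N1 H1] := LP (k *: u + v) e e0; have [N2 H2] := LP u e e0; have [N3 H3] := LP v e e0.
  pose N := maxn N1 (maxn N2 N3).
  have h1 := H1 N (leq_maxl _ _).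
  have h2 := H2 N (leq_trans (leq_maxl _ _) (leq_maxr _ _)).
  have h3 := H3 N (leq_trans (leq_maxr _ _) (leq_maxr _ _)).
  have -> : L (k *: u + v) - (k *: L u + L v) =
     k * ('d (G N) a u - L u) + ('d (G N) a v - L v) - ('d (G N) a (k *: u + v) - L (k *: u + v)).
    have El : 'd (G N) a (k *: u + v) = k * 'd (G N) a u + 'd (G N) a v by exact: linearP.
    have Es : k *: L u = k * L u by [].
    by rewrite El Es; ring.
  rewrite add0r; apply: le_trans (nrmB _ _) _; apply: le_trans (lerD (nrmD _ _) (lexx _)) _.
  rewrite nrmM.
  have h4 : nrm k * nrm ('d (G N) a u - L u) <= nrm k * e by rewrite ler_wpM2l ?nrm_ge0.
  rewrite mulrDl; move: h1 h3 h4; clear; lra.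
pose L' : {linear V -> C} := HB.pack L (GRing.isLinear.Build _ _ _ _ _ Llin).
(* [remainder_bound] holds for every [G n] with the same constant, so it survives the limit. *)
have rem h : nrm h < rho / 8 -> nrm (f (a + h) - f a - L h) <= (8 * (96 * 96)) * M / rho ^+ 2 * nrm h ^+ 2.
  move=> hr; apply: (@le_of_small _ _ 3) => // e e0.
  have ahr : nrm (a + h - a) < r.
    rewrite [a + _]addrC addrK; apply: lt_le_trans hr _.
    by apply: le_trans rhor; move: rho0; clear; lra.
  have [N1 H1] := LP h e e0; have [N2 H2] := inv_small _ _ ler01 e0.
  pose N := maxn N1 N2.
  have h1 := H1 N (leq_maxl _ _); have h2 := H2 N (leq_maxr _ _); rewrite mul1r in h2.
  have h3 := le_trans (GP N _ ahr).2 h2; have h4 := le_trans (GP N _ aa).2 h2.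
  have h5 := remainder_bound rho0 (dG N) (GM N) hr.
  have -> : f (a + h) - f a - L h = (G N (a + h) - G N a - 'd (G N) a h)
     - (G N (a + h) - f (a + h)) + (G N a - f a) + ('d (G N) a h - L h) by ring.
  apply: le_trans (nrmD _ _) _; apply: le_trans (lerD (nrmD _ _) (lexx _)) _.
  apply: le_trans (lerD (lerD (nrmB _ _) (lexx _)) (lexx _)) _.
  by move: h1 h3 h4 h5; clear; lra.
have LB h : nrm (L' h) <= 24 * M / rho * nrm h by exact: Lbound.
have [] // := @diff_of_est _ _ _ f a L' _ LB.
move=> e e0; pose K := (8 * (96 * 96)) * M / rho ^+ 2.
have K0 : 0 < K by rewrite /K divr_gt0 ?exprn_gt0 // mulr_gt0 // !mulr_gt0.
exists (Num.min (rho / 8) (e / K)); first by rewrite lt_min (divr_gt0 e0 K0) divr_gt0.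
move=> h; rewrite lt_min => /andP[h1 h2]; apply: le_trans (rem h h1) _.
by rewrite -/K [nrm h ^+ 2]expr2 mulrA ler_wpM2r ?nrm_ge0 // mulrC -ler_pdivlMr // ltW.
Qed.

(** Difference quotients in the direction [v] are holomorphic, and [remainder_bound] makes them
    converge uniformly near [a]; [weierstrass] concludes. *)
Lemma diff_holo f a v (r : R) : 0 < r ->
  (forall x, nrm (x - a) < r -> differentiable f x) ->
  differentiable (fun x => 'd f x v) a.
Proof.
move=> r0 df.
have aa : nrm (a - a) < r by rewrite subrr nrm0.
have [rho rho0 [rhor [M M0 fM]]] : exists2 rho : R, 0 < rho & rho <= r /\ (exists2 M : R, 0 < M &
    forall x, nrm (x - a) < rho -> nrm (f x) <= M).
  have /differentiable_continuous/continuous_nrmP/(_ 1 ltr01)[d d0 dH] := df a aa.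
  exists (Num.min d r); first by rewrite lt_min d0.
  split; first by rewrite ge_min lexx orbT.
  exists (nrm (f a) + 1); first by rewrite ltr_wpDl ?nrm_ge0.
  move=> x; rewrite lt_min => /andP[xd xr]; rewrite -[f x](subrK (f a)) addrC.
  by apply: le_trans (nrmD _ _) _; rewrite lerD2l ltW // dH.
have dfr x : nrm (x - a) < rho -> differentiable f x.
  by move=> xr; apply: df; exact: lt_le_trans rhor.
have rho20 : 0 < rho / 2 by rewrite divr_gt0.
apply: (weierstrass rho20) => e e0.
pose K := (8 * (96 * 96)) * M / (rho / 2) ^+ 2 * nrm v ^+ 2 + 1.
have K0 : 0 < K.
  rewrite /K ltr_wpDl // mulr_ge0 ?exprn_ge0 ?nrm_ge0 // divr_ge0 //.
    by rewrite !mulr_ge0 // ltW.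
  by rewrite exprn_ge0 // ltW.
have v1 : 0 < nrm v + 1 by rewrite ltr_wpDl ?nrm_ge0.
pose s := Num.min (e / K) (rho / 2 / 8 / (nrm v + 1)).
have s0 : 0 < s by rewrite lt_min (divr_gt0 e0 K0) !divr_gt0.
pose t : C := toC (s / 2).
have ss : s / 2 < s by move: s0; clear; lra.
have tn : nrm t = s / 2 by rewrite nrm_toC ger0_norm // divr_ge0 // ltW.
have t0 : 0 < nrm t by rewrite tn divr_gt0.
have te : nrm t * K <= e.
  by rewrite -ler_pdivlMr // tn; apply: le_trans (ltW ss) _; rewrite ge_min lexx.
have tv : nrm (t *: v) < rho / 2 / 8.
  rewrite nrmZ; apply: le_lt_trans (_ : nrm t * (nrm v + 1) < _).
    by rewrite ler_wpM2l ?nrm_ge0 // lerDl.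
  rewrite -ltr_pdivlMr // tn; apply: lt_le_trans ss _; by rewrite ge_min lexx orbT.
exists (fun x => t^-1 * (f (x + t *: v) - f x)) => x xr.
have br y : nrm (y - x) < rho / 2 -> nrm (y - a) < rho by exact: ball_half xr.
have xx : nrm (x - x) < rho / 2 by rewrite subrr nrm0.
have xtv : nrm (t *: v + x - a) < rho.
  by apply: br; rewrite addrK; apply: lt_trans tv _; move: rho0; clear; lra.
split.
  apply: differentiableM; first exact: differentiable_cst.
  apply: differentiableB; last exact/dfr/br.
  have -> : (fun z => f (z + t *: v)) = (fun z => f (t *: v + z)).
    by apply/funext => w; rewrite addrC.
  exact: (differentiable_shift (dfr _ xtv)).
have := @remainder_bound f x (rho / 2) M rho20 (fun y yx => dfr y (br y yx)) (fun y yx => fM y (br y yx)) _ tv.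
rewrite linearZ /= -[t *: 'd f x v]/(t * 'd f x v) nrmZ => h.
have tn0 : t != 0 by rewrite -nrm_gt0.
rewrite (_ : _ - _ = t^-1 * (f (x + t *: v) - f x - t * 'd f x v)); last first.
  by rewrite [RHS]mulrBr mulKf.
rewrite nrmM nrmV ler_pdivrMl //; apply: le_trans h _.
apply: le_trans (_ : nrm t * (nrm t * K) <= _); last by rewrite ler_pM2l.
rewrite /K; move: (8 * (96 * 96) * M / _) => K'.
rewrite (_ : _ * (nrm t * nrm v) ^+ 2 = nrm t * (nrm t * (K' * nrm v ^+ 2))); last ring.
by rewrite ler_pM2l // ler_pM2l // lerDl.
Qed.

End Remainder.

(** * Zeros of holomorphic functions *)

Section Compactness.
Context {R : realType}.
Local Notation C := (Cplx R).

Lemma nrm_continuous (V : normedModType C) : continuous (fun x : V => nrm x : R).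
Proof.
move=> x; apply/cvgrPdist_lt => e e0; apply/nbhs_nrmP; exists e => // y yx.
apply: le_lt_trans yx; have := ler_nrmB x y; have := ler_nrmB y x.
rewrite ler_norml [nrm (x - y)]nrm_distC => h1 h2; apply/andP; split => //.
by rewrite lerNl opprB.
Qed.

Lemma toC_continuous : continuous (toC : R -> C).
Proof.
move=> x A /nbhs_nrmP[e e0 eA]; apply/nbhs_ballP; exists e => //= y.
rewrite /ball /= => yx; apply: eA.
by rewrite [_ - _](_ : _ = toC (y - x)) ?nrm_toC 1?distrC //; apply: C_ext => /=; ring.
Qed.

Lemma compact_disc (M : R) : compact [set z : C | nrm z <= M].
Proof.
pose f (p : R * R) : C := toC p.1 + iC * toC p.2.
have cf : continuous f.
  move=> p; apply: (@cvgD _ C _ _ _ (fun p : R * R => toC p.1) (fun p : R * R => iC * toC p.2)).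
    by apply: (@continuous_comp _ _ _ fst toC); [exact: cvg_fst|exact: toC_continuous].
  apply: cvgMr.
  by apply: (@continuous_comp _ _ _ snd toC); [exact: cvg_snd|exact: toC_continuous].
have cS : compact (f @` (`[-M, M]%classic `*` `[-M, M]%classic)).
  apply: continuous_compact; first exact: continuous_subspaceT.
  by apply: compact_setX; exact: segment_compact.
apply: (subclosed_compact _ cS).
  have -> : [set z : C | nrm z <= M] = (fun z : C => nrm z : R) @^-1` [set x | x <= M] by [].
  by apply: closed_comp; [move=> z _; exact: nrm_continuous|exact: closed_le].
move=> z /= zM; exists (reC z, imC z).
  by split => /=; rewrite in_itv /= -ler_norml; apply: le_trans zM; [exact: reC_le|exact: imC_le].
by rewrite /f /= -mkCE mkC_eta.
Qed.

Lemma annulus_min (u : C -> C) (a b : R) : 0 < a -> a <= b ->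
  (forall z, a <= nrm z <= b -> {for z, continuous u}) ->
  (forall z, a <= nrm z <= b -> u z != 0) ->
  exists2 m : R, 0 < m & forall z, a <= nrm z <= b -> m <= nrm (u z).
Proof.
move=> a0 ab cu u0.
pose A := [set z : C | a <= nrm z <= b].
have cA : compact A.
  apply: (subclosed_compact _ (@compact_disc b)); last by move=> z /= /andP[].
  have -> : A = (fun z : C => nrm z : R) @^-1` `[a, b].
    by apply/seteqP; split => z /=; rewrite in_itv.
  by apply: closed_comp; [move=> z _; exact: nrm_continuous|exact: itv_closed].
have A0 : A !=set0.
  by exists (toC a); rewrite /A /= nrm_toC ger0_norm ?lexx // ltW.
have cn : {within A, continuous (fun z => nrm (u z) : R)}.
  apply: continuous_in_subspaceT => z /set_mem zA.
  by apply: (@continuous_comp _ _ _ u (fun x : C => nrm x : R)); [exact: cu|exact: nrm_continuous].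
have [z zA zm] := compact_EVT_min A0 cA cn.
exists (nrm (u z)); first by rewrite nrm_gt0 u0 // (set_mem zA).
by move=> w wA; apply: zm; rewrite inE.
Qed.

End Compactness.

Lemma differentiable_pow (K : numFieldType) (V : normedModType K) (f : V -> K) x k :
  differentiable f x -> differentiable (fun y => f y ^+ k) x.
Proof.
move=> df; elim: k => [|k IH].
  by under eq_fun do rewrite expr0; exact: differentiable_cst.
by under eq_fun do rewrite exprS; exact: differentiableM.
Qed.

Section Zeros.
Context {R : realType}.
Local Notation C := (Cplx R).

(* Otherwise [punctured_bound] applies to [1 / u]. *)
Lemma hurwitz (u : C -> C) (r m : R) : 0 < r -> 0 < m ->
  (forall z, nrm z < 3 * r -> differentiable u z) ->
  (forall z, r <= nrm z < 3 * r -> m <= nrm (u z)) ->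
  nrm (u 0) < m / 4 -> exists2 z, nrm z < r & u z = 0.
Proof.
move=> r0 m0 du um u0; apply: contrapT => H.
have nz z : nrm z < 3 * r -> u z != 0.
  move=> z3; apply/eqP => uz; have [zr|zr] := ltP (nrm z) r.
    by apply: H; exists z.
  have := um z; rewrite zr z3 uz nrm0 => /(_ isT); rewrite leNgt m0 //.
have r23 : 2 * r < 3 * r by move: r0; clear; lra.
have z3 : nrm (0 : C) < 3 * r by rewrite nrm0 mulr_gt0.
have dV z : nrm z < 3 * r -> differentiable (fun z => (u z)^-1) z.
  by move=> zr; apply: differentiableV; [exact: du|exact: nz].
have : nrm (u 0)^-1 <= 4 * m^-1.
  apply: (@punctured_bound _ (fun z => (u z)^-1) 0 (3 * r) r m^-1 r0 r23).
  - by move=> z; rewrite subr0 => /andP[_]; exact: dV.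
  - exact: differentiable_continuous (dV _ z3).
  - move=> z; rewrite subr0 => /andP[z1 z2]; have zr := le_lt_trans z2 r23.
    by rewrite nrmV lef_pV2 ?posrE ?nrm_gt0 ?nz // um // z1 zr.
rewrite nrmV => h.
have n0 : 0 < nrm (u 0) by rewrite nrm_gt0 nz.
move: h; rewrite -[X in X <= _]mul1r ler_pdivrMr // mulrAC ler_pdivlMr // mul1r.
move: u0; clear; lra.
Qed.

Variable V : normedModType C.

(** On the line through [a] an annulus free of zeros surrounds [t = 0]. For small [w] the
    restriction of [J] to the parallel line through [a + w] is uniformly close to the one through
    [a], and [hurwitz] keeps a zero. *)
Lemma line_zero (J : V -> C) (a v : V) (r eta M : R) : 0 < eta -> 8 * (eta * nrm v) < r ->
  (forall x, nrm (x - a) < r -> differentiable J x) ->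
  (forall x, nrm (x - a) < r -> nrm (J x) <= M) -> J a = 0 ->
  (forall t : C, eta <= nrm t <= 3 * eta -> J (a + t *: v) != 0) ->
  exists2 d : R, 0 < d & forall w, nrm w < d -> exists2 t : C, nrm t < eta & J (a + w + t *: v) = 0.
Proof.
move=> eta0 etar dJ JM Ja Jn.
have n0 := nrm_ge0 v.
have en0 : 0 <= eta * nrm v by rewrite mulr_ge0 // ltW.
have r0 : 0 < r by apply: le_lt_trans etar; rewrite mulr_ge0.
have tv (t : C) : nrm t <= 3 * eta -> nrm (t *: v) <= 3 * (eta * nrm v).
  by move=> t3; rewrite nrmZ mulrA ler_wpM2r.
have in1 (t : C) w : nrm t <= 3 * eta -> nrm w < r / 8 -> nrm (a + w + t *: v - a) < r / 2.
  move=> /tv h hw; rewrite -[a + w + _]addrA [a + (w + _)]addrC addrK; apply: le_lt_trans (nrmD _ _) _.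
  by move: etar en0 h hw; clear; lra.
have lt2 x : nrm (x - a) < r / 2 -> nrm (x - a) < r.
  by move=> h; apply: lt_trans h _; move: r0; clear; lra.
have w0 : nrm (0 : V) < r / 8 by rewrite nrm0 divr_gt0.
have e3 : eta <= 3 * eta by move: eta0; clear; lra.
have in0 (t : C) : nrm t <= 3 * eta -> nrm (a + t *: v - a) < r / 2.
  by move=> t3; have := in1 t 0 t3 w0; rewrite addr0.
have [t /andP[_ t3]|m m0 mJ] := @annulus_min _ (fun t : C => J (a + t *: v)) eta (3 * eta) eta0 e3 _ Jn.
  apply: differentiable_continuous.
  by have [] := diff_line (dJ _ (lt2 _ (in0 _ t3))).
have M0 : 0 <= M.
  by apply: le_trans (nrm_ge0 (J a)) _; apply: JM; rewrite subrr nrm0.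
pose K := 96 * M / r.
have K0 : 0 <= K by rewrite /K divr_ge0 ?mulr_ge0 // ltW.
have K1 : 0 < K + 1 by rewrite ltr_wpDl.
(* A perturbation below [m / 8] leaves [|J|] above [m / 2] on the annulus and below [(m / 2) / 4] at
   the centre, as [hurwitz] requires. *)
exists (Num.min (r / 8) (m / 8 / (K + 1))).
  by rewrite lt_min (divr_gt0 _ K1) !divr_gt0.
move=> w; rewrite lt_min => /andP[w1]; rewrite ltr_pdivlMr // => w2.
have close (t : C) : nrm t <= 3 * eta -> nrm (J (a + w + t *: v) - J (a + t *: v)) < m / 8.
  move=> t3; have h := ball_lip r0 dJ JM (in0 t t3) (in1 t w t3 w1).
  apply: le_lt_trans h _.
  have -> : a + w + t *: v - (a + t *: v) = w.
    by rewrite [a + w]addrC -[w + a + _]addrA addrK.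
  by apply: le_lt_trans w2; rewrite -/K mulrC ler_wpM2l ?nrm_ge0 // lerDl.
have m2 : 0 < m / 2 by rewrite divr_gt0.
have [] := @hurwitz (fun t : C => J (a + w + t *: v)) eta (m / 2) eta0 m2.
- move=> t t3; have t3' := ltW t3.
  by have [] := diff_line (dJ _ (lt2 _ (in1 t w t3' w1))).
- move=> t /andP[t1 t3]; have t3' := ltW t3.
  have h1 := close t t3'; have h2 := mJ t; rewrite t1 t3' in h2.
  have h3 := ler_nrmB (J (a + t *: v)) (J (a + t *: v) - J (a + w + t *: v)).
  rewrite subKr [X in _ - X]nrm_distC in h3.
  by move: h1 (h2 isT) h3 m0; clear; lra.
- have h : nrm (0 : C) <= 3 * eta by rewrite nrm0 mulr_ge0 // ltW.
  have := close 0 h; rewrite scale0r !addr0 Ja subr0.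
  by move: m0; clear; lra.
- by move=> t t1 t2; exists t.
Qed.

(** An operator on functions, so that [iter] produces the higher derivatives along [v]. *)
Definition dird (v : V) (f : V -> C) : V -> C := fun x => 'd f x v.

Lemma dird_holo v (f : V -> C) a (r : R) :
  (forall x, nrm (x - a) < r -> differentiable f x) ->
  forall x, nrm (x - a) < r -> differentiable (dird v f) x.
Proof.
move=> df x xr; have rx : 0 < r - nrm (x - a) by rewrite subr_gt0.
apply: (diff_holo v rx) => y yx; apply: df.
by apply: le_lt_trans (nrmBD _ x _) _; rewrite -ltrBrDr.
Qed.

Lemma iter_dird_holo v (f : V -> C) a (r : R) k :
  (forall x, nrm (x - a) < r -> differentiable f x) ->
  forall x, nrm (x - a) < r -> differentiable (iter k (dird v) f) x.
Proof. by move=> df; elim: k => [|k IH] //=; exact: dird_holo. Qed.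

(** Induction on [k]: the derivative along [v] is flat too, and the mean value inequality along the
    segment gains one factor [nrm t]. *)
Lemma flat_bound v a (r : R) k (f : V -> C) : 0 < r ->
  (forall x, nrm (x - a) < r -> differentiable f x) ->
  (forall j, iter j (dird v) f a = 0) ->
  exists2 d : R, 0 < d & exists2 K : R, 0 <= K & forall t : C, nrm t < d ->
    nrm (t *: v) < r /\ nrm (f (a + t *: v)) <= K * nrm t ^+ k.
Proof.
move=> r0; have v1 : 0 < nrm v + 1 by rewrite ltr_wpDl ?nrm_ge0.
have tvr (t : C) (d : R) : nrm t < d / (nrm v + 1) -> nrm (t *: v) < d.
  rewrite ltr_pdivlMr // => h; apply: le_lt_trans h; rewrite nrmZ ler_wpM2l ?nrm_ge0 //.
  by rewrite lerDl.
elim: k f => [|k IH] f df flat.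
  have /differentiable_continuous/continuous_nrmP/(_ 1 ltr01)[d d0 dH] : differentiable f a.
    by apply: df; rewrite subrr nrm0.
  exists (Num.min d r / (nrm v + 1)); first by rewrite divr_gt0 // lt_min d0.
  exists 1 => // t /tvr; rewrite lt_min => /andP[td tr]; split => //.
  have fa : f a = 0 := flat 0%N.
  have := dH (a + t *: v); rewrite [a + _]addrC addrK fa subr0 => /(_ td) /ltW.
  by rewrite expr0 mulr1.
have flat' j : iter j (dird v) (dird v f) a = 0 by rewrite -iterSr; exact: flat.
have [d d0 [K K0 HK]] := IH (dird v f) (dird_holo v df) flat'.
exists d => //; exists (2 * K); first by rewrite mulr_ge0.
move=> t td; have [tr _] := HK t td; split => //.
have fa : f a = 0 := flat 0%N.
rewrite -[f _]subr0 -fa exprS (_ : 2 * K * _ = 2 * (nrm t * (K * nrm t ^+ k))); last ring.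
have sc (s : R) : toC s *: (t *: v) = (toC s * t) *: v by rewrite scalerA.
have st (s : R) : 0 <= s <= 1 -> nrm (toC s * t) <= nrm t.
  by move=> /andP[s0 s1]; rewrite nrmM nrm_toC ger0_norm // ler_piMl ?nrm_ge0.
apply: segment_lip => s s01; rewrite sc; have st' := st s s01.
  have [h _] := HK _ (le_lt_trans st' td).
  by apply: df; rewrite [a + _]addrC addrK.
have [_ h] := HK _ (le_lt_trans st' td).
have -> : 'd f (a + (toC s * t) *: v) (t *: v) = t * dird v f (a + (toC s * t) *: v).
  exact: linearZ.
rewrite nrmM ler_wpM2l ?nrm_ge0 //; apply: le_trans h _.
rewrite ler_wpM2l //; by rewrite lerXn2r ?nnegrE ?nrm_ge0.
Qed.

(** The identity theorem on a line. With [u t = f (a + t v)], the quotient [u s / s^k] extends over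
    0, and [punctured_bound] around [t] gives [|u t| <= 4 K0 (8 |t| / rho)^k] for every [k], which
    tends to 0 when [|t| < rho / 16]. *)
Lemma flat_zero v a (r : R) (f : V -> C) : 0 < r ->
  (forall x, nrm (x - a) < r -> differentiable f x) ->
  (forall j, iter j (dird v) f a = 0) ->
  exists2 d : R, 0 < d & forall t : C, nrm t < d -> f (a + t *: v) = 0.
Proof.
move=> r0 df flat.
have [rho rho0 [K0 K00 H0]] := flat_bound 0 r0 df flat.
have M0 := K00; pose u (t : C) := f (a + t *: v).
have du t : nrm t < rho -> differentiable u t.
  move=> tr; have [h _] := H0 t tr.
  by have [] := diff_line (df (a + t *: v) _); rewrite 1?[a + _]addrC ?addrK.
have uM t : nrm t < rho -> nrm (u t) <= K0.
  by move=> /H0[_]; rewrite expr0 mulr1.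
exists (rho / 16); first by rewrite divr_gt0.
move=> t tr; rewrite -/(u t).
have [->|t0] := eqVneq t 0; first by rewrite /u scale0r addr0; exact: (flat 0%N).
apply/eqP; rewrite -nrm_eq0; apply/eqP/le_anti; rewrite nrm_ge0 andbT.
have key k : nrm (u t) <= 4 * K0 * 2^-1 ^+ k.
  pose g (s : C) : C := if s == 0 then 0 else u s * (s ^+ k)^-1.
  (* Order [k + 2] makes [g] quadratically small at 0, hence differentiable there with derivative
     0. *)
  have [d d0 [K KK HK]] := flat_bound (k + 2) r0 df flat.
  have g0 : g 0 = 0 by rewrite /g eqxx.
  have dg0 : differentiable g 0.
    have [] // := @diff1_of_est _ _ g 0 0.
    move=> e e0; have K1 : 0 < K + 1 by rewrite ltr_wpDl.
    exists (Num.min d (e / (K + 1))); first by rewrite lt_min d0 divr_gt0.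
    move=> s; rewrite lt_min => /andP[sd se]; rewrite scaler0 subr0 add0r g0 subr0.
    rewrite /g; case: eqVneq => [->|s0]; first by rewrite nrm0 mulr0.
    have [_ h] := HK s sd; rewrite nrmM nrmV nrmX ler_pdivrMr ?exprn_gt0 ?nrm_gt0 //.
    apply: le_trans h _; rewrite exprD expr2.
    rewrite (_ : K * _ = K * nrm s * (nrm s * nrm s ^+ k)); last ring.
    rewrite -[leRHS]mulrA ler_wpM2r ?mulr_ge0 ?exprn_ge0 ?nrm_ge0 //.
    move: se; rewrite ltr_pdivlMr // => se; apply: le_trans (ltW se).
    by rewrite mulrC ler_wpM2l ?nrm_ge0 // lerDl.
  have dg s : nrm s < rho -> differentiable g s.
    move=> sr; have [->//|s0] := eqVneq s 0.
    apply: (@near_eq_differentiable _ _ _ (fun s => u s * (s ^+ k)^-1)).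
      apply/nbhs_nrmP; exists (nrm s); first by rewrite nrm_gt0.
      move=> y ys; rewrite /g; case: eqVneq ys => // ->.
      by rewrite sub0r nrmN ltxx.
    apply: differentiableM; first exact: du.
    apply: differentiableV; last by rewrite expf_neq0.
    by apply: differentiable_pow; exact: differentiable_idfun.
  have r4 : 0 < rho / 4 by rewrite divr_gt0.
  have r42 : 2 * (rho / 4) < 3 * rho / 4 by move: rho0; clear; lra.
  have in1 s : nrm (s - t) < 3 * rho / 4 -> nrm s < rho.
    move=> h; rewrite -[s](subrK t); apply: le_lt_trans (nrmD _ _) _.
    by move: h tr rho0; clear; lra.
  have tt : nrm (t - t) < 3 * rho / 4 by rewrite subrr nrm0 divr_gt0 // mulr_gt0.
  have gt : nrm (g t) <= 4 * (K0 * (8 / rho) ^+ k).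
    apply: (@punctured_bound _ g t (3 * rho / 4) (rho / 4) _ r4 r42).
    - by move=> s /andP[_ /in1]; exact: dg.
    - exact: differentiable_continuous (dg _ (in1 _ tt)).
    - move=> s /andP[s1 s2]; have sr := in1 _ (le_lt_trans s2 r42).
      have s8 : rho / 8 <= nrm s.
        have := nrmB s t; move: s1 tr rho0; clear; lra.
      have s0 : 0 < nrm s by apply: lt_le_trans s8; rewrite divr_gt0.
      rewrite /g; case: eqP => [sz|_]; first by rewrite sz nrm0 ltxx in s0.
      rewrite nrmM nrmV nrmX ler_pM ?nrm_ge0 ?invr_ge0 ?exprn_ge0 ?nrm_ge0 ?uM //.
      rewrite -invf_div exprVn lef_pV2 ?posrE ?exprn_gt0 ?divr_gt0 //.
      by rewrite lerXn2r ?nnegrE ?nrm_ge0 // divr_ge0 // ltW.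
  move: gt; rewrite /g (negPf t0) nrmM nrmV nrmX ler_pdivrMr ?exprn_gt0 ?nrm_gt0 // => h.
  apply: le_trans h _; rewrite -!mulrA -exprMn ler_wpM2l // ler_wpM2l //.
  rewrite lerXn2r ?nnegrE ?mulr_ge0 ?invr_ge0 ?nrm_ge0 ?divr_ge0 ?ltW //.
  rewrite mulrAC ltr_pdivrMr //; move: tr; clear; lra.
have K4 : 0 <= 1 :> R by [].
apply: (le_of_small K4) => e e0; rewrite add0r mul1r.
have [k kH] := exists_half_pow_lt (4 * K0) e0.
exact: le_trans (key k) (ltW kH).
Qed.

End Zeros.

(** * Implicit functions and zero sets as graphs *)

Section Implicit.
Context {R : realType}.
Local Notation C := (Cplx R).
Variables V Y : normedModType C.
Implicit Types (F J : V -> C) (a v x : V).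

Lemma locally_bounded (W : normedModType C) (f : V -> W) a : {for a, continuous f} ->
  exists2 d : R, 0 < d & exists2 M : R, 0 < M & forall x, nrm (x - a) < d -> nrm (f x) <= M.
Proof.
move=> /continuous_nrmP/(_ 1 ltr01)[d d0 dH].
exists d => //; exists (nrm (f a) + 1); first by rewrite ltr_wpDl ?nrm_ge0.
move=> x xd; rewrite -[f x](subrK (f a)) addrC.
by apply: le_trans (nrmD _ _) _; rewrite lerD2l ltW // dH.
Qed.

(** The derivative along [v] stays within a quarter of its value [D] at [a]. Hence [F] minus its
    differential at [a] varies by at most [nrm t * nrm D / 2] along [v], and half of the linear
    growth remains. *)
Lemma transversal F a v (r : R) : 0 < r ->
  (forall x, nrm (x - a) < r -> differentiable F x) -> 'd F a v != 0 ->
  exists2 rho : R, 0 < rho & rho <= r /\ (exists2 c : R, 0 < c &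
    (forall x, nrm (x - a) < rho -> 'd F x v != 0) /\
    (forall x (t : C), nrm (x - a) < rho -> nrm (x + t *: v - a) < rho ->
       c * nrm t <= nrm (F (x + t *: v) - F x))).
Proof.
move=> r0 dF D0; set D := 'd F a v in D0.
have aa : nrm (a - a) < r by rewrite subrr nrm0.
have n0 : 0 < nrm D by rewrite nrm_gt0.
have n4 : 0 < nrm D / 4 by rewrite divr_gt0.
have /differentiable_continuous/continuous_nrmP/(_ _ n4)[d d0 dH] := dird_holo v dF aa.
exists (Num.min d r); first by rewrite lt_min d0.
split; first by rewrite ge_min lexx orbT.
exists (nrm D / 2); first by rewrite divr_gt0.
have near x : nrm (x - a) < Num.min d r -> nrm ('d F x v - D) < nrm D / 4 /\ differentiable F x.
  by rewrite lt_min => /andP[xd xr]; split; [exact: dH|exact: dF].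
split.
  move=> x /near[h _]; apply/eqP => E; move: h; rewrite E sub0r nrmN.
  by move: n0; clear; lra.
move=> x t xr tr.
have cL := diff_continuous (dF _ aa).
pose G z := F z - 'd F a z.
have h : nrm (G (x + t *: v) - G x) <= 2 * (nrm t * (nrm D / 4)).
  have sb s : 0 <= s <= 1 -> nrm (x + toC s *: (t *: v) - a) < Num.min d r.
    by move=> s01; have := segment_ball xr tr s01; rewrite [x + t *: v - x]addrAC subrr add0r.
  apply: segment_lip => s /sb /near[h1 h2].
    by apply: differentiableB; [exact: h2|exact: linear_differentiable].
  have E : 'd G (x + toC s *: (t *: v)) (t *: v) = t * ('d F (x + toC s *: (t *: v)) v - D).
    apply: etrans (diff_sub _ h2 (linear_differentiable _ cL)) _; rewrite mulrBr; congr (_ - _).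
      exact: linearZ.
    by apply: etrans (diff_linE _ _ cL) _; exact: linearZ.
  by rewrite E nrmM ler_wpM2l ?nrm_ge0 // ltW.
have E : G (x + t *: v) - G x = F (x + t *: v) - F x - t * D.
  have -> : t * D = 'd F a (t *: v) by rewrite linearZ.
  by rewrite /G linearD; ring.
rewrite E in h.
have h2 := ler_nrmB (t * D) (F (x + t *: v) - F x); rewrite nrm_distC nrmM in h2.
rewrite (_ : nrm D / 2 * nrm t = nrm t * nrm D - 2 * (nrm t * (nrm D / 4))); last by field.
move: h h2; clear; lra.
Qed.

(** The lower bound with constant [c] makes [tau] Lipschitz at [y0]; the first-order expansion of
    [F] along its level set can then be solved for the increment of [tau]. The map [i] embeds the
    parameter space. *)
Lemma implicit_diff F (x0 v : V) (i : {linear Y -> V}) (B c : R) (tau : Y -> C) (y0 : Y) :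
  (forall y, nrm (i y) <= B * nrm y) -> 0 < c ->
  differentiable F x0 -> 'd F x0 v != 0 ->
  (exists2 d : R, 0 < d & forall k, nrm k < d ->
     F (x0 + i k + (tau (y0 + k) - tau y0) *: v) = F x0 /\
     c * nrm (tau (y0 + k) - tau y0) <=
       nrm (F (x0 + i k + (tau (y0 + k) - tau y0) *: v) - F (x0 + i k))) ->
  differentiable tau y0 /\ (forall k, 'd F x0 (i k) + 'd tau y0 k * 'd F x0 v = 0).
Proof.
move=> iB c0 dF D0 [d d0 H].
set D := 'd F x0 v in D0 *.
have nD : 0 < nrm D by rewrite nrm_gt0.
have [B1 B10 LB] := linear_bound (diff_continuous dF).
pose L k := - (D^-1 * 'd F x0 (i k)).
have Llin : linear L.
  move=> k u w; rewrite /L; have -> : 'd F x0 (i (k *: u + w)) = k * 'd F x0 (i u) + 'd F x0 (i w).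
    by rewrite linearP; exact: linearP.
  have -> : k *: - (D^-1 * 'd F x0 (i u)) = k * - (D^-1 * 'd F x0 (i u)) by [].
  by ring.
pose L' : {linear Y -> C} := HB.pack L (GRing.isLinear.Build _ _ _ _ _ Llin).
pose B' := `|B| + 1.
have B'0 : 0 < B' by rewrite ltr_wpDl.
have iB' y : nrm (i y) <= B' * nrm y.
  apply: le_trans (iB y) _; rewrite ler_wpM2r ?nrm_ge0 // /B'.
  by apply: le_trans (ler_norm B) _; rewrite lerDl.
have [d1 d10 H1] := differentiable_est dF ltr01.
pose K := (B1 + 1) * B' / c.
have K0 : 0 < K by rewrite /K divr_gt0 // mulr_gt0 // addr_gt0.
have lip k : nrm k < Num.min d (d1 / B') -> nrm (tau (y0 + k) - tau y0) <= K * nrm k.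
  rewrite lt_min => /andP[kd]; rewrite ltr_pdivlMr // => kd1.
  have [h1 h2] := H k kd; rewrite h1 [leRHS]nrm_distC in h2.
  have ik : nrm (i k) < d1 by apply: le_lt_trans (iB' k) _; rewrite mulrC.
  have h3 := H1 (i k) ik; have h4 := LB (i k).
  have h5 : nrm (F (x0 + i k) - F x0) <= (B1 + 1) * nrm (i k).
    rewrite -[_ - F x0](subrK ('d F x0 (i k))); apply: le_trans (nrmD _ _) _.
    by move: h3 h4; clear; lra.
  rewrite /K mulrAC ler_pdivlMr // mulrC; apply: le_trans h2 _; apply: le_trans h5 _.
  by rewrite -mulrA ler_pM2l ?addr_gt0.
have [] := @diff_of_est _ _ _ tau y0 L' ((nrm D)^-1 * B1 * B').
- move=> h; rewrite /= /L nrmN nrmM nrmV -!mulrA ler_pM2l ?invr_gt0 //.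
  by apply: le_trans (LB _) _; rewrite ler_pM2l.
- move=> e e0; pose A := B' + K * nrm v.
  have A0 : 0 < A by rewrite /A ltr_pwDl // mulr_ge0 ?nrm_ge0 // ltW.
  have e1 : 0 < e * nrm D / A by rewrite divr_gt0 // mulr_gt0.
  have [d2 d20 H2] := differentiable_est dF e1.
  exists (Num.min (Num.min d (d1 / B')) (d2 / A)).
    by rewrite lt_min (divr_gt0 d20 A0) lt_min d0 divr_gt0.
  move=> k; rewrite lt_min => /andP[k1 k2]; move: (k2); rewrite ltr_pdivlMr // => k2'.
  have l := lip k k1; set dt := tau (y0 + k) - tau y0 in l *.
  have kd : nrm k < d by move: k1; rewrite lt_min => /andP[].
  have [h1 _] := H k kd; rewrite -/dt -addrA in h1.
  have hA : nrm (i k + dt *: v) <= nrm k * A.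
    apply: le_trans (nrmD _ _) _; rewrite nrmZ /A mulrDr; apply: lerD.
      by rewrite mulrC.
    by rewrite mulrA ler_wpM2r ?nrm_ge0 // mulrC.
  have := H2 _ (le_lt_trans hA k2'); rewrite h1 subrr sub0r nrmN.
  have -> : 'd F x0 (i k + dt *: v) = 'd F x0 (i k) + dt * D.
    by rewrite linearD; congr (_ + _); exact: linearZ.
  move=> h2; have -> : dt - L' k = D^-1 * ('d F x0 (i k) + dt * D).
    rewrite /= /L opprK mulrDr addrC; congr (_ + _).
    by rewrite mulrCA mulVf ?mulr1.
  rewrite nrmM nrmV ler_pdivrMl //; apply: le_trans h2 _.
  apply: le_trans (ler_wpM2l (ltW e1) hA) _.
  by rewrite le_eqVlt; apply/orP; left; apply/eqP; field; rewrite gt_eqF.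
move=> dt E; split => // k.
have -> : 'd tau y0 k = L k by rewrite E.
by rewrite /L mulNr mulrAC mulVf // mul1r subrr.
Qed.

(* By [transversal] the zeros of [F] meet each line of direction [v] near [a] at most
   once, and by [line_zero] the zeros of [J] meet it: the zero sets of [J] and [F]
   coincide near [a] and are the graph of [tau]. *)
Lemma zero_graph F J a v (r : R) (i : {linear Y -> V}) (B : R) : 0 < r -> v != 0 ->
  (forall y, nrm (i y) <= B * nrm y) ->
  (forall x, nrm (x - a) < r -> differentiable F x) ->
  (forall x, nrm (x - a) < r -> differentiable J x) ->
  J a = 0 -> 'd F a v != 0 -> (forall x, nrm (x - a) < r -> J x = 0 -> F x = 0) ->
  exists2 d : R, 0 < d & exists tau : Y -> C, tau 0 = 0 /\ forall y, nrm y < d ->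
    let x := a + i y + tau y *: v in
    [/\ nrm (x - a) < r, J x = 0, 'd F x v != 0, differentiable tau y &
       forall k, 'd F x (i k) + 'd tau y k * 'd F x v = 0].
Proof.
move=> r0 v0 iB dF dJ Ja D0 JF.
have aa : nrm (a - a) < r by rewrite subrr nrm0.
have Fa : F a = 0 by exact: JF.
have nv : 0 < nrm v by rewrite nrm_gt0.
have [rho rho0 [rhor [c c0 [D0' tr]]]] := transversal r0 dF D0.
have [d1 d10 [M M0 JM]] := locally_bounded (differentiable_continuous (dJ a aa)).
pose rr := Num.min d1 rho.
have rr0 : 0 < rr by rewrite lt_min d10.
have rrr x : nrm (x - a) < rr -> nrm (x - a) < r.
  by rewrite lt_min => /andP[_ h]; exact: lt_le_trans rhor.
have rrho x : nrm (x - a) < rr -> nrm (x - a) < rho by rewrite lt_min => /andP[].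
(* [hurwitz] works up to radius [3 * eta]; the displacement [3 * rr / 16] along [v], together with
   [rr / 16] for [i y], stays in the ball of radius [rr]. *)
pose eta := rr / 16 / nrm v.
have eta0 : 0 < eta by rewrite /eta !divr_gt0.
have etav : eta * nrm v = rr / 16 by rewrite /eta divfK // gt_eqF.
have eta8 : 8 * (eta * nrm v) < rr by rewrite etav; move: rr0; clear; lra.
have tv (t : C) : nrm t <= 3 * eta -> nrm (t *: v) <= 3 * (rr / 16).
  by move=> h; rewrite nrmZ -etav mulrA ler_wpM2r // ltW.
have Jn (t : C) : eta <= nrm t <= 3 * eta -> J (a + t *: v) != 0.
  move=> /andP[t1 t2]; apply/eqP => J0.
  have tin : nrm (a + t *: v - a) < rr.
    rewrite [a + _]addrC addrK; apply: le_lt_trans (tv t t2) _; move: rr0; clear; lra.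
  have F0 := JF _ (rrr _ tin) J0.
  have aar : nrm (a - a) < rho by rewrite subrr nrm0.
  have := tr a t aar (rrho _ tin); rewrite F0 Fa subrr nrm0 leNgt => /negP; apply.
  by rewrite mulr_gt0 // (lt_le_trans eta0).
have dJ' x : nrm (x - a) < rr -> differentiable J x by move=> /rrr; exact: dJ.
have JM' x : nrm (x - a) < rr -> nrm (J x) <= M by rewrite lt_min => /andP[/JM].
have [d2 d20 H2] := line_zero eta0 eta8 dJ' JM' Ja Jn.
pose B' := `|B| + 1.
have B'0 : 0 < B' by rewrite ltr_wpDl.
have iB' y : nrm (i y) <= B' * nrm y.
  apply: le_trans (iB y) _; rewrite ler_wpM2r ?nrm_ge0 // /B'.
  by apply: le_trans (ler_norm B) _; rewrite lerDl.
pose d := Num.min d2 (rr / 16) / B'.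
have d0 : 0 < d by rewrite /d divr_gt0 // lt_min d20 divr_gt0.
have id y : nrm y < d -> nrm (i y) < d2 /\ nrm (i y) < rr / 16.
  rewrite /d ltr_pdivlMr // mulrC => h; apply/andP; rewrite -lt_min.
  exact: le_lt_trans (iB' y) h.
(* This choice carries no regularity; differentiability comes afterwards from the lower bound of
   [transversal]. *)
have ex y : exists t : C, nrm y < d -> nrm t < eta /\ J (a + i y + t *: v) = 0.
  have [yd|//] := pselect (nrm y < d); last by exists 0.
  by have [t t1 t2] := H2 _ (id _ yd).1; exists t.
have [tau tauP] := choice ex.
have inr (y : Y) (t : C) : nrm y < d -> nrm t < eta -> nrm (a + i y + t *: v - a) < rr.
  move=> /id[_ yd] te; rewrite -[a + _ + _]addrA [a + (_ + _)]addrC addrK.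
  apply: le_lt_trans (nrmD _ _) _.
  have te3 : nrm t <= 3 * eta by move: te eta0; clear; lra.
  by have := tv t te3; move: yd rr0; clear; lra.
exists d => //; exists tau; split.
  have z0 : nrm (0 : Y) < d by rewrite nrm0.
  have [t1 t2] := tauP 0 z0; have xin := inr 0 _ z0 t1.
  have F0 := JF _ (rrr _ xin) t2; rewrite linear0 addr0 in F0 xin.
  have aar : nrm (a - a) < rho by rewrite subrr nrm0.
  have := tr a _ aar (rrho _ xin); rewrite F0 Fa subrr nrm0 pmulr_rle0 // => h.
  by apply/eqP; rewrite -nrm_eq0; apply/eqP/le_anti; rewrite h nrm_ge0.
move=> y yd /=; have [t1 t2] := tauP y yd; have xin := inr y _ yd t1.
set x := a + i y + tau y *: v in xin t2 *.
have F0 := JF _ (rrr _ xin) t2.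
have Dx := D0' x (rrho _ xin).
have [|dtau tauD] := @implicit_diff F x v i B c tau y iB c0 (dF _ (rrr _ xin)) Dx.
  exists (d - nrm y); first by rewrite subr_gt0.
  move=> k kd.
  have ykd : nrm (y + k) < d by apply: le_lt_trans (nrmD _ _) _; rewrite -ltrBrDl.
  have [s1 s2] := tauP _ ykd.
  have E1 : x + i k = a + i (y + k) + tau y *: v by rewrite /x linearD [LHS]addrAC addrA.
  have E2 : x + i k + (tau (y + k) - tau y) *: v = a + i (y + k) + tau (y + k) *: v.
    by rewrite E1 -[LHS]addrA -scalerDl [tau y + _]addrC subrK.
  have in1 := rrho _ (inr _ _ ykd t1); have in2 := inr _ _ ykd s1.
  have F1 := JF _ (rrr _ in2) s2.
  split; first by rewrite E2 F1 F0.
  rewrite E2 E1.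
  have E3 : a + i (y + k) + tau (y + k) *: v = a + i (y + k) + tau y *: v + (tau (y + k) - tau y) *: v.
    by rewrite -E2 E1.
  by have := tr _ (tau (y + k) - tau y) in1; rewrite -E3; apply; exact: rrho.
by split => //; exact: rrr.
Qed.

End Implicit.

(** * Osgood's theorem *)

Section DimensionOne.
Context {R : realType}.
Local Notation C := (Cplx R).

Lemma diff_zero_cst (V : normedModType C) (f : V -> C) (a : V) (r : R) :
  (forall x, nrm (x - a) < r -> differentiable f x) ->
  (forall x, nrm (x - a) < r -> forall h, 'd f x h = 0) ->
  forall x, nrm (x - a) < r -> f x = f a.
Proof.
move=> df d0 x xr; apply/eqP; rewrite -subr_eq0 -nrm_eq0; apply/eqP/le_anti.
rewrite nrm_ge0 andbT -[leRHS](mulr0 2) -[in f x](subrK a x) [x - a + a]addrC.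
have aa : nrm (a - a) < r by rewrite subrr nrm0; apply: le_lt_trans xr; exact: nrm_ge0.
apply: segment_lip => t t01; have h := segment_ball aa xr t01; first exact: df.
by rewrite d0 // nrm0.
Qed.

(** If the derivative vanished at 0, a nearby [z1] would have a derivative that is nonzero but
    smaller than [m / (8 rho)]. By injectivity [(z - z1) / (h z - h z1)] is holomorphic around [z1]
    and bounded by [rho / m] on an annulus, so [punctured_bound] gives [1 / |h'(z1)| <= 4 rho / m],
    a contradiction. *)
Lemma injective_diff1 (h : C -> C) (rho : R) : 0 < rho ->
  (forall z, nrm z < rho -> differentiable h z) ->
  (forall z w, nrm z < rho -> nrm w < rho -> h z = h w -> z = w) ->
  'd h 0 1 != 0.
Proof.
move=> rho0 dh ih; apply/eqP => D0.
have z0 : nrm (0 : C) < rho by rewrite nrm0.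
have r8 : 0 < rho / 8 by rewrite divr_gt0.
have [|||m m0 mh] := @annulus_min _ (fun z => h z - h 0) (rho / 8) (5 * rho / 8) r8.
- by move: rho0; clear; lra.
- move=> z /andP[_ z5]; apply: differentiable_continuous; apply: differentiableB.
    by apply: dh; apply: le_lt_trans z5 _; move: rho0; clear; lra.
  exact: differentiable_cst.
- move=> z /andP[z8 z5]; rewrite subr_eq0; apply/eqP => hz.
  have zr : nrm z < rho by apply: le_lt_trans z5 _; move: rho0; clear; lra.
  have zz := ih _ _ zr z0 hz; move: z8; rewrite zz nrm0 leNgt r8 //.
have m20 : 0 < m / 2 by rewrite divr_gt0.
have m40 : 0 < m / (8 * rho) by rewrite divr_gt0 // mulr_gt0.
have /differentiable_continuous/continuous_nrmP/(_ _ m20)[d1 d10 H1] := dh _ z0.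
have dh0 (x : C) : nrm (x - 0) < rho -> differentiable h x by rewrite subr0; exact: dh.
have z00 : nrm (0 - 0 : C) < rho by rewrite subr0.
have /differentiable_continuous/continuous_nrmP/(_ _ m40)[d2 d20 H2] := dird_holo (1 : C) dh0 z00.
pose d := Num.min (Num.min d1 d2) (rho / 8).
have d0 : 0 < d by rewrite !lt_min d10 d20.
(* If the derivative vanished on a whole disc, [h] would be constant there. *)
have [z1 z1d hz1] : exists2 z1, nrm z1 < d & 'd h z1 1 != 0.
  apply: contrapT => H.
  have zero z : nrm (z - 0) < d -> forall k, 'd h z k = 0.
    rewrite subr0 => zd k; have dhz : differentiable h z.
      by apply: dh; move: zd; rewrite lt_min => /andP[_ h1]; apply: lt_trans h1 _; move: rho0; clear; lra.
    rewrite (diff_scal _ dhz).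
    have -> : 'd h z 1 = 0 by apply/eqP/negPn/negP => h1; apply: H; exists z.
    by rewrite mulr0.
  have dr z : nrm (z - 0) < d -> differentiable h z.
    rewrite subr0 => zd; apply: dh; move: zd; rewrite lt_min => /andP[_ h1].
    by apply: lt_trans h1 _; move: rho0; clear; lra.
  have nt : nrm (toC (d / 2)) = d / 2 by rewrite nrm_toC ger0_norm // divr_ge0 // ltW.
  have td : nrm (toC (d / 2) - 0) < d by rewrite subr0 nt; move: d0; clear; lra.
  have E := diff_zero_cst dr zero td.
  have tr : nrm (toC (d / 2)) < rho.
    by move: td; rewrite subr0 lt_min => /andP[_ h1]; apply: lt_trans h1 _; move: rho0; clear; lra.
  have := ih _ _ tr z0 E => /(congr1 (@nrm _ _)); rewrite nt nrm0 => h1.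
  by move: d0; rewrite -[d](@divfK _ 2) // h1 mul0r ltxx.
move: z1d; rewrite !lt_min => /andP[/andP[z11 z12] z18].
have z1r : nrm z1 < rho by apply: lt_trans z18 _; move: rho0; clear; lra.
pose u z := if z == z1 then ('d h z1 1)^-1 else (z - z1) * (h z - h z1)^-1.
have u1 : u z1 = ('d h z1 1)^-1 by rewrite /u eqxx.
have in1 z : nrm (z - z1) < 3 * rho / 4 -> nrm z < rho.
  move=> hz; rewrite -[z](subrK z1); apply: le_lt_trans (nrmD _ _) _.
  by move: hz z18 rho0; clear; lra.
have r4 : 0 < rho / 4 by rewrite divr_gt0.
have r42 : 2 * (rho / 4) < 3 * rho / 4 by move: rho0; clear; lra.
have du z : 0 < nrm (z - z1) < 3 * rho / 4 -> differentiable u z.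
  move=> /andP[zz zr]; have zr' := in1 _ zr.
  apply: (@near_eq_differentiable _ _ _ (fun z => (z - z1) * (h z - h z1)^-1)).
    apply/nbhs_nrmP; exists (nrm (z - z1)) => // y yz; rewrite /u.
    case: eqP => // yz1; move: yz; rewrite yz1 nrm_distC ltxx //.
  apply: differentiableM.
    by apply: differentiableB; [exact: differentiable_idfun|exact: differentiable_cst].
  apply: differentiableV.
    by apply: differentiableB; [exact: dh|exact: differentiable_cst].
  rewrite subr_eq0; apply/eqP => hz; have zE := ih _ _ zr' z1r hz.
  by move: zz; rewrite zE subrr nrm0 ltxx.
have cu : {for z1, continuous u}.
  pose w z := if z == z1 then 'd h z1 1 else (h z - h z1) * (z - z1)^-1.
  have uw : u = fun z => (w z)^-1.
    by apply/funext => z; rewrite /u /w; case: eqP => // _; rewrite invfM invrK mulrC.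
  have wz1 : w z1 = 'd h z1 1 by rewrite /w eqxx.
  rewrite uw; apply: (@continuous_comp _ _ _ w (fun x : C => x^-1)); last first.
    by apply: differentiable_continuous; apply: differentiable_Rinv; rewrite wz1.
  apply/continuous_nrmP => e e0.
  have [d3 d30 H3] := diffquot_cvg (1 : C) (dh _ z1r) (divr_gt0 e0 (ltr0Sn R 1)).
  exists d3 => // y yd; rewrite wz1 /w; case: eqP => [_|/eqP yz]; first by rewrite subrr nrm0.
  have := H3 (y - z1); rewrite nrm_gt0 subr_eq0 yz yd => /(_ isT).
  have -> : z1 + (y - z1) *: (1 : C) = y by rewrite /GRing.scale /= mulr1 addrC subrK.
  by rewrite mulrC => h3; apply: le_lt_trans h3 _; move: e0; clear; lra.
have : nrm (u z1) <= 4 * (rho / m).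
  apply: (@punctured_bound _ u z1 (3 * rho / 4) (rho / 4) _ r4 r42 du cu).
  move=> z /andP[zz1 zz2].
  have zr := in1 _ (le_lt_trans zz2 r42).
  have z8 : rho / 8 <= nrm z.
    by have := nrmB z z1; move: zz1 z18 rho0; clear; lra.
  have z5 : nrm z <= 5 * rho / 8.
    have : nrm z <= nrm (z - z1) + nrm z1 by rewrite -{1}[z](subrK z1) nrmD.
    by move: zz2 z18 rho0; clear; lra.
  have h1 := mh z; rewrite z8 z5 in h1; have {}h1 := h1 isT.
  have h2 := H1 z1; rewrite subr0 in h2; have {}h2 := h2 z11.
  have h3 : m / 2 <= nrm (h z - h z1).
    have := ler_nrmB (h z - h 0) (h z1 - h 0).
    have -> : h z - h 0 - (h z1 - h 0) = h z - h z1 by ring.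
    by move: h1 h2; clear; lra.
  rewrite /u; case: eqP => [E|_].
    by move: zz1; rewrite E subrr nrm0 leNgt r4.
  rewrite nrmM nrmV (_ : rho / m = (rho / 2) * (m / 2)^-1); last first.
    by field; rewrite gt_eqF.
  rewrite ler_pM ?nrm_ge0 ?invr_ge0 ?nrm_ge0 //; first by move: zz2; clear; lra.
  by rewrite lef_pV2 ?posrE // (lt_le_trans m20).
rewrite u1 nrmV => h1.
have D0' : dird (1 : C) h 0 = 0 by exact: D0.
have h2 := H2 z1; rewrite D0' !subr0 in h2; have {}h2 : nrm ('d h z1 1) < m / (8 * rho) := h2 z12.
have n1 : 0 < nrm ('d h z1 1) by rewrite nrm_gt0.
move: h1; rewrite -[leLHS]mul1r ler_pdivrMr // => h1.
have : 4 * (rho / m) * nrm ('d h z1 1) < 4 * (rho / m) * (m / (8 * rho)).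
  by rewrite ltr_pM2l // mulr_gt0 // divr_gt0.
have -> : 4 * (rho / m) * (m / (8 * rho)) = 1 / 2 by field; rewrite !gt_eqF.
by move: h1; clear; lra.
Qed.

End DimensionOne.

Section GenericDiff.
Variables (K : numFieldType) (U V W : normedModType K).

Lemma diff_chain (f : U -> V) (g : V -> W) x h :
  differentiable f x -> differentiable g (f x) ->
  'd (fun x => g (f x)) x h = 'd g (f x) ('d f x h).
Proof. by move=> df dg; rewrite -[fun x => _]/(g \o f) diff_comp. Qed.

Lemma diff_lin_chain (L : {linear V -> W}) (f : U -> V) x h : continuous L ->
  differentiable f x -> 'd (fun x => L (f x)) x h = L ('d f x h).
Proof.
move=> cL df; have dL := linear_differentiable (f x) cL.
by rewrite (diff_chain h df dL) diff_linE.
Qed.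

Lemma differentiable_graph (a v : V) (L : {linear U -> V}) (tau : U -> K) y :
  continuous L -> differentiable tau y ->
  differentiable (fun y => a + L y + tau y *: v) y.
Proof.
move=> cL dt; apply: differentiableD; last exact: differentiableZl.
by apply: differentiableD; [exact: differentiable_cst|exact: linear_differentiable].
Qed.

Lemma diff_graph (a v : V) (L : {linear U -> V}) (tau : U -> K) y h :
  continuous L -> differentiable tau y ->
  'd (fun y => a + L y + tau y *: v) y h = L h + 'd tau y h *: v.
Proof.
move=> cL dt; have dz := differentiableZl v dt.
have dL : differentiable L y by exact: linear_differentiable.
have dc : differentiable (cst a : U -> V) y by exact: differentiable_cst.
have dd : differentiable (cst a + (L : U -> V)) y by exact: differentiableD.
rewrite -[fun y => _]/((cst a + (L : U -> V)) + (fun y => tau y *: v)).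
rewrite (diffD dd dz) /= (diffD dc dL) /= diff_cst diffZl // diff_lin //.
by rewrite add0r.
Qed.

End GenericDiff.

(** * Row vectors and the induction step at points of nonzero differential *)

Section RowVectors.
Context {R : realType}.
Local Notation C := (Cplx R).

Lemma nrm_coord n (x : 'rV[C]_n) i : nrm (x 0 i) <= nrm x.
Proof.
rewrite -toC_le -!nrmE [leRHS]/Num.norm /= mx_normE -[leLHS]nngE num_le.
exact: (le_bigmax _ _ (0, i)).
Qed.

Lemma nrm_rV_le n (x : 'rV[C]_n) (e : R) : 0 <= e ->
  (forall i, nrm (x 0 i) <= e) -> nrm x <= e.
Proof.
move=> e0 H; have [x0|x0] := eqVneq x 0; first by rewrite x0 nrm0.
have [|[i j] /= E] := @mx_norm_neq0 _ _ _ x.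
  by rewrite -[mx_norm x]/(`|x|) normr_eq0.
rewrite -toC_le -nrmE [leLHS]E nrmE toC_le (ord1 i); exact: H.
Qed.

Section Linear.
Variables (n : nat).
Definition coordf (i : 'I_n) (x : 'rV[C]_n) : C := x 0 i.
Lemma coordf_linear i : linear (coordf i).
Proof. by move=> k u v; rewrite /coordf !mxE. Qed.
HB.instance Definition _ i := GRing.isLinear.Build C 'rV[C]_n C _ (coordf i) (coordf_linear i).
Lemma coordf_continuous i : continuous (coordf i).
Proof. by apply: (@bounded_linear_cont _ _ _ _ 1) => x; rewrite mul1r; exact: nrm_coord. Qed.
End Linear.

Lemma rV_linear_bound n (V : normedModType C) (L : {linear 'rV[C]_n -> V}) :
  exists B : R, forall x, nrm (L x) <= B * nrm x.
Proof.
exists (\sum_i nrm (L (delta_mx 0 i))) => x.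
rewrite {1}(row_sum_delta x) linear_sum mulr_suml.
have tri (s : seq 'I_n) (F : 'I_n -> V) : nrm (\sum_(i <- s) F i) <= \sum_(i <- s) nrm (F i).
  elim: s => [|j s IH]; first by rewrite !big_nil nrm0.
  by rewrite !big_cons (le_trans (nrmD _ _)) // lerD2l.
apply: le_trans (tri _ _) _; apply: ler_sum => i _.
by rewrite linearZ nrmZ mulrC ler_wpM2l ?nrm_ge0 ?nrm_coord.
Qed.

Lemma rV_linear_continuous n (V : normedModType C) (L : {linear 'rV[C]_n -> V}) : continuous L.
Proof. by have [B LB] := rV_linear_bound L; exact: bounded_linear_cont LB. Qed.

Lemma differentiable_coordf (V : normedModType C) n (f : V -> 'rV[C]_n) x i :
  differentiable f x -> differentiable (fun x => coordf i (f x)) x.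
Proof.
move=> df; apply: (@differentiable_comp _ _ _ _ f (coordf i)) => //.
by apply: linear_differentiable; exact: coordf_continuous.
Qed.

Lemma diff_coordf (V : normedModType C) n (f : V -> 'rV[C]_n) x i h :
  differentiable f x -> 'd (fun x => coordf i (f x)) x h = coordf i ('d f x h).
Proof. by move=> df; apply: diff_lin_chain => //; exact: coordf_continuous. Qed.

Lemma compact_rV_ball n (M : R) : compact [set x : 'rV[C]_n | nrm x <= M].
Proof.
have cD := @rV_compact C n (fun=> [set z : C | nrm z <= M]) (fun=> @compact_disc _ M).
apply: (subclosed_compact _ cD).
  have -> : [set x : 'rV[C]_n | nrm x <= M] = (fun x : 'rV[C]_n => nrm x : R) @^-1` [set x | x <= M] by [].
  by apply: closed_comp; [move=> z _; exact: nrm_continuous|exact: closed_le].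
by move=> x /= xM i; exact: le_trans (nrm_coord x i) xM.
Qed.

Section Insertion.
Variables (n : nat) (j0 : 'I_n.+1).
Definition ins0 (y : 'rV[C]_n) : 'rV[C]_n.+1 :=
  \row_j (if unlift j0 j is Some k then y 0 k else 0).
Lemma ins0_linear : linear ins0.
Proof.
move=> k u v; apply/rowP => j; rewrite !mxE; case: (unlift j0 j) => [i|]; rewrite ?mxE //.
by rewrite mulr0 addr0.
Qed.
HB.instance Definition _ := GRing.isLinear.Build C 'rV[C]_n 'rV[C]_n.+1 _ ins0 ins0_linear.

Definition del (x : 'rV[C]_n.+1) : 'rV[C]_n := \row_k x 0 (lift j0 k).
Lemma del_linear : linear del.
Proof. by move=> k u v; apply/rowP => j; rewrite !mxE. Qed.
HB.instance Definition _ := GRing.isLinear.Build C 'rV[C]_n.+1 'rV[C]_n _ del del_linear.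

Lemma ins0K y : del (ins0 y) = y.
Proof. by apply/rowP => k; rewrite !mxE liftK. Qed.

Lemma del_delta : del (delta_mx 0 j0) = 0.
Proof. by apply/rowP => k; rewrite !mxE eq_sym (negPf (neq_lift _ _)) andbF. Qed.

Lemma ins0_del (x : 'rV[C]_n.+1) : ins0 (del x) + x 0 j0 *: delta_mx 0 j0 = x.
Proof.
apply/rowP => j; rewrite !mxE eqxx /=; case: unliftP => [k ->|->].
  by rewrite !mxE eq_sym (negPf (neq_lift _ _)) mulr0 addr0.
by rewrite eqxx mulr1 add0r.
Qed.

Lemma eq_del (x y : 'rV[C]_n.+1) : x 0 j0 = y 0 j0 -> del x = del y -> x = y.
Proof. by move=> h1 h2; rewrite -(ins0_del x) -(ins0_del y) h1 h2. Qed.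

End Insertion.

(** Osgood's theorem in dimension [n], kept as a predicate so that the induction can assume it one
    dimension lower. *)
Definition osgood n := forall (f : 'rV[C]_n -> 'rV[C]_n) (a : 'rV[C]_n) (r : R), 0 < r ->
  (forall x, nrm (x - a) < r -> differentiable f x) ->
  (forall x y, nrm (x - a) < r -> nrm (y - a) < r -> f x = f y -> x = y) ->
  forall u, 'd f a u = 0 -> u = 0.

(* If some derivative of a coordinate [f_i0] is nonzero, its level set is a graph over
   [n] of the coordinates, on which the induction hypothesis applies to the other
   coordinates of [f]. *)
Lemma osgood_rank n : osgood n ->
  forall (f : 'rV[C]_n.+1 -> 'rV[C]_n.+1) a (r : R), 0 < r ->
  (forall x, nrm (x - a) < r -> differentiable f x) ->
  (forall x y, nrm (x - a) < r -> nrm (y - a) < r -> f x = f y -> x = y) ->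
  (exists w, 'd f a w != 0) -> forall u, 'd f a u = 0 -> u = 0.
Proof.
move=> IH f a r r0 df fi [w0 w0P] u du.
have aa : nrm (a - a) < r by rewrite subrr nrm0.
have dfa := df _ aa.
have [j0 [i0 ji]] : exists (j0 i0 : 'I_n.+1), coordf i0 ('d f a (delta_mx 0 j0)) != 0.
  apply: contrapT => H; move/eqP: w0P; apply.
  apply/rowP => i; rewrite mxE (row_sum_delta w0) linear_sum summxE big1 // => j _.
  rewrite linearZ mxE; apply/eqP; rewrite mulf_eq0; apply/orP; right.
  by apply/negPn/negP => h; apply: H; exists j, i.
pose v : 'rV[C]_n.+1 := delta_mx 0 j0.
pose F x := coordf i0 (f x) - coordf i0 (f a).
have dF x : nrm (x - a) < r -> differentiable F x.
  move=> xr; apply: differentiableB; last exact: differentiable_cst.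
  exact/differentiable_coordf/df.
have dFE x h : nrm (x - a) < r -> 'd F x h = coordf i0 ('d f x h).
  move=> xr; have d1 := differentiable_coordf i0 (df x xr).
  apply: etrans (diff_sub h d1 (differentiable_cst _ _)) _.
  apply: etrans (subr0 _); congr (_ - _); first exact: diff_coordf (df x xr).
  exact: (congr1 (fun G : 'rV[C]_n.+1 -> C => G h) (diff_cst _ _)).
have Fa : F a = 0 by rewrite /F subrr.
have v0 : v != 0.
  by apply/eqP => /rowP/(_ j0)/eqP; rewrite !mxE !eqxx oner_eq0.
have Dv : 'd F a v != 0 by rewrite dFE.
pose L : {linear 'rV[C]_n -> 'rV[C]_n.+1} := ins0 j0.
pose P : {linear 'rV[C]_n.+1 -> 'rV[C]_n} := del i0.
have [B iB] := rV_linear_bound L.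
have [d d0 [tau [tau0 H]]] := zero_graph r0 v0 iB dF dF Fa Dv (fun x _ e => e).
pose p y := a + ins0 j0 y + tau y *: v.
pose g y := del i0 (f (p y)).
have p0 : p 0 = a by rewrite /p linear0 tau0 scale0r !addr0.
have ci : continuous L by exact: rV_linear_continuous.
have cd : continuous P by exact: rV_linear_continuous.
have dp y : nrm y < d -> differentiable p y.
  by move=> /H[_ _ _ dt _]; exact: differentiable_graph.
have pr y : nrm y < d -> nrm (p y - a) < r by move=> /H[].
have dfp y : nrm y < d -> differentiable (fun y => f (p y)) y.
  move=> yd; apply: (@differentiable_comp _ _ _ _ p f); first exact: dp.
  exact/df/pr.
have dg y : nrm (y - 0) < d -> differentiable g y.
  rewrite subr0 => yd; apply: (@differentiable_comp _ _ _ _ (fun y => f (p y)) (del i0)).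
    exact: dfp.
  exact: linear_differentiable.
(* Points of the graph share the coordinate [i0] of [f], so the remaining coordinates determine [f],
   and the point itself by injectivity. *)
have gi y z : nrm (y - 0) < d -> nrm (z - 0) < d -> g y = g z -> y = z.
  rewrite !subr0 => yd zd gE.
  have F0 y' : nrm y' < d -> coordf i0 (f (p y')) = coordf i0 (f a).
    by move=> /H[_ /eqP]; rewrite subr_eq0 => /eqP.
  have fE : f (p y) = f (p z) := eq_del (etrans (F0 y yd) (esym (F0 z zd))) gE.
  have pE := fi _ _ (pr _ yd) (pr _ zd) fE.
  have dp' x : del j0 (p x) = del j0 a + x.
    by rewrite /p !linearD /= linearZ /= del_delta scaler0 addr0 ins0K.
  by apply: (@addrI _ (del j0 a)); rewrite -!dp' pE.
have z0 : nrm (0 : 'rV[C]_n) < d by rewrite nrm0.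
pose w := del j0 u; pose s := u 0 j0.
have uE : ins0 j0 w + s *: v = u by exact: ins0_del.
(* A vector killed by the differential of [f] is tangent to the level set of [F]: its component
   along [v] is prescribed by [tau]. *)
have sE : s = 'd tau 0 w.
  have [_ _ _ _ /(_ w)] := H 0 z0; rewrite -/(p 0) p0 => e1.
  have e2 : 'd F a (ins0 j0 w) + s * 'd F a v = 0.
    have <- : 'd F a u = 'd F a (ins0 j0 w) + s * 'd F a v.
      by rewrite -{1}uE linearD; congr (_ + _); exact: linearZ.
    by rewrite dFE // du linear0.
  by apply: (mulIf Dv); apply: (addrI ('d F a (ins0 j0 w))); rewrite e2.
have dgw : 'd g 0 w = 0.
  have E1 : 'd p 0 w = u.
    have [_ _ _ dt _] := H 0 z0.
    by apply: etrans (diff_graph a v w ci dt) _; rewrite -sE.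
  have E2 : 'd (fun y => f (p y)) 0 w = 'd f (p 0) ('d p 0 w).
    by apply: diff_chain; [exact: dp|rewrite p0].
  have E3 : 'd g 0 w = del i0 ('d (fun y => f (p y)) 0 w).
    exact: (diff_lin_chain w cd (dfp 0 z0)).
  apply: etrans E3 _; apply: etrans (congr1 (del i0) _) (linear0 P).
  apply: etrans E2 _; apply: etrans (congr1 ('d f (p 0)) E1) _.
  exact: (eq_ind_r (fun z => 'd f z u = 0) du p0).
have w0' := IH g 0 d d0 dg gi w dgw.
by rewrite -uE sE w0' !linear0 scale0r addr0.
Qed.

End RowVectors.

Section BigDifferentiable.
Variables (K : numFieldType) (V : normedModType K).

Lemma differentiable_bigsum (I : Type) (s : seq I) (F : I -> V -> K) x :
  (forall i, differentiable (F i) x) -> differentiable (fun x => \sum_(i <- s) F i x) x.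
Proof.
move=> dF; elim: s => [|i s IH].
  by under eq_fun do rewrite big_nil; exact: differentiable_cst.
by under eq_fun do rewrite big_cons; exact: differentiableD.
Qed.

Lemma differentiable_bigprod (I : Type) (s : seq I) (F : I -> V -> K) x :
  (forall i, differentiable (F i) x) -> differentiable (fun x => \prod_(i <- s) F i x) x.
Proof.
move=> dF; elim: s => [|i s IH].
  by under eq_fun do rewrite big_nil; exact: differentiable_cst.
by under eq_fun do rewrite big_cons; exact: differentiableM.
Qed.

Lemma differentiable_det n (A : V -> 'M[K]_n) x :
  (forall i j, differentiable (fun x => A x i j) x) -> differentiable (fun x => \det (A x)) x.
Proof.
move=> dA; rewrite /determinant; apply: differentiable_bigsum => s.
apply: differentiableM; first exact: differentiable_cst.
by apply: differentiable_bigprod => i; exact: dA.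
Qed.

End BigDifferentiable.

(** * Jacobian determinant and critical points of injective maps *)

Section Osgood.
Context {R : realType}.
Local Notation C := (Cplx R).

(** Rows are indexed by directions and columns by coordinates of [f], to match multiplication of row
    vectors on the right. *)
Definition jac n (f : 'rV[C]_n -> 'rV[C]_n) (x : 'rV[C]_n) : 'M[C]_n :=
  \matrix_(j, i) dird (delta_mx 0 j) (fun x => coordf i (f x)) x.

Lemma jacE n (f : 'rV[C]_n -> 'rV[C]_n) x u : differentiable f x ->
  u *m jac f x = 'd f x u.
Proof.
move=> df; apply/rowP => i; rewrite mxE.
have -> : 'd f x u = \sum_j u 0 j *: 'd f x (delta_mx 0 j).
  by rewrite {1}(row_sum_delta u) linear_sum; apply: eq_bigr => j _; exact: linearZ.
rewrite summxE; apply: eq_bigr => j _; rewrite !mxE; congr (_ * _).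
exact: diff_coordf.
Qed.

Lemma det_jac_eq0 n (f : 'rV[C]_n -> 'rV[C]_n) x : differentiable f x ->
  \det (jac f x) = 0 -> exists2 u, u != 0 & 'd f x u = 0.
Proof.
move=> df /eqP/det0P[u u0 uJ]; exists u => //.
exact: etrans (esym (jacE u df)) uJ.
Qed.

Lemma det_jac_neq0 n (f : 'rV[C]_n -> 'rV[C]_n) x : differentiable f x ->
  \det (jac f x) != 0 -> forall u, 'd f x u = 0 -> u = 0.
Proof.
move=> df /det0P H u du; apply/eqP/negPn/negP => u0; apply: H; exists u => //.
exact: etrans (jacE u df) du.
Qed.

Lemma det_jac_holo n (f : 'rV[C]_n -> 'rV[C]_n) a (r : R) :
  (forall x, nrm (x - a) < r -> differentiable f x) ->
  forall x, nrm (x - a) < r -> differentiable (fun x => \det (jac f x)) x.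
Proof.
move=> df x xr; apply: differentiable_det => j i.
under eq_fun do rewrite mxE.
apply: (dird_holo _ _ xr) => y yr.
exact/differentiable_coordf/df.
Qed.

Lemma diff_zero_cst_rV (V : normedModType C) n (f : V -> 'rV[C]_n) (a : V) (r : R) :
  (forall x, nrm (x - a) < r -> differentiable f x) ->
  (forall x, nrm (x - a) < r -> forall h, 'd f x h = 0) ->
  forall x, nrm (x - a) < r -> f x = f a.
Proof.
move=> df d0 x xr; apply/rowP => i.
apply: (@diff_zero_cst _ V (fun x => coordf i (f x)) a r) => // y yr.
  exact/differentiable_coordf/df.
move=> h; apply: etrans (diff_coordf i h (df _ yr)) _; rewrite d0 //; exact: linear0.
Qed.

(** The point is the first zero met on the segment from [b] to [a]. If all derivatives along [a - b]
    vanished there, [flat_zero] would produce earlier zeros. *)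
Lemma first_zero_not_flat n (J : 'rV[C]_n -> C) (a b : 'rV[C]_n) (r : R) :
  (forall x, nrm (x - a) < r -> differentiable J x) ->
  nrm (b - a) < r -> J b != 0 -> J a = 0 ->
  exists z k, [/\ nrm (z - a) < r, J z = 0 & iter k (dird (a - b)) J z != 0].
Proof.
move=> dJ br Jb Ja; set v := a - b.
have r0 : 0 < r by apply: le_lt_trans br; exact: nrm_ge0.
have aa : nrm (a - a) < r by rewrite subrr nrm0.
pose l (t : R) := b + toC t *: v.
have lin t : 0 <= t <= 1 -> nrm (l t - a) < r by move=> t01; exact: segment_ball br aa t01.
pose S := [set t : R | 0 <= t <= 1 /\ J (l t) = 0].
have S1 : S 1.
  by split; rewrite ?lexx ?ler01 // /l -[toC 1]/(1 : C) scale1r /v addrC subrK.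
have Slb : lbound S 0 by move=> t [/andP[]].
have hS : has_inf S by split; [exists 1|exists 0].
pose t0 := inf S.
have t01 : 0 <= t0 <= 1.
  apply/andP; split; first by apply: lb_le_inf => //; exists 1.
  by apply: ge_inf => //; exists 0.
have nb (t : R) : 0 <= t <= 1 -> J (l t) != 0 -> exists2 d : R, 0 < d &
    forall s : R, `|s - t| < d -> J (l s) != 0.
  move=> th Jt; have n0 : 0 < nrm (J (l t)) by rewrite nrm_gt0.
  have /differentiable_continuous/continuous_nrmP/(_ _ n0)[d d0 dH] := dJ _ (lin _ th).
  have v1 : 0 < nrm v + 1 by rewrite ltr_wpDl ?nrm_ge0.
  exists (d / (nrm v + 1)); first by rewrite divr_gt0.
  move=> s; rewrite (ltr_pdivlMr _ _ v1) => sd; apply/eqP => Js.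
  have : nrm (l s - l t) < d.
    have -> : l s - l t = toC (s - t) *: v.
      rewrite /l opprD addrACA subrr add0r -scalerBl; congr (_ *: _).
      by apply: C_ext => /=; ring.
    rewrite nrmZ nrm_toC; apply: le_lt_trans sd; rewrite ler_wpM2l //.
    by rewrite lerDl.
  move=> hs.
  have E := etrans (congr1 (fun c => c - J (l t)) Js) (sub0r _).
  have := eq_ind _ (fun c => nrm c < nrm (J (l t))) (dH (l s) hs) _ E.
  by rewrite nrmN ltxx.
have Jt0 : J (l t0) = 0.
  apply/eqP/negPn/negP => H; have [d d0 dH] := nb t0 t01 H.
  have [s sS sd] := inf_adherent d0 hS.
  have ts : t0 <= s by exact: (ge_inf (ex_intro _ 0 Slb) sS).
  have std : `|s - t0| < d by rewrite ger0_norm ?subr_ge0 // ltrBlDl.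
  by move: (dH s std); apply/negP/negPn/eqP; exact: sS.2.
have t0p : 0 < t0.
  rewrite lt_def; case/andP: t01 => -> _; rewrite andbT; apply/eqP => E.
  move: Jt0; rewrite E /l -[toC 0]/(0 : C) scale0r addr0 => /eqP; exact/negP.
exists (l t0); apply: contrapT => /forallNP Nk.
have flat j : iter j (dird v) J (l t0) = 0.
  apply/eqP/negPn/negP => H; apply: (Nk j); split => //; exact: lin.
have rx : 0 < r - nrm (l t0 - a) by rewrite subr_gt0 lin.
have dJ' x : nrm (x - l t0) < r - nrm (l t0 - a) -> differentiable J x.
  move=> xr; apply: dJ; apply: le_lt_trans (nrmBD _ (l t0) _) _.
  by rewrite -ltrBrDr.
have [d d0 dH] := flat_zero rx dJ' flat.
pose s := Num.min (d / 2) t0.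
have s0 : 0 < s by rewrite lt_min t0p divr_gt0.
have sd : s < d.
  have : s <= d / 2 by rewrite ge_min lexx.
  by move: d0; clear; lra.
have st : s <= t0 by rewrite ge_min lexx orbT.
have := dH (toC (- s)); rewrite nrm_toC normrN (gtr0_norm s0) => /(_ sd).
have -> : l t0 + toC (- s) *: v = l (t0 - s).
  rewrite /l -addrA -scalerDl; congr (_ + _ *: _); by apply: C_ext => /=; ring.
move=> Js; have : S (t0 - s).
  split => //; rewrite subr_ge0 st /=; case/andP: t01 => _ t1.
  by apply: le_trans t1; rewrite gerBl ltW.
move=> /(ge_inf (ex_intro _ 0 Slb)); rewrite -/t0 leNgt => /negP; apply.
by rewrite gtrBl.
Qed.

Lemma sub_ball (V : normedModType C) (a x y : V) (r : R) :
  nrm (x - a) < r -> nrm (y - x) < r - nrm (x - a) -> nrm (y - a) < r.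
Proof.
by move=> xr yx; apply: le_lt_trans (nrmBD _ x _) _; rewrite -ltrBrDr.
Qed.

(** By [osgood_rank] a nonzero differential is injective, hence has nonzero determinant: the rank at
    a critical point can only be 0. *)
Lemma critical_diff0 n : osgood (R := R) n ->
  forall (f : 'rV[C]_n.+1 -> 'rV[C]_n.+1) a (r : R),
  (forall x, nrm (x - a) < r -> differentiable f x) ->
  (forall x y, nrm (x - a) < r -> nrm (y - a) < r -> f x = f y -> x = y) ->
  forall x, nrm (x - a) < r -> \det (jac f x) = 0 -> forall h, 'd f x h = 0.
Proof.
move=> IH f a r df fi x xr Jx h; apply/eqP/negPn/negP => h0.
have [u u0 du] := det_jac_eq0 (df _ xr) Jx; move/eqP: u0; apply.
have rx : 0 < r - nrm (x - a) by rewrite subr_gt0.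
apply: (osgood_rank IH rx _ _ _ du); last by exists h.
  by move=> y yx; exact/df/(sub_ball xr).
by move=> y z yx zx; apply: fi; exact: (sub_ball xr).
Qed.

Lemma osgood1 : osgood (R := R) 1.
Proof.
move=> f a r r0 df fi u du; apply/eqP/negPn/negP => u0.
have aa : nrm (a - a) < r by rewrite subrr nrm0.
have nu : 0 < nrm u by rewrite nrm_gt0.
have ru : 0 < r / nrm u by rewrite divr_gt0.
have tin (t : C) : nrm t < r / nrm u -> nrm (a + t *: u - a) < r.
  by rewrite ltr_pdivlMr // [a + _]addrC addrK nrmZ.
have lined (t : C) : nrm t < r / nrm u -> differentiable (fun t : C => f (a + t *: u)) t.
  by move=> tr; have [] := diff_line (df _ (tin t tr)).
have := @injective_diff1 _ (fun t : C => coordf 0 (f (a + t *: u))) _ ru.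
move=> H; have /eqP : 'd (fun t : C => coordf 0 (f (a + t *: u))) 0 1 != 0.
  apply: H.
    by move=> t tr; exact/differentiable_coordf/lined.
  move=> t s tr sr E.
  have fE : f (a + t *: u) = f (a + s *: u).
    by apply/rowP => i; rewrite (ord1 i); exact: E.
  have := fi _ _ (tin t tr) (tin s sr) fE => /addrI /eqP.
  by rewrite -subr_eq0 -scalerBl scaler_eq0 (negPf u0) orbF subr_eq0 => /eqP.
apply.
have z0 : nrm (0 : C) < r / nrm u by rewrite nrm0.
apply: etrans (@diff_coordf _ C 1 (fun t : C => f (a + t *: u)) 0 0 1 (lined 0 z0)) _.
have da0 := df _ (tin 0 z0).
have [_ E] := diff_line da0.
apply: etrans (congr1 (coordf 0) E) _.
have a0 : a + 0 *: u = a by rewrite scale0r addr0.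
apply: etrans (congr1 (coordf 0) (eq_ind_r (fun z => 'd f z u = 0) du a0)) _.
exact: linear0.
Qed.

(* Assume the Jacobian [J] vanishes at [a]. By [critical_diff0], [d f = 0] on
   the zero set of [J]. For a direction [v] and an order [m] minimal such that the
   [m]-th derivative of [J] along [v] is nonzero at some zero of [J], the derivative
   of order [m - 1] cuts out the zero set near that point; this set contains a curve,
   along which [f] is constant. *)
Lemma osgood_step n : osgood (R := R) n.+1 -> osgood (R := R) n.+2.
Proof.
move=> IH f a r r0 df fi.
have aa : nrm (a - a) < r by rewrite subrr nrm0.
suff detn0 : \det (jac f a) != 0 by exact: (det_jac_neq0 (df _ aa)).
apply/eqP => Ja.
pose J x := \det (jac f x).
have dJ := det_jac_holo df.
have crit := critical_diff0 IH df fi.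
have sub x y : nrm (x - a) < r -> nrm (y - x) < r - nrm (x - a) -> nrm (y - a) < r.
  exact: sub_ball.
(* If [J] vanished on the whole ball, so would the differential of [f], and [f] would be
   constant. *)
have [b br Jb] : exists2 b, nrm (b - a) < r & J b != 0.
  apply: contrapT => H.
  have d0 x : nrm (x - a) < r -> forall h, 'd f x h = 0.
    move=> xr; apply: (crit x xr); apply/eqP/negPn/negP => Jx; apply: H; by exists x.
  pose x := a + toC (r / 2) *: delta_mx 0 0.
  have nd : nrm (delta_mx 0 0 : 'rV[C]_n.+2) <= 1.
    apply: nrm_rV_le => // i; rewrite mxE; case: (_ && _); rewrite ?nrm1 ?nrm0 //.
  have xr : nrm (x - a) < r.
    rewrite /x [a + _]addrC addrK nrmZ nrm_toC gtr0_norm ?divr_gt0 //.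
    apply: le_lt_trans (ler_wpM2l _ nd) _; first by rewrite divr_ge0 // ltW.
    by move: r0; clear; lra.
  have := fi _ _ xr aa (diff_zero_cst_rV df d0 xr).
  rewrite /x -[RHS]addr0 => /addrI/rowP/(_ 0); rewrite !mxE !eqxx mulr1 => /(congr1 (@reC R)) /= E.
  by move: r0; rewrite -[r](@divfK _ 2) // E mul0r ltxx.
have [z [k [zr Jz kz]]] := first_zero_not_flat dJ br Jb Ja.
set v := a - b in kz.
have v0 : v != 0.
  rewrite subr_eq0; apply/eqP => E.
  exact: (elimN eqP Jb (eq_ind a (fun x => J x = 0) Ja b E)).
(* The order is minimized over all zeros of [J] in the ball, so that every derivative of lower order
   vanishes on the entire zero set and not just at one point. *)
pose P m := `[< exists2 z, nrm (z - a) < r /\ J z = 0 & iter m (dird v) J z != 0 >].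
have exP : exists m, P m by exists k; apply/asboolP; exists z.
case: (ex_minnP exP) => m /asboolP[{zr Jz kz}z [zr Jz] mz] mmin.
have min j x : (j < m)%N -> nrm (x - a) < r -> J x = 0 -> iter j (dird v) J x = 0.
  move=> jm xr Jx; apply/eqP/negPn/negP => H.
  have : P j by apply/asboolP; exists x.
  by move=> /mmin; rewrite leqNgt jm.
case: m mz min {mmin} => [|m] mz min; first by move: mz; rewrite /= Jz eqxx.
pose g := iter m (dird v) J.
have rz : 0 < r - nrm (z - a) by rewrite subr_gt0.
have dg x : nrm (x - z) < r - nrm (z - a) -> differentiable g x.
  by move=> xz; exact: (iter_dird_holo v m dJ (sub _ _ zr xz)).
have dJ' x : nrm (x - z) < r - nrm (z - a) -> differentiable J x.
  by move=> xz; exact: (dJ _ (sub _ _ zr xz)).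
have Jg x : nrm (x - z) < r - nrm (z - a) -> J x = 0 -> g x = 0.
  by move=> xz; exact: (min m x (ltnSn m) (sub _ _ zr xz)).
have [j vj] : exists j, v 0 j != 0.
  apply: contrapT => H; move/eqP: v0; apply; apply/rowP => j; rewrite [RHS]mxE.
  by apply/eqP/negPn/negP => vj; apply: H; exists j; exact: vj.
(* Dimension at least two enters here. The curve moves along an axis [j'] other than [j]: its
   coordinate [j] reads off [tau], and its coordinate [j'] then reads off the parameter, so it is
   not constant. *)
have [j' jj'] : exists j' : 'I_n.+2, j' != j.
  by exists (lift j ord0); rewrite eq_sym; exact: neq_lift.
pose w : 'rV[C]_n.+2 := delta_mx 0 j'.
pose i (s : C) := s *: w.
have ilin : linear i by move=> c s t; rewrite /i scalerDl scalerA.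
pose i' : {linear C -> 'rV[C]_n.+2} := HB.pack i (GRing.isLinear.Build _ _ _ _ _ ilin).
have iB s : nrm (i' s) <= nrm w * nrm s by rewrite /= /i nrmZ mulrC.
have ci : continuous i' := bounded_linear_cont iB.
have [d d0 [tau [tau0 H]]] := zero_graph rz v0 iB dg dJ' Jz mz Jg.
pose p s := z + i' s + tau s *: v.
have pd s : nrm (s - 0) < d -> [/\ nrm (p s - a) < r, J (p s) = 0 & differentiable p s].
  rewrite subr0 => sd; have [h1 h2 _ h4 _] := H s sd; split.
  - exact: sub zr h1.
  - exact: h2.
  - exact: differentiable_graph.
have dfp s : nrm (s - 0) < d -> differentiable (fun s => f (p s)) s.
  by move=> /pd[h1 _ h3]; apply: (@differentiable_comp _ _ _ _ p f); [exact: h3|exact: df].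
have dfp0 s : nrm (s - 0) < d -> forall h, 'd (fun s => f (p s)) s h = 0.
  move=> /pd[h1 h2 h3] h; apply: etrans (diff_chain h h3 (df _ h1)) _.
  exact: crit.
have s0 : nrm (toC (d / 2)) = d / 2 by rewrite nrm_toC gtr0_norm // divr_gt0.
have sd : nrm (toC (d / 2) - 0) < d by rewrite subr0 s0; move: d0; clear; lra.
have z0 : nrm (0 - 0 : C) < d by rewrite subr0 nrm0.
have E := diff_zero_cst_rV dfp dfp0 sd.
have [ps _ _] := pd _ sd; have [p0 _ _] := pd _ z0.
have {}E := fi _ _ ps p0 E.
have pE s : (p s) 0 j = z 0 j + tau s * v 0 j.
  by rewrite !mxE [j == j']eq_sym (negPf jj') andbF mulr0 addr0.
have t0 : tau (toC (d / 2)) = 0.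
  move/(congr1 (fun x : 'rV[C]_n.+2 => x 0 j)): E; rewrite !pE tau0 mul0r addr0 -[RHS]addr0.
  by move=> /addrI /eqP; rewrite mulf_eq0 (negPf vj) orbF => /eqP.
have pE' s : (p s) 0 j' = z 0 j' + s + tau s * v 0 j'.
  by rewrite !mxE !eqxx mulr1.
have e0 : z 0 j' + toC (d / 2) = z 0 j' + 0.
  have := congr1 (fun x : 'rV[C]_n.+2 => x 0 j') E.
  by rewrite !pE' t0 tau0 mul0r !addr0.
have e1 : toC (d / 2) = 0 by exact: (addrI _ e0).
have h : d / 2 = 0 by rewrite -s0 e1 nrm0.
by move: d0; rewrite -[d](@divfK _ 2) // h mul0r ltxx.
Qed.

Lemma osgood_all n : osgood (R := R) n.
Proof.
case: n => [|n]; first by move=> f a r _ _ _ u _; apply/rowP => -[].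
by elim: n => [|n IH]; [exact: osgood1|exact: osgood_step].
Qed.

End Osgood.

(** * Holomorphic inverses *)

Section Inverse.
Context {R : realType}.
Local Notation C := (Cplx R).

Definition injective_holo (n : nat) (f : 'rV[C]_n -> 'rV[C]_n) (a : 'rV[C]_n) (r : R) :=
  (forall x, nrm (x - a) < r -> differentiable f x) /\
  (forall x y, nrm (x - a) < r -> nrm (y - a) < r -> f x = f y -> x = y).

Lemma injective_jac_unit n (f : 'rV[C]_n -> 'rV[C]_n) a (r : R) x :
  injective_holo f a r -> nrm (x - a) < r -> jac f x \in unitmx.
Proof.
move=> [df fi] xr; rewrite unitmxE unitfE; apply/eqP => J0.
have [u u0 du] := det_jac_eq0 (df x xr) J0; move/eqP: u0; apply.
have rx : 0 < r - nrm (x - a) by rewrite subr_gt0.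
apply: (@osgood_all _ n f x _ rx _ _ u du).
  by move=> y yx; exact/df/(sub_ball xr).
by move=> y z yx zx; apply: fi; exact: (sub_ball xr).
Qed.

Lemma diff_invmx n (f : 'rV[C]_n -> 'rV[C]_n) a (r : R) x y : injective_holo f a r -> nrm (x - a) < r -> 'd f x (y *m invmx (jac f x)) = y.
Proof.
move=> fh xr; apply: etrans (esym (jacE _ (fh.1 x xr))) _.
by rewrite mulmxKV // (injective_jac_unit fh).
Qed.

Lemma shift_nrm_continuous (E : normedModType C) (b : E) : continuous (fun x : E => nrm (x - b) : R).
Proof.
move=> x; apply: (@continuous_comp _ _ _ (fun x : E => x - b) (fun x : E => nrm x : R)).
  by apply: continuousB; [exact: cvg_id|exact: cst_continuous].
exact: nrm_continuous.
Qed.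

Lemma compact_closed_ball n (a : 'rV[C]_n) (rho : R) : compact [set x : 'rV[C]_n | nrm (x - a) <= rho].
Proof.
apply: (subclosed_compact _ (@compact_rV_ball _ n (rho + nrm a))).
  have -> : [set x : 'rV[C]_n | nrm (x - a) <= rho] = (fun x : 'rV[C]_n => nrm (x - a) : R) @^-1` [set x | x <= rho] by [].
  by apply: closed_comp; [move=> z _; exact: shift_nrm_continuous|exact: closed_le].
move=> x /= xr; rewrite -[x](subrK a); apply: le_trans (nrmD _ _) _.
by rewrite lerD2r.
Qed.

(* A minimizer of [|f x - y|] over a closed ball is interior when [y] is close to
   [f a], and invertibility of the derivative then forces [f x = y]. *)
Lemma open_at n (f : 'rV[C]_n -> 'rV[C]_n) a (r : R) : 0 < r -> injective_holo f a r ->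
  exists2 d : R, 0 < d & forall y, nrm (y - f a) < d ->
  exists2 x, nrm (x - a) < r & f x = y.
Proof.
pose E := 'rV[C]_n.
move=> r0 fh; have [df fi] := fh; pose rho := r / 2.
have rho0 : 0 < rho by rewrite divr_gt0.
have rhor : rho < r by move: r0; rewrite /rho; clear; lra.
have aa : nrm (a - a) < r by rewrite subrr nrm0.
pose B := [set x : E | nrm (x - a) <= rho].
have Br x : B x -> nrm (x - a) < r by move=> h; exact: le_lt_trans rhor.
have cfB (y : E) : {within B, continuous (fun x => nrm (f x - y) : R)}.
  apply: continuous_in_subspaceT => x /set_mem /Br xr.
  apply: (@continuous_comp _ _ _ f (fun x : E => nrm (x - y) : R)).
    exact: differentiable_continuous (df _ xr).
  exact: shift_nrm_continuous.
have [m m0 mS] : exists2 m : R, 0 < m & forall x, nrm (x - a) = rho -> m <= nrm (f x - f a).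
  pose S := [set x : E | nrm (x - a) = rho].
  (* The sphere is empty in dimension 0. *)
  have [S0|/set0P S0] := eqVneq S set0.
    exists 1 => // x xS; have : S x by [].
    by rewrite S0.
  have SB : S `<=` B by move=> x xS; rewrite /B /= [nrm _]xS.
  have cS : compact S.
    apply: (subclosed_compact _ (@compact_closed_ball n a rho)) => //.
    have -> : S = (fun x : E => nrm (x - a) : R) @^-1` [set x | x = rho] by [].
    by apply: closed_comp; [move=> z _; exact: shift_nrm_continuous|exact: closed_eq].
  have [x /set_mem xS xm] := compact_EVT_min S0 cS (continuous_subspaceW SB (cfB (f a))).
  exists (nrm (f x - f a)).
    rewrite nrm_gt0 subr_eq0; apply/eqP => fE.
    have xa := fi _ _ (Br _ (SB _ xS)) aa fE.
    by move: rho0; rewrite -xS xa subrr nrm0 ltxx.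
  by move=> z zS; apply: xm; rewrite inE.
(* For such [y], the values of [f] on the sphere are farther from [y] than [f a] is. *)
exists (m / 2); first by rewrite divr_gt0.
move=> y ya.
have Ba : B a by rewrite /B /= subrr nrm0 ltW.
have [x /set_mem xB xm] := compact_EVT_min (ex_intro _ a Ba) (@compact_closed_ball n a rho) (cfB y).
have xa : nrm (f x - y) <= nrm (f a - y) by apply: xm; rewrite inE.
have xr := Br _ xB.
exists x => //; apply/eqP; rewrite -subr_eq0 -nrm_eq0; apply/eqP/le_anti.
rewrite nrm_ge0 andbT leNgt; apply/negP => pos.
have xrho : nrm (x - a) < rho.
  rewrite lt_def [nrm (x - a) <= rho]xB andbT; apply/eqP => e.
  have h := mS x (esym e); have h2 := nrmBD (f x) y (f a).
  rewrite nrm_distC in xa; move: h h2 xa ya; rewrite [nrm (f a - y)]nrm_distC.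
  rewrite [nrm (y - f x)]nrm_distC; move: m0; clear; lra.
pose h := (y - f x) *m invmx (jac f x).
have dh : 'd f x h = y - f x by exact: (diff_invmx _ fh).
have h1 : 0 < nrm h + 1 by rewrite ltr_wpDl ?nrm_ge0.
(* A step [s h] moves the value a fraction [s] of the way to [y]; this [e] keeps the linearization
   error within half of that gain. *)
pose e := nrm (f x - y) / (2 * (nrm h + 1)).
have e0 : 0 < e by rewrite /e divr_gt0 // mulr_gt0.
have [d d0 dH] := differentiable_est (df _ xr) e0.
have [s [s0 s1 sd sr]] : exists s : R, [/\ 0 < s, s <= 1, s * (nrm h + 1) < d & s * (nrm h + 1) <= rho - nrm (x - a)].
  pose q := Num.min (Num.min d (rho - nrm (x - a)) / (nrm h + 1)) 2.
  have mn : 0 < Num.min d (rho - nrm (x - a)) by rewrite lt_min d0 subr_gt0.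
  have q0 : 0 < q by rewrite lt_min (divr_gt0 mn h1) ltr0n.
  have qh : q * (nrm h + 1) <= Num.min d (rho - nrm (x - a)).
    by rewrite -ler_pdivlMr // ge_min lexx.
  have q2 : q <= 2 by rewrite ge_min lexx orbT.
  have qp : 0 < q * (nrm h + 1) by rewrite mulr_gt0.
  move: qh; rewrite le_min => /andP[qd qr].
  exists (q / 2); rewrite divr_gt0 // mulrAC; split => //.
  - by move: q2; clear; lra.
  - by move: qd qp; clear; lra.
  - by move: qr qp; clear; lra.
have ns : nrm (toC s *: h) <= s * (nrm h + 1).
  by rewrite nrmZ nrm_toC gtr0_norm // ler_pM2l // lerDl.
have := dH _ (le_lt_trans ns sd).
have -> : 'd f x (toC s *: h) = toC s *: (y - f x) by rewrite linearZ; congr (_ *: _).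
move=> est.
have xB' : B (x + toC s *: h).
  rewrite /B /= addrAC; apply: le_trans (nrmD _ _) _.
  by move: sr ns; clear; lra.
have := xm (x + toC s *: h); rewrite inE => /(_ xB'); rewrite leNgt => /negP; apply.
have -> : f (x + toC s *: h) - y = (f (x + toC s *: h) - f x - toC s *: (y - f x)) + toC (1 - s) *: (f x - y).
  have -> : toC (1 - s) = 1 - toC s by apply: C_ext => /=; ring.
  rewrite scalerBl scale1r -[y - f x]opprB scalerN opprK addrA.
  by rewrite [_ + toC s *: _ + _]addrAC addrK addrA subrK.
apply: le_lt_trans (nrmD _ _) _; rewrite nrmZ nrm_toC ger0_norm ?subr_ge0 //.
have est2 : e * nrm (toC s *: h) <= s * (nrm (f x - y) / 2).
  apply: le_trans (ler_wpM2l (ltW e0) ns) _.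
  rewrite /e le_eqVlt; apply/orP; left; apply/eqP; field.
  by rewrite gt_eqF.
have sp : 0 < s * nrm (f x - y) by rewrite mulr_gt0.
move: (le_trans est est2) sp; clear; lra.
Qed.

(** The inverse of the differential bounds [nrm (x - a)] by [K] times its image, and the first-order
    error costs half of it. *)
Lemma expand_at n (f : 'rV[C]_n -> 'rV[C]_n) a (r : R) : 0 < r -> injective_holo f a r ->
  exists2 c : R, 0 < c & exists2 d : R, 0 < d &
  forall x, nrm (x - a) < d -> c * nrm (x - a) <= nrm (f x - f a).
Proof.
move=> r0 fh; have [df _] := fh; pose E := 'rV[C]_n.
have aa : nrm (a - a) < r by rewrite subrr nrm0.
pose Ji := invmx (jac f a).
pose Lj : {linear 'rV[C]_n -> 'rV[C]_n} := mulmxr Ji.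
have LjE y : Lj y = y *m Ji by [].
have [B LB] := rV_linear_bound Lj.
pose K := `|B| + 1.
have K0 : 0 < K by rewrite ltr_wpDl.
have LK (y : 'rV[C]_n) : nrm (y *m Ji) <= K * nrm y.
  rewrite -LjE; apply: (le_trans (LB y)).
  rewrite ler_wpM2r ?nrm_ge0 //.
  by apply: le_trans (ler_norm B) _; rewrite lerDl.
have K20 : 0 < (2 * K)^-1 by rewrite invr_gt0 mulr_gt0.
have [d d0 dH] := differentiable_est (df _ aa) K20.
exists (2 * K)^-1 => //; exists d => // x xd.
have := dH _ xd; rewrite [a + _]addrC subrK => h1.
have h2 : nrm (x - a) <= K * nrm ('d f a (x - a)).
  have E1 : x - a = 'd f a (x - a) *m Ji.
    have := jacE (x - a) (df _ aa) => <-.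
    by rewrite mulmxK // (injective_jac_unit fh).
  by rewrite {1}E1.
have h3 := ler_nrmB ('d f a (x - a)) (f x - f a); rewrite nrm_distC in h3.
have h4 : nrm (x - a) <= K * nrm (f x - f a) + K * ((2 * K)^-1 * nrm (x - a)).
  rewrite -mulrDr; apply: le_trans h2 _; rewrite ler_pM2l //.
  by move: h1 h3; clear; lra.
have h5 : K * ((2 * K)^-1 * nrm (x - a)) = nrm (x - a) / 2 by field; rewrite gt_eqF.
rewrite h5 in h4; rewrite ler_pdivrMl ?mulr_gt0 //.
move: h4; clear; lra.
Qed.

End Inverse.

(** Near [f a] the function [G] is [k] composed with the inverse of [f]. By [open_at] every nearby
    value has a preimage close to [a], and by [expand_at] an error that is small relative to [x - a]
    is small relative to [f x - f a]. *)
Lemma inverse_diff (R : realType) (n : nat) (f : 'rV[Cplx R]_n -> 'rV[Cplx R]_n) (a : 'rV[Cplx R]_n)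
    (r : R) (k G : 'rV[Cplx R]_n -> Cplx R) : 0 < r ->
  injective_holo f a r ->
  differentiable k a -> (forall x, nrm (x - a) < r -> G (f x) = k x) ->
  differentiable G (f a).
Proof.
move=> r0 fh dk GE; have [df fi] := fh.
have aa : nrm (a - a) < r by rewrite subrr nrm0.
have [c c0 [d1 d10 cH]] := expand_at r0 fh.
pose Ji := invmx (jac f a).
pose L : {linear 'rV[Cplx R]_n -> Cplx R} := 'd k a \o mulmxr Ji.
have [B LB] := rV_linear_bound L.
have Ga : G (f a) = k a by exact: GE.
have [] // := @diff_of_est _ _ _ G (f a) L B LB.
move=> e e0.
have [Bk Bk0 kB] := linear_bound (diff_continuous dk).
pose Lj : {linear 'rV[Cplx R]_n -> 'rV[Cplx R]_n} := mulmxr Ji.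
have LjE y : Lj y = y *m Ji by [].
have [B2 JB] := rV_linear_bound Lj.
pose K := `|B2| + 1.
have K0 : 0 < K by rewrite ltr_wpDl.
have JK (y : 'rV[Cplx R]_n) : nrm (y *m Ji) <= K * nrm y.
  rewrite -LjE; apply: (le_trans (JB y)).
  rewrite ler_wpM2r ?nrm_ge0 //.
  by apply: le_trans (ler_norm B2) _; rewrite lerDl.
(* The errors from [k] and from [f] are each at most [e * c / 2 * nrm (x - a)], while
   [c * nrm (x - a) <= nrm h]. *)
have e10 : 0 < e * c / 2 by rewrite divr_gt0 // mulr_gt0.
have BK0 : 0 < Bk * K by rewrite mulr_gt0.
have [d2 d20 H2] := differentiable_est dk e10.
have [d3 d30 H3] := differentiable_est (df _ aa) (divr_gt0 e10 BK0).
pose rho := Num.min (Num.min d1 r) (Num.min d2 d3).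
have rho0 : 0 < rho by rewrite !lt_min d10 r0 d20 d30.
have rhor x : nrm (x - a) < rho -> nrm (x - a) < r by rewrite !lt_min => /andP[/andP[]].
have fh' : injective_holo f a rho.
  by split => [x /rhor|x y /rhor h1 /rhor h2]; [exact: df|exact: fi].
have [d d0 dH] := open_at rho0 fh'.
exists d => // h hd; have [|x xr fx] := dH (f a + h); first by rewrite [f a + _]addrC addrK.
rewrite -fx GE; last exact: rhor.
have hE : h = f x - f a by rewrite fx [f a + _]addrC addrK.
move: (xr); rewrite !lt_min => /andP[/andP[x1 _] /andP[x2 x3]].
have c1 := cH x x1; rewrite -hE in c1.
have k1 := H2 _ x2; rewrite [a + _]addrC subrK in k1.
have f1 := H3 _ x3; rewrite [a + _]addrC subrK -hE in f1.
have E1 : 'd f a (x - a) *m Ji = x - a.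
  have := jacE (x - a) (df _ aa) => <-.
  by rewrite mulmxK // (injective_jac_unit fh).
have E2 : k x - G (f a) - L h = (k x - k a - 'd k a (x - a)) - 'd k a ((h - 'd f a (x - a)) *m Ji).
  rewrite Ga mulmxBl E1 linearB /=; ring.
rewrite E2; apply: le_trans (nrmB _ _) _.
have b1 : nrm ('d k a ((h - 'd f a (x - a)) *m Ji)) <= e * c / 2 * nrm (x - a).
  apply: le_trans (kB _) _; apply: le_trans (ler_wpM2l (ltW Bk0) (JK _)) _.
  apply: le_trans (ler_wpM2l (ltW Bk0) (ler_wpM2l (ltW K0) f1)) _.
  rewrite le_eqVlt; apply/orP; left; apply/eqP; field.
  by rewrite !gt_eqF.
have b2 : e * (c * nrm (x - a)) <= e * nrm h by rewrite ler_pM2l.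
apply: le_trans b2; move: k1 b1; clear; nra.
Qed.

(** * Holomorphic functions on a manifold *)

Section Manifold.
Context {R : realType} {N : nat}.
Local Notation C := (Cplx R).
Variable M : complexManifold R N.
Implicit Types (f g h : M -> C) (z w : M).

Lemma chart_ball (c : chart R N M) z (U : set M) : atlas c -> chart_dom c z -> nbhs z U ->
  exists2 r : R, 0 < r & forall x, nrm (x - c z) < r ->
    [/\ chart_dom c (chart_inv c x), U (chart_inv c x) & c (chart_inv c x) = x].
Proof.
move=> ac cz Uz.
have [_ oc cK _ _] := atlas_chart ac.
have h1 := near_chart_inv ac cz Uz.
have h2 : nbhs (c z) (c @` chart_dom c).
  by apply: open_nbhs_nbhs; split => //; exists z.
have h3 : nbhs (c z : 'rV[C]_N) ([set x | U (chart_inv c x)] `&` (c @` chart_dom c)).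
  exact: filterI h1 h2.
have [r r0 rH] := (nbhs_nrmP _ _).1 h3.
exists r => // x xr; have [Ux [z' z'd z'x]] := rH x xr.
by split => //; rewrite -z'x cK.
Qed.

Lemma holo_chart_diff (W : normedModType C) (f : M -> W) (c : chart R N M) x :
  holomorphic f -> atlas c -> chart_dom c (chart_inv c x) -> c (chart_inv c x) = x ->
  differentiable (f \o chart_inv c) x.
Proof. by move=> hf ac xd xE; rewrite -xE; exact: hf. Qed.

Lemma holo_cst (k : C) : holomorphic (fun _ : M => k).
Proof. by move=> c ac z _ cz; exact: differentiable_cst. Qed.

Lemma holo_add f g : holomorphic f -> holomorphic g -> holomorphic (fun z => f z + g z).
Proof. by move=> hf hg c ac z Uz cz; apply: differentiableD; [exact: hf|exact: hg]. Qed.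

Lemma holo_mul f g : holomorphic f -> holomorphic g -> holomorphic (fun z => f z * g z).
Proof. by move=> hf hg c ac z Uz cz; apply: differentiableM; [exact: hf|exact: hg]. Qed.

Lemma holo_opp f : holomorphic f -> holomorphic (fun z => - f z).
Proof. by move=> hf c ac z Uz cz; apply: differentiableN; exact: hf. Qed.

Lemma holo_sub f g : holomorphic f -> holomorphic g -> holomorphic (fun z => f z - g z).
Proof. by move=> hf hg; apply: holo_add; [exact: hf|exact: holo_opp]. Qed.

Lemma holo_pow f k : holomorphic f -> holomorphic (fun z => f z ^+ k).
Proof. by move=> hf c ac z Uz cz; apply: (@differentiable_pow _ _ (f \o chart_inv c)); exact: hf. Qed.

Lemma holo_inv f : holomorphic f -> (forall z, f z != 0) -> holomorphic (fun z => (f z)^-1).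
Proof.
move=> hf f0 c ac z Uz cz; apply: (@differentiableV _ _ (f \o chart_inv c)); first exact: hf.
exact: f0.
Qed.

(** In a chart, [ball_lip] gives the Lipschitz constant [96 / r] for all functions bounded by 1, so
    one neighbourhood serves them all. *)
Lemma equicontinuous_at z (U : set M) (e : R) : nbhs z U -> 0 < e ->
  nbhs z [set y | forall f : M -> C, holomorphic f -> (forall w, U w -> nrm (f w) <= 1) ->
    nrm (f y - f z) <= e].
Proof.
move=> Uz e0; have [c ac cz] := atlas_cover z.
have [od oc cK cc _] := atlas_chart ac.
have [r r0 rH] := chart_ball ac cz Uz.
pose d := Num.min (r / 2) (e * r / 96).
have d0 : 0 < d by rewrite lt_min !divr_gt0 // mulr_gt0.
have h1 : nbhs z [set y | nrm (c y - c z) < d].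
  have h0 : nbhs (c z : 'rV[C]_N) [set x | nrm (x - c z) < d].
    by apply/nbhs_nrmP; exists d.
  exact: (cc z cz _ h0).
have h2 : nbhs z (chart_dom c) by exact: open_nbhs_nbhs.
apply: filterS (filterI h1 h2) => y [/= yd cy] f hf fU.
pose u : 'rV[C]_N -> C := f \o chart_inv c.
have du x : nrm (x - c z) < r -> differentiable u x.
  by move=> /rH[xd _ xE]; exact: holo_chart_diff.
have u1 x : nrm (x - c z) < r -> nrm (u x) <= 1.
  by move=> /rH[_ xU _]; exact: fU.
have zz : nrm (c z - c z) < r / 2 by rewrite subrr nrm0 divr_gt0.
have yr : nrm (c y - c z) < r / 2 by move: yd; rewrite lt_min => /andP[].
have := ball_lip r0 du u1 zz yr; rewrite /u /= !cK // => h; apply: le_trans h _.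
have : nrm (c y - c z) <= e * r / 96 by move: yd; rewrite lt_min => /andP[_ /ltW].
move=> h; apply: le_trans (ler_wpM2l _ h) _; first by rewrite divr_ge0 // ltW.
by rewrite le_eqVlt; apply/orP; left; apply/eqP; field; rewrite gt_eqF.
Qed.

Lemma holomorphic_limit f :
  (forall z, exists2 U, nbhs z U & forall e : R, 0 < e ->
     exists2 g, holomorphic g & forall y, U y -> nrm (g y - f y) <= e) ->
  holomorphic f.
Proof.
move=> H c ac z _ cz; have [U Uz HU] := H z.
have [r r0 rH] := chart_ball ac cz Uz.
apply: (weierstrass r0) => e e0; have [g hg gf] := HU e e0.
exists (g \o chart_inv c) => x /rH[xd xU xE]; split; first exact: holo_chart_diff.
exact: gf.
Qed.

(** In charts [phi] is an injective holomorphic map between open sets of the same dimension, the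
    situation of [inverse_diff]. *)
Lemma holo_comp_inverse (phi psi : M -> M) h : holomorphic_map phi -> injective phi ->
  (forall z, psi (phi z) = z) -> holomorphic h -> holomorphic_on (range phi) (h \o psi).
Proof.
move=> [cphi hphi] iphi psiK hh c ac _ [z _ <-] cw.
have [d ad dz] := atlas_cover z.
have [_ _ dK _ _] := atlas_chart ad.
have [oc _ cK _ _] := atlas_chart ac.
have Uz : nbhs z (phi @^-1` chart_dom c) by apply: cphi; exact: open_nbhs_nbhs.
have [r r0 rH] := chart_ball ad dz Uz.
pose f := c \o phi \o chart_inv d.
have fE : f (d z) = c (phi z) by rewrite /f /= dK.
rewrite -fE.
apply: (@inverse_diff R N f (d z) r (h \o chart_inv d) _ r0).
- split.
    by move=> x /rH[xd xc xE]; rewrite -xE; exact: hphi.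
  move=> x y /rH[xd xc xE] /rH[yd yc yE] fxy.
  have E1 : phi (chart_inv d x) = phi (chart_inv d y).
    by rewrite -(cK _ xc) -(cK _ yc); congr (chart_inv c _).
  by rewrite -xE -yE (iphi _ _ E1).
- exact: hh.
- by move=> x /rH[xd xc xE]; rewrite /f /= cK // psiK.
Qed.

(** The iterate is undone one factor at a time: [h] composed with the inverse of [phi] is
    approximated on [phi K] by a global function, to which the induction hypothesis applies on
    [phi K]. Thus the Runge property of [range phi] serves all iterates. *)
Lemma runge_transfer (phi : M -> M) : holomorphic_map phi -> injective phi ->
  runge_domain (range phi) -> forall k h (K : set M) (e : R), holomorphic h -> compact K -> 0 < e ->
  exists2 g, holomorphic g & forall z, K z -> nrm (g (iter k phi z) - h z) < e.
Proof.
move=> hphi iphi [_ _ _ runge]; elim=> [|k IH] h K e hh cK e0.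
  by exists h => // z _; rewrite subrr nrm0.
have e20 : 0 < e / 2 by rewrite divr_gt0.
have cphiK : compact (phi @` K).
  by apply: continuous_compact => //; exact/continuous_subspaceT/(proj1 hphi).
have [[z0]|noM] := pselect (inhabited M); last first.
  by exists h => // z _; exfalso; apply: noM; exact: (inhabits z).
have ex (w : M) : exists z, forall z', phi z' = w -> z = z'.
  have [[z zw]|H] := pselect (exists z, phi z = w).
    by exists z => z' z'w; apply: iphi; rewrite zw z'w.
  by exists z0 => z' z'w; exfalso; apply: H; exists z'.
have [psi psiP] := choice ex.
have psiK z : psi (phi z) = z by exact: psiP.
have hg := holo_comp_inverse hphi iphi psiK hh.
have sub : phi @` K `<=` range phi by move=> _ [z _ <-]; exists z.
have [h1 hh1 h1P] := runge _ hg _ cphiK sub _ e20.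
have [g hg' gP] := IH h1 _ _ hh1 cphiK e20.
exists g => // z Kz; rewrite iterSr.
have a1 := gP (phi z); have a2 := h1P (phi z).
have phiK : (phi @` K) (phi z) by exists z.
have {}a1 := a1 phiK; have {}a2 := a2 phiK; rewrite modulusE /= psiK in a2.
apply: le_lt_trans (nrmBD _ (h1 (phi z)) _) _.
by rewrite (splitr e) ltrD.
Qed.

(** * Harnack's inequality for functions into the disc *)

Definition disc_fun (F : M -> C) := holomorphic F /\ forall x, nrm (F x) < 1.

Lemma disc_neq1 F z : disc_fun F -> 0 < nrm (1 - F z).
Proof.
move=> [_ /(_ z) F1]; rewrite nrm_gt0 subr_eq0; apply/eqP => E.
by move: F1; rewrite -E nrm1 ltxx.
Qed.

(** [1 - F] has positive real part, so the denominator has real part at least 1. *)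
Lemma disc_harnack_transform (F : M -> C) (k : R) : disc_fun F -> 0 < k ->
  holomorphic (fun z => (1 + toC k * (1 - F z))^-1) /\
  forall z, 1 <= nrm (1 + toC k * (1 - F z)).
Proof.
move=> [hF F1] k0.
have ge1 z : 1 <= nrm (1 + toC k * (1 - F z)).
  apply: le_trans (_ : reC (1 + toC k * (1 - F z)) <= _); last first.
    by apply: le_trans (reC_le _); exact: ler_norm.
  rewrite reCD reCM /= mul0r subr0 lerDl; apply: mulr_ge0; first exact: ltW.
  rewrite reCD reCN /= subr_ge0.
  by apply: le_trans (ler_norm _) _; apply: le_trans (reC_le _) _; rewrite ltW.
split; last exact: ge1.
apply: holo_inv.
  apply: holo_add; first exact: holo_cst.
  by apply: holo_mul; [exact: holo_cst|apply: holo_sub; [exact: holo_cst|exact: hF]].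
by move=> z; rewrite -nrm_gt0 (lt_le_trans ltr01).
Qed.

(* With [k = 1 / (4 |1 - F b|)] the function [1 / (1 + k (1 - F))] is bounded by 1, and
   [equicontinuous_at] keeps its values at [a] close to those at [b]. *)
Lemma harnack_local z : nbhs z [set y | forall F, disc_fun F ->
  nrm (1 - F y) <= 4 * nrm (1 - F z) /\ nrm (1 - F z) <= 4 * nrm (1 - F y)].
Proof.
have e0 : 0 < 4^-1 :> R by rewrite invr_gt0.
apply: filterS (equicontinuous_at (filterT : nbhs z [set: M]) e0) => y yH F FD.
have key (a b : M) : (forall f : M -> C, holomorphic f -> (forall w, [set: M] w -> nrm (f w) <= 1) ->
    nrm (f a - f b) <= 4^-1) -> nrm (1 - F a) <= 4 * nrm (1 - F b).
  move=> H; have d0 := disc_neq1 b FD; set d := nrm (1 - F b) in d0 *.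
  pose k := (4 * d)^-1.
  have k0 : 0 < k by rewrite invr_gt0 mulr_gt0.
  have [hG G1] := disc_harnack_transform FD k0.
  pose G z : C := (1 + toC k * (1 - F z))^-1.
  have Gne z' : 1 + toC k * (1 - F z') != 0 by rewrite -nrm_gt0 (lt_le_trans ltr01).
  have GE z' : 1 - G z' = toC k * (1 - F z') * G z'.
    by rewrite /G; field; rewrite Gne.
  have Gle z' : nrm (G z') <= 1.
    by rewrite /G nrmV invf_le1 // (lt_le_trans ltr01).
  have h1 : nrm (G a - G b) <= 4^-1 by apply: H => // w _; exact: Gle.
  have h2 : nrm (1 - G b) <= 4^-1.
    rewrite GE !nrmM nrm_toC (gtr0_norm k0) -/d; apply: le_trans (_ : k * d * 1 <= _).
      by apply: ler_wpM2l => //; rewrite mulr_ge0 ?ltW.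
    rewrite mulr1 /k invfM -mulrA mulVf ?gt_eqF // mulr1 //.
  have h3 : nrm (1 - G a) <= 2^-1.
    have -> : 1 - G a = (1 - G b) - (G a - G b) by ring.
    by apply: le_trans (nrmB _ _) _; move: h1 h2; clear; lra.
  have h4 : 2^-1 <= nrm (G a).
    have := ler_nrmB (1 : C) (1 - G a); rewrite subKr nrm1.
    by move: h3; clear; lra.
  move: h3; rewrite GE !nrmM nrm_toC (gtr0_norm k0) => h3.
  have h5 : k * nrm (1 - F a) * 2^-1 <= 2^-1.
    by apply: le_trans h3; apply: ler_wpM2l => //; rewrite mulr_ge0 ?nrm_ge0 // ltW.
  have h6 : k * nrm (1 - F a) <= 1 by move: h5; clear; lra.
  by move: h6; rewrite /k ler_pdivrMl ?mulr_gt0 // mulr1.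
split; apply: key => f hf f1; first exact: yH.
by rewrite nrm_distC; exact: yH.
Qed.

(** The points comparable with [z0] form a nonempty set that is open and closed: [harnack_local]
    works in both directions at the cost of a factor 4. The constant does not depend on [F]. *)
Lemma harnack_point z0 : connected [set: M] -> forall z, exists2 c : R, 0 < c & forall F, disc_fun F ->
  nrm (1 - F z) <= c * nrm (1 - F z0) /\ nrm (1 - F z0) <= c * nrm (1 - F z).
Proof.
move=> conM.
pose A := [set z : M | exists2 c : R, 0 < c & forall F, disc_fun F ->
  nrm (1 - F z) <= c * nrm (1 - F z0) /\ nrm (1 - F z0) <= c * nrm (1 - F z)].
have step z y : (forall F, disc_fun F ->
   nrm (1 - F y) <= 4 * nrm (1 - F z) /\ nrm (1 - F z) <= 4 * nrm (1 - F y)) -> A z -> A y.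
  move=> H [c c0 cH]; exists (4 * c); first by rewrite mulr_gt0.
  move=> F FD; have [h1 h2] := H F FD; have [h3 h4] := cH F FD; split.
    by rewrite -mulrA; apply: le_trans h1 _; rewrite ler_pM2l.
  by apply: le_trans h4 _; rewrite -mulrA [leRHS]mulrCA ler_pM2l.
suff : A = [set: M] by move=> AT z; have : [set: M] z by []; rewrite -AT.
apply: conM.
- by exists z0; exists 1 => // F _; rewrite mul1r.
- exists A; last by rewrite setTI.
  rewrite openE => z Az; apply: filterS (harnack_local z) => y yH.
  exact: step yH Az.
- exists A; last by rewrite setTI.
  move=> z clz; have [y [Ay yH]] := clz _ (harnack_local z).
  apply: step Ay => F FD; by have [] := yH F FD.
Qed.

Lemma harnack_compact z0 (K : set M) : connected [set: M] -> compact K ->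
  exists2 c : R, 1 <= c & forall z, K z -> forall F, disc_fun F ->
  nrm (1 - F z) <= c * nrm (1 - F z0) /\ nrm (1 - F z0) <= c * nrm (1 - F z).
Proof.
move=> conM /compact_near_coveringP cK.
pose P (c : R) z := forall F, disc_fun F ->
  nrm (1 - F z) <= c * nrm (1 - F z0) /\ nrm (1 - F z0) <= c * nrm (1 - F z).
have H : \forall c \near +oo, K `<=` P c.
  apply: (cK _ _ P) => x Kx.
  have [c c0 cH] := harnack_point z0 conM x.
  exists ([set y | forall F, disc_fun F ->
    nrm (1 - F y) <= 4 * nrm (1 - F x) /\ nrm (1 - F x) <= 4 * nrm (1 - F y)], [set b | 4 * c <= b]).
    split => /=; first exact: harnack_local.
    by apply: nbhs_pinfty_ge; exact: num_real.
  move=> [y b] /= [yH cb] F FD; have [h1 h2] := yH F FD; have [h3 h4] := cH F FD.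
  split.
    apply: le_trans (_ : 4 * c * nrm (1 - F z0) <= _); last by rewrite ler_wpM2r ?nrm_ge0.
    by rewrite -mulrA; apply: le_trans h1 _; rewrite ler_pM2l.
  apply: le_trans (_ : 4 * c * nrm (1 - F y) <= _); last by rewrite ler_wpM2r ?nrm_ge0.
  by apply: le_trans h4 _; rewrite -mulrA [leRHS]mulrCA ler_pM2l.
have P1 : \forall c \near +oo, 1 <= c :> R by apply: nbhs_pinfty_ge; exact: num_real.
by have [c [c1 cP]] := filter_ex (filterI P1 H); exists c.
Qed.

End Manifold.

(** * Transitivity of the iterates *)

Section Smoothstep.
Context {R : realType}.
Local Notation C := (Cplx R).

Lemma nrm_nat k : nrm (k%:R : C) = k%:R.
Proof.
have E : toC (k%:R : R) = k%:R by elim: k => [//|k IH]; rewrite -!nat1r toCD IH.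
by rewrite -E nrm_toC normr_nat.
Qed.

Lemma rotate (a : C) : exists2 u : C, nrm u = 1 & a * u = toC (nrm a).
Proof.
have [->|a0] := eqVneq a 0; first by exists 1; rewrite ?nrm1 // mul0r nrm0.
exists (toC (nrm a) / a); last by rewrite mulrC divfK.
by rewrite nrmM nrmV nrm_toC ger0_norm ?nrm_ge0 // divff // nrm_eq0.
Qed.

Lemma nrm_1BX (x : C) k : nrm x <= 1 -> nrm (1 - x ^+ k) <= k%:R * nrm (1 - x).
Proof.
move=> x1; elim: k => [|k IH]; first by rewrite expr0 subrr nrm0 mul0r.
have -> : 1 - x ^+ k.+1 = (1 - x) + x * (1 - x ^+ k) by rewrite exprS; ring.
apply: le_trans (nrmD _ _) _; rewrite nrmM -nat1r mulrDl mul1r lerD2l.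
by apply: le_trans IH; rewrite ler_piMl ?nrm_ge0.
Qed.

(* Both 0 and 1 are superattracting fixed points of this polynomial. *)
Definition smoothstep (x : C) : C := x ^+ 2 * (3 - 2 * x).

Lemma smoothstep_sym (x : C) : 1 - smoothstep x = smoothstep (1 - x).
Proof. by rewrite /smoothstep; ring. Qed.

(** For [|y| <= 1/10] one has [|3 - 2y| <= 5], so a step multiplies the modulus by at most
    [5 |y| <= 1/2]; the bound 1/10 is carried along to keep the induction going. *)
Lemma smoothstep_iter (x : C) j : nrm x <= 10^-1 -> nrm (iter j smoothstep x) <= 2^-1 ^+ j.
Proof.
move=> x1.
suff [] : nrm (iter j smoothstep x) <= 10^-1 /\ nrm (iter j smoothstep x) <= 2^-1 ^+ j by [].
elim: j => [|j [IH1 IH2]].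
  by split => //=; rewrite expr0; apply: le_trans x1 _; clear; lra.
set y := iter j smoothstep x in IH1 IH2.
have h : nrm (smoothstep y) <= nrm y / 2.
  rewrite /smoothstep nrmM nrmX.
  have n3 : nrm (3 - 2 * y) <= 5.
    apply: le_trans (nrmB _ _) _; rewrite nrmM.
    have -> : nrm (3 : C) = 3 by exact: nrm_nat.
    have -> : nrm (2 : C) = 2 by exact: nrm_nat.
    by move: IH1; clear; lra.
  have y0 := nrm_ge0 y; rewrite expr2 -mulrA; apply: ler_wpM2l => //.
  apply: le_trans (_ : 10^-1 * 5 <= _); last by clear; lra.
  by apply: ler_pM => //; exact: nrm_ge0.
rewrite iterS -/y exprS; split; last first.
  by apply: le_trans h _; rewrite mulrC ler_pM2l ?invr_gt0.
by apply: le_trans h _; have := nrm_ge0 y; move: IH1; clear; lra.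
Qed.

Lemma smoothstep_iter1 (x : C) j : nrm (1 - x) <= 10^-1 -> nrm (1 - iter j smoothstep x) <= 2^-1 ^+ j.
Proof.
move=> h; have -> : 1 - iter j smoothstep x = iter j smoothstep (1 - x).
  by elim: j => [//|j IH]; rewrite !iterS smoothstep_sym IH.
exact: smoothstep_iter.
Qed.

Lemma exists_pow_le (x e : R) : 0 <= x -> x < 1 -> 0 < e -> exists k : nat, x ^+ k <= e.
Proof.
move=> x0 x1 e0.
have : (fun k : nat => x ^+ k) @ \oo --> (0 : R) by apply: cvg_expr; rewrite ger0_norm.
move=> /cvgrPdist_le /(_ e e0)[k _ /(_ k (leqnn k))] /=.
by rewrite sub0r normrN => h; exists k; exact: le_trans (ler_norm _) h.
Qed.

End Smoothstep.

(** * Simultaneous approximation on a compact set and on its image *)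

Section Transitivity.
Context {R : realType} {N : nat}.
Local Notation C := (Cplx R).
Variable M : complexManifold R N.
Implicit Types (z w : M).

(** [(1 + s) / (1 - s) > 2 / d] with [s <= 1] forces [s > 1 - d], and the supremum [s] is approached
    by some [F]. *)
Lemma caratheodory_large z w (d : R) : 0 < d -> d <= 1 ->
  2^-1 * ln (2 / d) < caratheodory z w ->
  exists F : M -> C, [/\ disc_fun F, F w = 0 & 1 - d < nrm (F z)].
Proof.
move=> d0 d1; rewrite /caratheodory ltr_pM2l ?invr_gt0 // => H.
set S := [set r | exists F : M -> C,
  [/\ holomorphic F, forall x, modulus (F x) < 1, F w = 0 & r = modulus (F z)]].
have SE : caratheodory_star z w = sup S by [].
have S0 : S 0.
  exists (fun=> 0); split; first exact: holo_cst.
  - by move=> x; rewrite modulusE nrm0.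
  - by [].
  - by rewrite modulusE nrm0.
have S1 : ubound S 1 by move=> _ [F [_ F1 _ ->]]; exact: ltW.
have hS : has_sup S by split; [exists 0|exists 1].
set s := caratheodory_star z w in H.
have s0 : 0 <= s by rewrite /s SE; apply: ub_le_sup => //; exists 1.
have s1 : s <= 1 by rewrite /s SE; apply: ge_sup => //; exists 0.
have d20 : 0 < 2 / d by rewrite divr_gt0.
(* If the supremum were 1, division by 0 and [ln 0] would both take the default value 0, so
   [caratheodory] would be 0, whereas [ln (2 / d)] is nonnegative. *)
have s1' : s < 1.
  rewrite lt_neqAle s1 andbT; apply/eqP => E; move: H; rewrite E subrr invr0 mulr0 (ln0 (lexx 0)).
  rewrite ltNge => /negP; apply; rewrite ln_ge0 // ler_pdivlMr // mul1r.
  by move: d1; clear; lra.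
have ss : 0 < 1 - s by rewrite subr_gt0.
have q0 : 0 < (1 + s) / (1 - s) by rewrite divr_gt0 // ltr_pwDl.
move: H; rewrite ltr_ln ?posrE // ltr_pdivlMr // mulrAC ltr_pdivrMr // => H.
have ds : 1 - d < s.
  have : (1 + s) * d <= 2 * d by rewrite ler_pM2r //; move: s1; clear; lra.
  by move: H; clear; lra.
have e0 : 0 < s - (1 - d) by rewrite subr_gt0.
have [_ [F [hF F1 Fw ->]]] := sup_adherent e0 hS.
rewrite -SE -/s subKr modulusE => Fz; exists F; split; [split|exact: Fw|exact: Fz]; first exact: hF.
by move=> x; rewrite -modulusE; exact: F1.
Qed.

Lemma holo_iter (f : M -> C) (phi : M -> M) k : holomorphic_map phi -> holomorphic f ->
  holomorphic (fun z => f (iter k phi z)).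
Proof.
move=> hphi hf; elim: k => [|k IH]; first exact: hf.
have -> : (fun z => f (iter k.+1 phi z)) = (fun z => f (iter k phi z)) \o phi.
  by apply/funext => z; rewrite iterSr.
exact: holomorphic_comp.
Qed.

Lemma compact_bound (f : M -> C) (K : set M) : holomorphic f -> compact K ->
  exists2 B : R, 0 < B & forall y, K y -> nrm (f y) <= B.
Proof.
move=> hf cK; have hp : f \in @holo_pred R N M by exact/asboolP.
have [B /posC[B0 BE] BH] := holo_bounded (HoloFun hp) cK.
exists (reC B) => // y Ky; rewrite -toC_le -BE -nrmE; exact: BH.
Qed.

Lemma disc_rotate F (u : C) : nrm u = 1 -> @disc_fun R N M F -> disc_fun (fun z => F z * u).
Proof.
move=> u1 [hF F1]; split; first by apply: holo_mul; [exact: hF|exact: holo_cst].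
by move=> x; rewrite nrmM u1 mulr1.
Qed.

Lemma holo_smoothstep (f : M -> C) j : holomorphic f -> holomorphic (fun z => iter j smoothstep (f z)).
Proof.
move=> hf; elim: j => [|j IH]; first exact: hf.
have -> : (fun z => iter j.+1 smoothstep (f z)) =
   (fun z => iter j smoothstep (f z) ^+ 2 * (3 - 2 * iter j smoothstep (f z))) by [].
apply: holo_mul; first exact: holo_pow.
apply: holo_sub; first exact: holo_cst.
by apply: holo_mul; [exact: holo_cst|exact: IH].
Qed.

Lemma transitive_at (phi : M -> M) (n : nat -> nat) z0 :
  connected [set: M] -> holomorphic_map phi -> injective phi -> runge_domain (range phi) ->
  (caratheodory z0 (iter (n l) phi z0) @[l --> \oo] --> +oo) ->
  forall (g h : M -> C) (K : set M) (e : R), holomorphic g -> holomorphic h -> compact K -> 0 < e ->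
  \forall l \near \oo, exists f : M -> C, [/\ holomorphic f,
    forall z, K z -> nrm (f z - g z) < e &
    forall z, K z -> nrm (f (iter (n l) phi z) - h z) < e].
Proof.
move=> conM hphi iphi runge cinf g h K e hg hh cK e0.
have [c c1 cH] := harnack_compact z0 conM cK.
have c0 : 0 < c by exact: lt_le_trans c1.
have rr0 : 0 <= 1 - c^-1 by rewrite subr_ge0 invf_le1.
have rr1 : 1 - c^-1 < 1 by rewrite gtrBl invr_gt0.
have t0 : 0 < 10^-1 :> R by rewrite invr_gt0.
(* [1 - c^-1] will bound [|F|] on [phi^n K]; 1/10 is the radius assumed by [smoothstep_iter]. *)
have [k kH] := exists_pow_le rr0 rr1 t0.
(* On [K] this yields [|1 - F| <= c d], hence [|1 - F^k| <= k c d <= 1/10]; writing [k + 1] covers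
   the case [k = 0]. *)
pose d : R := ((k%:R + 1) * c * 10)^-1.
have k1 : 1 <= k%:R + 1 :> R by rewrite lerDr ler0n.
have kc : 1 <= (k%:R + 1) * c by rewrite -[leLHS]mulr1; apply: ler_pM.
have d0 : 0 < d by rewrite invr_gt0 !mulr_gt0 // (lt_le_trans ltr01).
have d1 : d <= 1.
  rewrite invf_le1; last by rewrite !mulr_gt0 // (lt_le_trans ltr01).
  by move: kc; clear; lra.
have dk : k%:R * (c * d) <= 10^-1.
  apply: le_trans (_ : (k%:R + 1) * (c * d) <= _).
    by rewrite ler_wpM2r ?lerDl // mulr_ge0 // ltW.
  by rewrite mulrA /d invfM mulrA divff ?mul1r // gt_eqF // (lt_le_trans ltr01).
have : \forall l \near \oo, 2^-1 * ln (2 / d) < caratheodory z0 (iter (n l) phi z0).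
  by move/cvgryPgt : cinf; exact.
apply: filterS => l /(caratheodory_large d0 d1)[F0 [F0D F0w F0z]].
set m := n l in F0w *.
have [u u1 uE] := rotate (F0 z0).
pose F z := F0 z * u.
have FD : disc_fun F by exact: disc_rotate.
have Fz0 : nrm (1 - F z0) <= d.
  rewrite /F uE (_ : 1 - toC _ = toC (1 - nrm (F0 z0))); last by apply: C_ext => /=; ring.
  have h1 : nrm (F0 z0) <= 1 by apply/ltW; exact: F0D.2.
  rewrite nrm_toC ger0_norm ?subr_ge0 //.
  by move: F0z; clear; lra.
have FK z : K z -> nrm (1 - F z) <= c * d.
  by move=> Kz; have [h1 _] := cH z Kz F FD; apply: le_trans h1 _; rewrite ler_pM2l.
have Fphi z : K z -> nrm (F (iter m phi z)) <= 1 - c^-1.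
  move=> Kz; have -> : nrm (F (iter m phi z)) = nrm (F0 (iter m phi z)).
    by rewrite /F nrmM u1 mulr1.
  (* The rotation depends on [z], which is harmless because [c] serves all disc functions at once.
     After it, Harnack's inequality between [z0] and [z] reads [1 <= c (1 - |F|)]. *)
  have [v v1 vE] := rotate (F0 (iter m phi z)).
  have D1 : disc_fun (fun z => F0 (iter m phi z)).
    by split; [exact: (holo_iter _ hphi F0D.1)|move=> x; exact: F0D.2].
  have [_] := cH z Kz _ (disc_rotate v1 D1).
  rewrite F0w mul0r subr0 nrm1 vE (_ : 1 - toC _ = toC (1 - nrm (F0 (iter m phi z)))); last first.
    by apply: C_ext => /=; ring.
  have nb1 : nrm (F0 (iter m phi z)) <= 1 by apply/ltW; exact: F0D.2.
  rewrite nrm_toC ger0_norm ?subr_ge0 // => h1.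
  have : c^-1 <= 1 - nrm (F0 (iter m phi z)) by rewrite -[c^-1]mulr1 ler_pdivrMl.
  by rewrite lerBrDr [c^-1 + _]addrC -lerBrDr.
pose w z := F z ^+ k.
have hw : holomorphic w by apply: holo_pow; exact: FD.1.
have wK z : K z -> nrm (1 - w z) <= 10^-1.
  move=> Kz; apply: le_trans (nrm_1BX _ (ltW (FD.2 z))) _; apply: le_trans dk.
  by apply: ler_wpM2l => //; exact: FK.
have wphi z : K z -> nrm (w (iter m phi z)) <= 10^-1.
  move=> Kz; rewrite /w nrmX; apply: le_trans kH.
  by rewrite lerXn2r ?nnegrE ?nrm_ge0 // Fphi.
have e20 : 0 < e / 2 by rewrite divr_gt0.
have [ht hht htP] := runge_transfer hphi iphi runge m hh cK e20.
have hd : holomorphic (fun z => ht z - g z) by exact: holo_sub.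
have [B1 B10 B1H] := compact_bound hd cK.
have [B2 B20 B2H] := compact_bound (holo_iter m hphi hd) cK.
have [j jH] := exists_half_pow_lt (B1 + B2) e20.
have pj : 0 <= 2^-1 ^+ j :> R by rewrite exprn_ge0 // invr_ge0.
pose x z := iter j smoothstep (w z).
have hx : holomorphic x by exact: holo_smoothstep.
exists (fun z => x z * g z + (1 - x z) * ht z); split.
- apply: holo_add; first by apply: holo_mul; [exact: hx|exact: hg].
  by apply: holo_mul; [apply: holo_sub; [exact: holo_cst|exact: hx]|exact: hht].
- move=> z Kz.
  have -> : x z * g z + (1 - x z) * ht z - g z = (ht z - g z) * (1 - x z) by ring.
  rewrite nrmM; apply: le_lt_trans (_ : B1 * 2^-1 ^+ j < _).
    by apply: ler_pM; rewrite ?nrm_ge0 ?B1H // smoothstep_iter1 // wK.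
  have : B1 * 2^-1 ^+ j <= (B1 + B2) * 2^-1 ^+ j by rewrite ler_wpM2r // lerDl ltW.
  by move: jH e0; clear; lra.
- move=> z Kz; set y := iter m phi z.
  have -> : x y * g y + (1 - x y) * ht y - h z = (ht y - h z) - (ht y - g y) * x y by ring.
  apply: le_lt_trans (nrmB _ _) _; rewrite nrmM.
  have h1 := htP z Kz.
  have h2 : nrm (ht y - g y) * nrm (x y) <= B2 * 2^-1 ^+ j.
    by apply: ler_pM; rewrite ?nrm_ge0 ?(B2H z) // smoothstep_iter // wphi.
  have h3 : B2 * 2^-1 ^+ j <= (B1 + B2) * 2^-1 ^+ j by rewrite ler_wpM2r // lerDr ltW.
  by move: h1 h2 h3 jH; rewrite -/y; clear; lra.
Qed.

End Transitivity.

(** * Separability and the universal function *)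

Section Exhaustion.
Variables (T : topologicalType) (K : nat -> set T).
Hypothesis KS : forall l, K l `<=` interior (K l.+1).
Hypothesis KT : \bigcup_l K l = [set: T].

Lemma exhaustion_mono l m : (l <= m)%N -> K l `<=` K m.
Proof.
move=> lm; rewrite -(subnKC lm); elim: (m - l)%N => [|i IH]; first by rewrite addn0.
by rewrite addnS; apply: subset_trans IH _; apply: subset_trans (@KS _) _; exact: interior_subset.
Qed.

Lemma exhaustion_nbhs (z : T) : exists l, nbhs z (K l).
Proof.
have : (\bigcup_l K l) z by rewrite KT.
by case=> l _ Klz; exists l.+1; exact: KS Klz.
Qed.

Lemma exhaustion_compact (A : set T) : compact A -> exists l, A `<=` K l.
Proof.
move=> /compact_near_coveringP cA.
have H : \forall l \near \oo, A `<=` K l.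
  apply: (cA _ _ (fun l y => K l y)) => x Ax.
  have [l Kl] := exhaustion_nbhs x.
  exists (K l, [set m | (l <= m)%N]); first by split; [|exists l].
  by move=> [y m] /= [Ky lm]; exact: exhaustion_mono lm _ Ky.
exact: filter_ex H.
Qed.

End Exhaustion.

Section Grid.
Variable R : realType.
Local Notation C := (Cplx R).

Lemma half_pow_le i j : (i <= j)%N -> 2^-1 ^+ j <= 2^-1 ^+ i :> R.
Proof. by move=> ij; rewrite ler_wiXn2l // ?invr_ge0 // invf_le1 // ler1n. Qed.

Definition grid_point (d : R) (q : int * int) : C := mkC (q.1%:~R * d) (q.2%:~R * d).

Lemma grid_approx (d : R) (z : C) : 0 < d -> exists q, nrm (z - grid_point d q) <= 2 * d.
Proof.
move=> d0.
have H (x : R) : exists a : int, `|x - a%:~R * d| <= d.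
  exists (Num.floor (x / d)).
  have h1 : (Num.floor (x / d))%:~R * d <= x by rewrite -ler_pdivlMr // floor_le_tmp.
  have h2 : x < ((Num.floor (x / d))%:~R + 1) * d.
    by rewrite -ltr_pdivrMr // -[1]/(1%:~R) -intrD; exact: floorD1_gt.
  by rewrite ger0_norm ?subr_ge0 // lerBlDr; move: h2; rewrite mulrDl mul1r addrC => /ltW.
have [a ha] := H (reC z); have [b hb] := H (imC z).
exists (a, b); have -> : z - grid_point d (a, b) =
   toC (reC z - a%:~R * d) + mkC 0 1 * toC (imC z - b%:~R * d) by case: z {ha hb} => x y; rewrite /grid_point; apply: C_ext; rewrite /reC /imC /=; ring.
apply: le_trans (nrmD _ _) _; rewrite nrmM !nrm_toC.
have -> : nrm (mkC 0 1 : C) = 1 by rewrite -modulusE /modulus /= expr0n expr1n add0r sqrtr1.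
by move: ha hb; clear; lra.
Qed.

(** The limit is chosen before the starting index [j], so one value satisfies the tail bound from
    every index at which the increments become geometric. *)
Lemma geometric_limit (u : nat -> C) :
  (exists j, forall i, (j <= i)%N -> nrm (u i.+1 - u i) <= 2^-1 ^+ i) ->
  exists l, forall j, (forall i, (j <= i)%N -> nrm (u i.+1 - u i) <= 2^-1 ^+ i) ->
    nrm (u j - l) <= 2 * 2^-1 ^+ j.
Proof.
have tail j : (forall i, (j <= i)%N -> nrm (u i.+1 - u i) <= 2^-1 ^+ i) ->
    forall p, nrm (u (j + p)%N - u j) <= 2 * 2^-1 ^+ j - 2 * 2^-1 ^+ (j + p).
  move=> H; elim=> [|p IH]; first by rewrite addn0 !subrr nrm0.
  rewrite addnS -(subrKA (u (j + p)%N)); apply: le_trans (nrmD _ _) _.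
  have := H (j + p)%N (leq_addr _ _); rewrite exprS.
  by move: IH; clear; lra.
have pos i : 0 <= 2^-1 ^+ i :> R by rewrite exprn_ge0 // invr_ge0.
move=> [j0 Hj0].
have [|l lH] := C_complete (u := u).
  move=> e e0; have [i iH] := exists_half_pow_lt 4 e0.
  exists (j0 + i)%N => n m Nn Nm.
  have Hi : forall k, ((j0 + i) <= k)%N -> nrm (u k.+1 - u k) <= 2^-1 ^+ k.
    by move=> k hk; apply: Hj0; apply: leq_trans hk; exact: leq_addr.
  have B k : ((j0 + i) <= k)%N -> nrm (u k - u (j0 + i)%N) <= 2 * 2^-1 ^+ i.
    move=> hk; have := tail _ Hi (k - (j0 + i))%N; rewrite subnKC // => h.
    apply: le_trans h _; rewrite -[leRHS]subr0; apply: lerB; last by rewrite mulr_ge0.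
    by rewrite ler_pM2l // half_pow_le // leq_addl.
  rewrite -(subrKA (u (j0 + i)%N)); apply: le_trans (nrmD _ _) _.
  rewrite [X in _ + X]nrm_distC.
  by have := B n Nn; have := B m Nm; move: iH; clear; lra.
exists l => j Hj; apply/ler_addgt0Pr => e e0.
have [n0 n0H] := lH e e0.
have h1 := n0H (j + n0)%N (leq_addl _ _).
have h2 := tail j Hj n0.
rewrite -(subrKA (u (j + n0)%N)); apply: le_trans (nrmD _ _) _.
rewrite [X in X + _]nrm_distC; have := pos (j + n0)%N.
by move: h1 h2; clear; lra.
Qed.

End Grid.

Section Separability.
Variables (R : realType) (N : nat).
Local Notation C := (Cplx R).
Variable M : complexManifold R N.

(** Each point of [A] has a neighbourhood on which [equicontinuous_at], after division by [B],
    controls all admissible functions; compactness leaves finitely many centres. *)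
Lemma equicontinuous_net (A U : set M) (B e : R) : compact A -> A `<=` interior U -> 0 < B -> 0 < e ->
  exists s : seq M, forall y, A y -> exists2 x, x \in s &
    forall f : M -> C, holomorphic f -> (forall w, U w -> nrm (f w) <= B) -> nrm (f y - f x) <= e.
Proof.
move=> cA AU B0 e0; have eB : 0 < e / B by rewrite divr_gt0.
pose V x := [set y | forall f : M -> C, holomorphic f -> (forall w, U w -> nrm (f w) <= B) ->
  nrm (f y - f x) <= e].
have VN x : A x -> nbhs x (V x).
  move=> Ax; apply: filterS (equicontinuous_at (AU _ Ax) eB) => y Hy f hf fB.
  have hg : holomorphic (fun z => f z * toC B^-1) by apply: holo_mul; [exact: hf|exact: holo_cst].
  have nB : nrm (toC B^-1) = B^-1 by rewrite nrm_toC ger0_norm // invr_ge0 ltW.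
  have gB w : U w -> nrm (f w * toC B^-1) <= 1.
    by move=> Uw; rewrite nrmM nB ler_pdivrMr // mul1r; exact: fB.
  by have := Hy _ hg gB; rewrite -mulrBl nrmM nB ler_pdivrMr // divfK ?gt_eqF.
move/compact_near_coveringP : cA => cA.
(* Finite lists directed by inclusion: a property holds near [G] when it holds for all lists
   containing a suitable one, so compactness can be used in the form of near coverings. *)
pose G := filter_from [set: seq M] (fun s => [set t : seq M | {subset s <= t}]).
have FG : ProperFilter G.
  apply: filter_from_proper => [|s _]; last by exists s.
  apply: filter_from_filter => [|s t _ _]; first by exists [::].
  exists (s ++ t) => // r /= str; split=> x xs; apply: str.
    by rewrite mem_cat xs.
  by rewrite mem_cat xs orbT.
have H : \forall s \near G, A `<=` [set y | exists2 x, x \in s & V x y].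
  apply: (cA _ G (fun s y => exists2 x, x \in s & V x y) _) => x Ax.
  exists (V x, [set s : seq M | x \in s]) => /=.
    split; first exact: VN.
    by exists [:: x] => // s /= ; apply; rewrite inE.
  by move=> [y s] /= [Vy xs]; exists x.
by have [s sP] := @filter_ex _ G FG _ H; exists s.
Qed.

(* Functions bounded by [m.+1] on [K l.+1] are determined on [K l], up to a multiple
   of [2^-k], by their values on a finite net; these values are rounded to a grid. *)
Lemma holomorphic_separable : has_compact_exhaustion M ->
  exists2 E : nat -> M -> C, (forall i, holomorphic (E i)) &
    forall (g : M -> C) (A : set M) (e : R), holomorphic g -> compact A -> 0 < e ->
      exists i, forall y, A y -> nrm (E i y - g y) < e.
Proof.
case=> K [cK KS KT].
have p2 k : 0 < 2^-1 ^+ k :> R by rewrite exprn_gt0 // invr_gt0.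
have m1 m : 0 < m.+1%:R :> R by [].
have net (t : nat * nat * nat) : exists s : seq M, forall y, K t.1.1 y -> exists2 x, x \in s &
    forall f : M -> C, holomorphic f -> (forall w, K t.1.1.+1 w -> nrm (f w) <= t.1.2.+1%:R) ->
    nrm (f y - f x) <= 2^-1 ^+ t.2.
  exact: equicontinuous_net (cK _) (@KS _) (m1 _) (p2 _).
have [S SP] := choice net.
(* A code [t] records the compact set, the bound, the precision and the rounded values on the
   net. *)
pose P (t : nat * nat * nat * seq (int * int)) (f : M -> C) :=
  [/\ holomorphic f, forall w, K t.1.1.1.+1 w -> nrm (f w) <= t.1.1.2.+1%:R &
  forall x, x \in S t.1 ->
    nrm (f x - grid_point (2^-1 ^+ t.1.2) (nth (0, 0) t.2 (index x (S t.1)))) <= 2 * 2^-1 ^+ t.1.2].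
have sel t : exists f : M -> C, holomorphic f /\ ((exists f', P t f') -> P t f).
  have [[f Pf]|nP] := pselect (exists f, P t f).
    by exists f; split; [case: Pf|].
  by exists (fun=> 0); split; [exact: holo_cst|move/nP].
have [E EP] := choice sel.
exists (fun i => E (odflt (0, 0, 0, [::])%N (unpickle i))) => [i|g A e hg cA e0].
  by have [] := EP (odflt (0, 0, 0, [::])%N (unpickle i)).
have [l Al] := exhaustion_compact KS KT cA.
have [B B0 gB] := compact_bound hg (cK l.+1).
have [m Bm] : exists m : nat, B <= m.+1%:R.
  by exists (Num.truncn B); apply: ltW; exact: truncnS_gt.
(* The 6 is 1 + 2 + 2 + 1: two moves to the net point and two roundings. *)
have [k ke] := exists_half_pow_lt 6 e0.
have [F FP] := choice (fun x => grid_approx (g x) (p2 k)).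
pose t := (l, m, k, [seq F x | x <- S (l, m, k)]).
have gP : P t g.
  split=> [|w Kw|x xS]; [exact: hg|exact: le_trans (gB w Kw) Bm|].
  by rewrite /= (nth_map x) ?index_mem // nth_index //; exact: FP.
exists (pickle t) => y Ay; rewrite pickleK /=.
(* The selected function need not be [g]; sharing its code is enough. *)
have [_ /(_ (ex_intro _ _ gP)) [hE EB ES]] := EP t.
have [_ gB' gS] := gP.
have [x xS xP] := SP (l, m, k) y (Al y Ay).
have h1 := xP _ hE EB; have h2 := xP _ hg gB'.
have h3 := ES x xS; have h4 := gS x xS.
move: h1 h2 h3 h4; rewrite /t /=; set q := grid_point _ _; set f := E _ => h1 h2 h3 h4.
have -> : f y - g y = (f y - f x) + (f x - q) - (g x - q) - (g y - g x) by ring.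
have := nrmB ((f y - f x) + (f x - q) - (g x - q)) (g y - g x).
have := nrmB ((f y - f x) + (f x - q)) (g x - q).
have := nrmD (f y - f x) (f x - q).
by move: h1 h2 h3 h4 ke; clear; lra.
Qed.

End Separability.

(** * Construction of a universal function *)

Section Universality.
Variables (R : realType) (N : nat).
Local Notation C := (Cplx R).
Variable M : complexManifold R N.

(** A Baire category argument made explicit. At stage [j] the current function changes by at most
    [2^-j] on a protected compact set [L j], and its composition with some [tau l] becomes close to
    the target [h j] on [K j]. The image of [K j] is then added to the protected set, so the later
    corrections, whose sum is geometric, preserve this. *)
Lemma universal_function (tau : nat -> M -> M) : has_compact_exhaustion M ->
  (forall l, continuous (tau l)) ->
  (forall (g h : M -> C) (K : set M) (e : R), holomorphic g -> holomorphic h -> compact K -> 0 < e ->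
    exists l, exists f : M -> C, [/\ holomorphic f,
      forall z, K z -> nrm (f z - g z) < e &
      forall z, K z -> nrm (f (tau l z) - h z) < e]) ->
  exists2 f : M -> C, holomorphic f &
    forall (g : M -> C) (A : set M) (e : R), holomorphic g -> compact A -> 0 < e ->
      exists l, forall z, A z -> nrm (f (tau l z) - g z) < e.
Proof.
move=> exh tauc trans.
have [E hE dE] := holomorphic_separable exh.
have [K [cK KS KT]] := exh.
have p2 k : 0 < 2^-1 ^+ k :> R by rewrite exprn_gt0 // invr_gt0.
(* [logn 2] takes each value infinitely often. *)
pose h j := E (logn 2 j).
have step (t : (M -> C) * set M * nat) : exists r : (M -> C) * nat,
    holomorphic t.1.1 -> compact t.1.2 -> [/\ holomorphic r.1,
      forall z, t.1.2 z -> nrm (r.1 z - t.1.1 z) <= 2^-1 ^+ t.2 &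
      forall z, K t.2 z -> nrm (r.1 (tau r.2 z) - h t.2 z) <= 2^-1 ^+ t.2].
  case: t => -[f L] j /=.
  have [hf|nhf] := pselect (holomorphic f); last by exists (f, 0%N) => /nhf.
  have [cL|ncL] := pselect (compact L); last by exists (f, 0%N) => _ /ncL.
  (* The transitivity hypothesis uses one compact set for both estimates, hence the union of the
     protected set and [K j]. *)
  have [l [f' [hf' H1 H2]]] := trans f (h j) (L `|` K j) _ hf (hE _) (compactU cL (cK j)) (p2 j).
  exists (f', l) => _ _; split => [|z Lz|z Kz]; first exact: hf'.
    by apply/ltW/H1; left.
  by apply/ltW/H2; right.
have [S SP] := choice step.
pose st := fix st (j : nat) : (M -> C) * set M := if j is i.+1 then
  let r := S (st i, i) in (r.1, (st i).2 `|` (K i `|` tau r.2 @` K i)) else (fun=> 0, set0).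
pose F j := (st j).1; pose L j := (st j).2; pose ll j := (S (st j, j)).2.
have FS j : F j.+1 = (S (st j, j)).1 by [].
have LS j : L j.+1 = L j `|` (K j `|` tau (ll j) @` K j) by [].
have inv j : holomorphic (F j) /\ compact (L j).
  elim: j => [|j [IH1 IH2]]; first by split; [exact: holo_cst|exact: compact0].
  have [H _ _] := SP (st j, j) IH1 IH2.
  split; first exact: H.
  rewrite LS; apply: compactU => //; apply: compactU => //.
  by apply: continuous_compact => //; exact/continuous_subspaceT/tauc.
have Linc i j : (i <= j)%N -> L i `<=` L j.
  move=> ij; rewrite -(subnKC ij); elim: (j - i)%N => [|p IH]; first by rewrite addn0.
  by rewrite addnS LS => z Lz; left; exact: IH.
have F1 j z : L j z -> nrm (F j.+1 z - F j z) <= 2^-1 ^+ j.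
  by have [h1 h2] := inv j; have [_ H _] := SP (st j, j) h1 h2; exact: H.
have F2 j z : K j z -> nrm (F j.+1 (tau (ll j) z) - h j z) <= 2^-1 ^+ j.
  by have [h1 h2] := inv j; have [_ _ H] := SP (st j, j) h1 h2; exact: H.
have KL l j : (l < j)%N -> K l `<=` L j.
  by move=> lj; apply: subset_trans (Linc _ _ lj); rewrite LS => z Kz; right; left.
have FL j z : L j z -> forall i, (j <= i)%N -> nrm (F i.+1 z - F i z) <= 2^-1 ^+ i.
  by move=> Lz i ji; apply: F1; exact: Linc ji _ Lz.
have lim z : exists w, forall j, (forall i, (j <= i)%N -> nrm (F i.+1 z - F i z) <= 2^-1 ^+ i) ->
    nrm (F j z - w) <= 2 * 2^-1 ^+ j.
  apply: (geometric_limit (u := fun j => F j z)).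
  have [l /nbhs_singleton Kl] := exhaustion_nbhs KS KT z.
  by exists l.+1; apply: FL; exact: KL Kl.
have [f fP] := choice lim.
have Ff j z : L j z -> nrm (F j z - f z) <= 2 * 2^-1 ^+ j.
  by move=> Lz; apply: fP; exact: FL.
exists f.
  apply: holomorphic_limit => z; have [l Kl] := exhaustion_nbhs KS KT z.
  exists (K l) => // e e0; have [j je] := exists_half_pow_lt 2 e0.
  exists (F (l.+1 + j)%N); first by have [] := inv (l.+1 + j)%N.
  move=> y Ky; apply: le_trans (Ff _ _ _) _; first by apply: KL Ky; rewrite addSn ltnS leq_addr.
  apply: le_trans (ltW je); by rewrite ler_pM2l // half_pow_le // leq_addl.
move=> g A e hg cA e0.
have e20 : 0 < e / 2 by rewrite divr_gt0.
have [i iP] := dE g A _ hg cA e20.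
have [l Al] := exhaustion_compact KS KT cA.
have [p pe] := exists_half_pow_lt 2 e20.
(* The odd cofactor gives [logn 2 j = i], so the target at stage [j] is [E i], while making [j] at
   least [l + p]. *)
pose j := (2 ^ i * (2 * (l + p)).+1)%N.
have lpj : (l + p <= j)%N.
  apply: leq_trans (_ : (2 * (l + p)).+1 <= _)%N; last by rewrite leq_pmull // expn_gt0.
  by apply: leqW; rewrite leq_pmull.
have hj : h j = E i.
  rewrite /h /j lognM ?expn_gt0 // pfactorK // logn_coprime ?addn0 //.
  by rewrite coprime2n /= oddM.
exists (ll j) => z Az.
have Kz : K j z by apply: (exhaustion_mono KS _ (Al z Az)); apply: leq_trans lpj; exact: leq_addr.
have h1 := F2 j z Kz; have h2 := iP z Az; rewrite hj in h1.
have h3 : nrm (F j.+1 (tau (ll j) z) - f (tau (ll j) z)) <= 2 * 2^-1 ^+ j.+1.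
  by apply: Ff; rewrite LS; right; right; exists z.
have h4 : 2^-1 ^+ j <= 2^-1 ^+ p :> R.
  by rewrite half_pow_le //; apply: leq_trans lpj; exact: leq_addl.
move: h3; rewrite exprS; set y := tau _ z in h1 * => h3.
have -> : f y - g z = (F j.+1 y - E i z) - (F j.+1 y - f y) + (E i z - g z) by ring.
have := nrmD ((F j.+1 y - E i z) - (F j.+1 y - f y)) (E i z - g z).
have := nrmB (F j.+1 y - E i z) (F j.+1 y - f y).
by move: h1 h2 h3 h4 pe; clear; lra.
Qed.

Lemma holo_cvg (G : set_system (holoFun M)) (g : holoFun M) : Filter G ->
  (forall (K : set M) (e : R), compact K -> 0 < e ->
    G [set f | forall y, K y -> nrm (f y - g y) < e]) -> G --> g.
Proof.
move=> FG H.
suff h : @holo_fam R N M f @[f --> G] --> @holo_fam R N M g.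
  move=> U [?/= [[W oW <-]]] /= Wg /filterS; apply; apply: h.
  exact: open_nbhs_nbhs.
apply/fam_cvgP => K cK P /uniform_nbhs[E [entE EP]].
move: entE; rewrite -entourage_ballE => -[e /= e0 eE].
have [e'0 e'E] := posC e0.
have := H K _ cK e'0; apply: filterS => f Hf; apply: EP => y Ky.
by apply: eE; rewrite /= -ball_normE /ball_ /= e'E nrmE toC_lt nrm_distC; exact: Hf.
Qed.

Lemma iter_comp_op (phi : M -> M) (hphi : holomorphic_map phi) m (f : holoFun M) z :
  iter m (comp_op hphi) f z = f (iter m phi z).
Proof. by elim: m z => // m IH z; rewrite iterS iterSr -IH. Qed.

Lemma iter_continuous (T : topologicalType) (u : T -> T) m : continuous u -> continuous (iter m u).
Proof.
by move=> cu; elim: m => [x|m IH x]; [exact: cvg_id|apply: continuous_comp; [exact: IH|exact: cu]].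
Qed.

End Universality.

(** The limit hypothesis passes to each subsequence, so the transitivity argument applies with
    [n (k l)] in place of [n l]. *)
Theorem theorem3p7 (R : realType) (N : nat) (Omega : complexManifold R N)
    (phi : Omega -> Omega) (n : nat -> nat)
    (Omega_connected : connected [set: Omega])
    (Omega_stein : stein Omega)
    (phi_holo : holomorphic_map phi)
    (n_incr : increasing_seq n)
    (phi_inj : injective phi)
    (phi_runge : runge_domain (range phi)) :
  (exists z0 : Omega,
     caratheodory z0 (iter (n l) phi z0) @[l --> \oo] --> +oo) ->
  hereditarily_hypercyclic (comp_op phi_holo) n.
Proof.
move=> [z0 cinf]; split=> [|k k_incr]; first exact: comp_op_continuous.
split=> [l|]; first by apply: iter_continuous; exact: comp_op_continuous.
have kge l : (l <= k l)%N.
  elim: l => // l IH; apply: leq_ltn_trans IH _.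
  by have := k_incr l.+1 l; rewrite !leEnat ltnn ltnNge => ->.
have kcinf : caratheodory z0 (iter (n (k l)) phi z0) @[l --> \oo] --> +oo.
  move=> P /cinf[l0 _ l0P]; exists l0 => // l /= l0l; apply: l0P => /=.
  exact: leq_trans l0l (kge l).
have [exh _ _ _] := Omega_stein.
have [|g h K e hg hh cK e0|f hf fU] :=
  universal_function (tau := fun l => iter (n (k l)) phi) exh.
- by move=> l; apply: iter_continuous; case: phi_holo.
- exact: filter_ex (transitive_at Omega_connected phi_holo phi_inj phi_runge kcinf hg hh cK e0).
have fP : f \in @holo_pred R N Omega by exact/asboolP.
exists (HoloFun fP) => O [g Og] oO.
have [K [cK KS KT]] := exh.
have p2 i : 0 < 2^-1 ^+ i :> R by rewrite exprn_gt0 // invr_gt0.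
(* Approximating a member [g] of the open set on [K i] within [2^-i] gives iterates that converge to
   [g] in the topology of compact convergence, so one of them lies in the set. *)
have [ll llP] := choice (fun i => fU g _ _ (holo_holomorphic g) (cK i) (p2 i)).
pose T l := iter (n (k l)) (comp_op phi_holo) (HoloFun fP).
have Tg : T (ll i) @[i --> \oo] --> g.
  apply: holo_cvg => A e cA e0.
  have [l Al] := exhaustion_compact KS KT cA.
  have [p pe] := exists_half_pow_lt 1 e0.
  exists (l + p)%N => // i /= lpi y Ay; rewrite iter_comp_op.
  apply: lt_trans pe; rewrite mul1r.
  have Ky : K i y by apply: (exhaustion_mono KS _ (Al y Ay)); apply: leq_trans lpi; exact: leq_addr.
  apply: lt_le_trans (llP i y Ky) _.
  by rewrite half_pow_le //; apply: leq_trans lpi; exact: leq_addl.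
have H : \forall i \near \oo, O (T (ll i)) by apply: Tg; exact: open_nbhs_nbhs.
have [i Oi] := filter_ex H.
by exists (T (ll i)); split=> //; exists (ll i).
Qed.
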